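(* Let $\Omega\subset\mathbb{R}^n$ ($n\ge2$) be a conical domain without cracks. Then the layer potentials groupoid $\mathcal{G}\rightrightarrows M=\partial'\Sigma(\Omega)$ associated to $\Omega$ is a boundary action groupoid.
   Context: Conical domains. An open connected bounded $\Omega\subset\mathbb{R}^n$ is a domain with conical points if there are finitely many points $p_1,\dots,p_l\in\partial\Omega$ such that $\Omega_0:=\partial\Omega\setminus\{p_1,\dots,p_l\}$ is smooth and each $p_i$ has a neighborhood $V_{p_i}$, a possibly disconnected domain $\omega_i\subsetneq S^{n-1}$ with smooth boundary and a diffeomorphism $\phi_{p_i}:V_{p_i}\to B^n$ (unit ball) with $\phi_{p_i}(\Omega\cap V_{p_i})=\{rx':0<r<1,\ x'\in\omega_i\}$; the closures $\overline{V_{p_i}}$ are pairwise disjoint. It is without cracks if $\partial\Omega=\partial\overline{\Omega}$. Desingularized boundary. Let $\varphi_i:(0,1)\times\partial\omega_i\to V_{p_i}\cap\Omega_0$ be the diffeomorphism induced by $\phi_{p_i}$ (polar coordinates). Then $M=\partial'\Sigma(\Omega)$ is obtained by gluing $\bigsqcup_{i}[0,1)\times\partial\omega_i$ to $\Omega_0$ along the $\varphi_i$; it is a compact manifold with boundary $\partial M=\bigsqcup_i\{0\}\times\partial\omega_i$ and interior $\Omega_0$. Groupoids. A groupoid $\mathcal{G}\rightrightarrows M$ has domain and range maps $d,r$; $(g,h)$ is composable if $d(g)=r(h)$; $\mathcal{G}_A=d^{-1}(A)$; the reduction to $A\subset M$ is $\mathcal{G}|_A=d^{-1}(A)\cap r^{-1}(A)$;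 $A$ is invariant if $r(d^{-1}(A))=A$. Manifolds are second countable and may have corners (locally modelled on $[0,\infty)^n$). A Lie groupoid has $\mathcal{G},M$ manifolds, $M$ Hausdorff, smooth structure maps, and $d$ a tame submersion (a submersion such that $d_*v$ is inward pointing iff $v$ is). For a right action of a Lie group $G$ on $X$, the action groupoid $X\rtimes G\rightrightarrows X$ has arrows $X\times G$, $r(x,g)=x$, $d(x,g)=x\cdot g^{-1}$, $(x,h)(x\cdot h^{-1},g)=(x,gh)$. Layer potentials groupoid. Let $\mathcal{H}=[0,\infty)\rtimes(0,\infty)$ with $(0,\infty)$ acting by dilation, $(\partial\omega_i)^2$ the pair groupoid, and $\mathcal{J}_i$ the reduction of $\mathcal{H}\times(\partial\omega_i)^2$ to $[0,1)\times\partial\omega_i$. Over $(0,1)\times\partial\omega_i$ it is the pair groupoid, identified via $\varphi_i$ with the pair groupoid of $V_{p_i}\cap\Omega_0$. The layer potentials groupoid is $\mathcal{G}=\left(\bigsqcup_i\mathcal{J}_i\right)\cup_\varphi(\Omega_0\times\Omega_0)\rightrightarrows M$, the Lie groupoid obtained by gluing along these identifications. Boundary action groupoid: a Lie groupoid $\mathcal{G}\rightrightarrows M$ such that (1) there is an open dense $\mathcal{G}$-invariant $U\subset M$ with $\mathcal{G}_U\simeq U\times U$ (pair groupoid); (2) there is an open cover $(U_i)_{i\in I}$ of $M$ such that for each $i$ there are a Hausdorff manifold $X_i$, a Lie group $G_i$ acting smoothly on $X_i$ on the right, and an open subset $U_i'\subset X_i$ diffeomorphic to $U_i$, with $\mathcal{G}|_{U_i}\simeq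 (X_i\rtimes G_i)|_{U_i'}$ as Lie groupoids; (3) the family $(\mathcal{G}|_{U_i})_{i\in I}$ satisfies the weak gluing condition: for each composable pair $(g,h)$ of $\mathcal{G}$ there is $i\in I$ with $g,h\in\mathcal{G}|_{U_i}$. *)

(* Defs.v *)
From HB Require Import structures.
From mathcomp Require Import all_boot all_order all_algebra.
From mathcomp Require Import all_classical all_reals all_analysis.

Set Implicit Arguments.
Unset Strict Implicit.
Unset Printing Implicit Defensive.

Import Order.TTheory GRing.Theory Num.Theory.
Import numFieldNormedType.Exports.

Local Open Scope classical_set_scope.
Local Open Scope ring_scope.

(** Manifolds are sets with an atlas, in the style of Bourbaki and Lang: the
    topology is the one induced by the charts.  The underlying set is a subset
    [car M] of an ambient type, and a map between manifolds is a function
    between the ambient types, of which only the values on the carrier matter.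
    In this way open submanifolds and reductions of groupoids stay on the same
    ambient type.  The records [mfd], [grp] and [gpd] only carry data; the
    axioms are the predicates [manifold], [Lie_group] and [Lie_groupoid]. *)

Section Euclidean.
Context {R : realType}.

Fixpoint Ck_on (k a b : nat) (W : set 'rV[R]_a) (f : 'rV[R]_a -> 'rV[R]_b) :
    Prop :=
  if k is k'.+1 then
    (forall x, W x -> differentiable f x) /\ (forall v, Ck_on k' W ('D_v f))
  else forall x, W x -> {for x, continuous f}.

(* Meaningful for [W] open. *)
Definition Coo_on (a b : nat) (W : set 'rV[R]_a) (f : 'rV[R]_a -> 'rV[R]_b) :
    Prop :=
  forall k, Ck_on k W f.

Definition diffeo_on (n : nat) (V W : set 'rV[R]_n)
    (f g : 'rV[R]_n -> 'rV[R]_n) : Prop :=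
  [/\ open V /\ open W,
      Coo_on V f /\ Coo_on W g,
      f @` V `<=` W /\ g @` W `<=` V,
      (forall x, V x -> g (f x) = x)
    & (forall y, W y -> f (g y) = y)].

(* [`|x|] is the sup norm on ['rV_n], hence the explicit sums of squares. *)
Definition unit_ball (n : nat) : set 'rV[R]_n :=
  [set x | \sum_i x 0 i ^+ 2 < 1].

Definition unit_sphere (n : nat) : set 'rV[R]_n :=
  [set x | \sum_i x 0 i ^+ 2 = 1].

Definition frontier (T : topologicalType) (A : set T) : set T :=
  closure A `&` closure (~` A).

End Euclidean.

Arguments unit_ball {R} n _.
Arguments unit_sphere {R} n _.

(* A chart takes values in the sector of the [y] in ['rV_cdim] such that
   [0 <= y 0 i] for all [i] with [ccor i].  The map is total, but only its
   values on [cdom] are relevant. *)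
Record chart (R : realType) (T : Type) := Chart {
  cdim : nat;
  cdom : set T;
  cmap : T -> 'rV[R]_cdim;
  ccor : 'I_cdim -> bool }.

Record mfd (R : realType) (T : Type) := Mfd {
  car : set T;
  atl : set (chart R T) }.

Section Manifolds.
Context {R : realType}.

Definition sector (n : nat) (s : 'I_n -> bool) : set 'rV[R]_n :=
  [set y | forall i, s i -> 0 <= y 0 i].

Definition chart_of (T : Type) (M : mfd R T) (c : chart R T) : Prop :=
  [/\ cdom c `<=` car M,
      set_inj (cdom c) (cmap c)
    & exists2 O, open O & cmap c @` cdom c = O `&` sector (@ccor _ _ c)].

Definition mopen (T : Type) (M : mfd R T) (A : set T) : Prop :=
  A `<=` car M /\
  forall c, atl M c -> forall p, A p -> cdom c p ->
    exists O, [/\ open O, O (cmap c p)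
                & forall q, cdom c q -> O (cmap c q) -> A q].

Definition msecond_countable (T : Type) (M : mfd R T) : Prop :=
  exists B : nat -> set T, (forall k, mopen M (B k)) /\
    forall A p, mopen M A -> A p -> exists k, B k p /\ B k `<=` A.

Definition mhausdorff (T : Type) (M : mfd R T) : Prop :=
  forall p q, car M p -> car M q -> p <> q ->
    exists A B, [/\ mopen M A, mopen M B, A p, B q & A `&` B = set0].

Definition mdense (T : Type) (M : mfd R T) (A : set T) : Prop :=
  forall B, mopen M B -> B !=set0 -> (A `&` B) !=set0.

(* [F] is a smooth function on a Euclidean neighbourhood [W] of [cmap c p]
   which represents [f], restricted to [S], in the charts [c] and [c'].  The
   last clause also gives the continuity of [f] at [p]. *)
Definition local_rep (T T' : Type) (S : set T) (f : T -> T')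
    (c : chart R T) (c' : chart R T') (p : T)
    (W : set 'rV[R]_(cdim c)) (F : 'rV[R]_(cdim c) -> 'rV[R]_(cdim c')) :
    Prop :=
  [/\ open W, W (cmap c p), Coo_on W F
    & forall q, S q -> cdom c q -> W (cmap c q) ->
        cdom c' (f q) /\ cmap c' (f q) = F (cmap c q)].

(* Smoothness on a subset [S] of [M], which in the sequel is either [car M] or
   an embedded submanifold of [M]: locally, [f] extends to a smooth function
   of the coordinates. *)
Definition smooth_on (T T' : Type) (M : mfd R T) (N : mfd R T') (S : set T)
    (f : T -> T') : Prop :=
  (forall p, S p -> car N (f p)) /\
  forall c c', atl M c -> atl N c' ->
  forall p, S p -> cdom c p -> cdom c' (f p) ->
    exists W F, local_rep S f (c := c) (c' := c') p W F.

Definition smooth (T T' : Type) (M : mfd R T) (N : mfd R T') (f : T -> T') :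
    Prop :=
  smooth_on M N (car M) f.

(* The smoothness of the identity is the compatibility of the charts.
   Manifolds are not required to be Hausdorff. *)
Definition manifold (T : Type) (M : mfd R T) : Prop :=
  [/\ forall c, atl M c -> chart_of M c,
      forall p, car M p -> exists2 c, atl M c & cdom c p,
      smooth M M idfun,
      msecond_countable M
    & exists n, forall c, atl M c -> cdim c = n].

Definition boundaryless (T : Type) (M : mfd R T) : Prop :=
  forall c, atl M c -> forall p, cdom c p ->
  forall i, ccor (c := c) i -> 0 < cmap c p 0 i.

(* Tangent vectors are read in charts. *)
Definition inward (T : Type) (c : chart R T) (p : T) (v : 'rV[R]_(cdim c)) :
    Prop :=
  forall i, ccor (c := c) i -> cmap c p 0 i = 0 -> 0 <= v 0 i.

(* The derivative of [F] at [cmap c p] does not depend on the choice of the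
   extension [F], because sectors have dense interior. *)
Definition tame_submersion (T T' : Type) (M : mfd R T) (N : mfd R T')
    (f : T -> T') : Prop :=
  smooth M N f /\
  forall c c', atl M c -> atl N c' ->
  forall p, cdom c p -> cdom c' (f p) ->
  forall W F, local_rep (car M) f (c := c) (c' := c') p W F ->
    (forall w, exists v, 'D_v F (cmap c p) = w) /\
    (forall v, inward (c := c') (f p) ('D_v F (cmap c p)) <->
               inward (c := c) p v).

Definition restr (T : Type) (M : mfd R T) (A : set T) : mfd R T :=
  Mfd (car M `&` A)
      [set c | exists2 c0, atl M c0 &
                 c = Chart (cdom c0 `&` A) (cmap c0) (@ccor _ _ c0)].

Definition prod_chart (T T' : Type) (c : chart R T) (c' : chart R T') :
    chart R (T * T') :=
  Chart (cdom c `*` cdom c')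
        (fun z => row_mx (cmap c z.1) (cmap c' z.2))
        (fun i => match fintype.split i with
                  | inl j => ccor (c := c) j
                  | inr j => ccor (c := c') j
                  end).

Definition mprod (T T' : Type) (M : mfd R T) (N : mfd R T') :
    mfd R (T * T') :=
  Mfd (car M `*` car N)
      [set c | exists c1 c2, [/\ atl M c1, atl N c2 & c = prod_chart c1 c2]].

(* The charts [cmap c \o j^-1] on [j @` cdom c]. *)
Definition push_atlas (T T' : Type) (j : T -> T') (A : set (chart R T)) :
    set (chart R T') :=
  [set c' | exists c h, [/\ A c,
      (forall x, cdom c x -> h (j x) = cmap c x)
    & c' = Chart (j @` cdom c) h (@ccor _ _ c)]].

Definition mdsum (I T : Type) (M : I -> mfd R T) : mfd R (I * T) :=
  Mfd [set z | car (M z.1) z.2]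
      (\bigcup_i push_atlas (pair i) (atl (M i))).

(* [glue M N A f] is the quotient of the disjoint union of [M] and [N] by the
   identification of each [x] in [A] with [f x]; the class of a point is
   represented by its element in [N] if there is one.  The map from [M] to
   the quotient is [glue_in A f], the one from [N] is [inr]. *)
Definition glue_in (T T' : Type) (A : set T) (f : T -> T') (x : T) : T + T' :=
  if `[< A x >] then inr (f x) else inl x.

Definition glue (T T' : Type) (M : mfd R T) (N : mfd R T') (A : set T)
    (f : T -> T') : mfd R (T + T') :=
  Mfd (glue_in A f @` car M `|` inr @` car N)
      (push_atlas (glue_in A f) (atl M) `|` push_atlas inr (atl N)).

(* The [k]-dimensional embedded submanifold [S] of the Euclidean space, with
   all its slice charts: [pid_mx k] is the projection on the first [k]
   coordinates. *)
Definition slice_chart (n k : nat) (S : set 'rV[R]_n) (c : chart R 'rV[R]_n) :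
    Prop :=
  exists V W f g,
    [/\ diffeo_on V W f g,
        (forall x, V x -> (S x <-> forall j : 'I_n, (k <= j)%N -> f x 0 j = 0))
      & c = @Chart R 'rV[R]_n k (S `&` V)
              (fun x => f x *m (pid_mx k : 'M[R]_(n, k))) (fun=> false)].

Definition submfd (n k : nat) (S : set 'rV[R]_n) : mfd R 'rV[R]_n :=
  Mfd S (slice_chart k S).

Definition is_submfd (n k : nat) (S : set 'rV[R]_n) : Prop :=
  forall x, S x -> exists2 c, slice_chart k S c & cdom c x.

Definition half_line : mfd R R :=
  Mfd [set x | 0 <= x]
      [set @Chart R R 1 [set x | 0 <= x] (fun x => const_mx x) (fun=> true)].

Definition pos_line : mfd R R :=
  Mfd [set x | 0 < x]
      [set @Chart R R 1 [set x | 0 < x] (fun x => const_mx x) (fun=> false)].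

End Manifolds.

Record grp (R : realType) (T : Type) := Grp {
  gcar : mfd R T;
  gone : T;
  ginv : T -> T;
  gmul : T -> T -> T }.

(* Groupoids with arrows in [T] and objects in [T']; [src] is the domain map
   and [mul g h] is relevant when [src g = rng h]. *)
Record gpd (R : realType) (T T' : Type) := Gpd {
  arr : mfd R T;
  obj : mfd R T';
  src : T -> T';
  rng : T -> T';
  one : T' -> T;
  inv : T -> T;
  mul : T -> T -> T }.

Section LieGroupoids.
Context {R : realType}.

Definition Lie_group (T : Type) (G : grp R T) : Prop :=
  let C := car (gcar G) in
  [/\ [/\ manifold (gcar G), mhausdorff (gcar G) & boundaryless (gcar G)],
      C (gone G),
      (forall g h k, C g -> C h -> C k ->
         gmul G g (gmul G h k) = gmul G (gmul G g h) k),
      (forall g, C g -> [/\ gmul G (gone G) g = g, gmul G g (gone G) = g,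
         gmul G (ginv G g) g = gone G & gmul G g (ginv G g) = gone G])
    & smooth (mprod (gcar G) (gcar G)) (gcar G) (fun z => gmul G z.1 z.2) /\
      smooth (gcar G) (gcar G) (ginv G)].

Definition smooth_right_action (T T' : Type) (X : mfd R T) (G : grp R T')
    (act : T -> T' -> T) : Prop :=
  [/\ smooth (mprod X (gcar G)) X (fun z => act z.1 z.2),
      (forall x, car X x -> act x (gone G) = x)
    & (forall x g h, car X x -> car (gcar G) g -> car (gcar G) h ->
         act (act x g) h = act x (gmul G g h))].

Definition composable (T T' : Type) (G : gpd R T T') : set (T * T) :=
  [set z | [/\ car (arr G) z.1, car (arr G) z.2 & src G z.1 = rng G z.2]].

Definition groupoid_axioms (T T' : Type) (G : gpd R T T') : Prop :=
  [/\ (forall x, car (obj G) x -> src G (one G x) = x /\ rng G (one G x) = x),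
      (forall g h, composable G (g, h) ->
         src G (mul G g h) = src G h /\ rng G (mul G g h) = rng G g),
      (forall g h k, composable G (g, h) -> composable G (h, k) ->
         mul G g (mul G h k) = mul G (mul G g h) k),
      (forall g, car (arr G) g ->
         mul G (one G (rng G g)) g = g /\ mul G g (one G (src G g)) = g)
    & (forall g, car (arr G) g ->
         [/\ src G (inv G g) = rng G g, rng G (inv G g) = src G g,
             mul G (inv G g) g = one G (src G g)
           & mul G g (inv G g) = one G (rng G g)])].

(* That the structure maps take their values in the right carriers is part of
   [smooth].  As [src] is a tame submersion, [composable G] is an embedded
   submanifold of the product. *)
Definition Lie_groupoid (T T' : Type) (G : gpd R T T') : Prop :=
  [/\ [/\ manifold (arr G), manifold (obj G) & mhausdorff (obj G)],
      groupoid_axioms G,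
      tame_submersion (arr G) (obj G) (src G) /\
      smooth (arr G) (obj G) (rng G),
      smooth (obj G) (arr G) (one G) /\ smooth (arr G) (arr G) (inv G)
    & smooth_on (mprod (arr G) (arr G)) (arr G) (composable G)
        (fun z => mul G z.1 z.2)].

Definition Lie_groupoid_iso (T T' S S' : Type) (G : gpd R T T')
    (H : gpd R S S') : Prop :=
  exists F F' f f',
    [/\ [/\ smooth (arr G) (arr H) F, smooth (arr H) (arr G) F',
            (forall g, car (arr G) g -> F' (F g) = g)
          & (forall h, car (arr H) h -> F (F' h) = h)],
        [/\ smooth (obj G) (obj H) f, smooth (obj H) (obj G) f',
            (forall x, car (obj G) x -> f' (f x) = x)
          & (forall y, car (obj H) y -> f (f' y) = y)],
        (forall g, car (arr G) g ->
           src H (F g) = f (src G g) /\ rng H (F g) = f (rng G g)),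
        (forall x, car (obj G) x -> F (one G x) = one H (f x))
      & (forall g h, composable G (g, h) ->
           F (mul G g h) = mul H (F g) (F h))].

Definition invariant_set (T T' : Type) (G : gpd R T T') (A : set T') : Prop :=
  rng G @` (car (arr G) `&` src G @^-1` A) = A.

Definition reduction (T T' : Type) (G : gpd R T T') (A : set T') :
    gpd R T T' :=
  Gpd (restr (arr G) (src G @^-1` A `&` rng G @^-1` A)) (restr (obj G) A)
      (src G) (rng G) (one G) (inv G) (mul G).

Definition pair_groupoid (T : Type) (M : mfd R T) : gpd R (T * T) T :=
  Gpd (mprod M M) M snd fst (fun x => (x, x)) (fun g => (g.2, g.1))
      (fun g h => (g.1, h.2)).

Definition action_groupoid (T T' : Type) (X : mfd R T) (G : grp R T')
    (act : T -> T' -> T) : gpd R (T * T') T :=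
  Gpd (mprod X (gcar G)) X
      (fun a => act a.1 (ginv G a.2)) fst
      (fun x => (x, gone G))
      (fun a => (act a.1 (ginv G a.2), ginv G a.2))
      (fun a b => (a.1, gmul G b.2 a.2)).

Definition prod_groupoid (T T' S S' : Type) (G : gpd R T T')
    (H : gpd R S S') : gpd R (T * S) (T' * S') :=
  Gpd (mprod (arr G) (arr H)) (mprod (obj G) (obj H))
      (fun a => (src G a.1, src H a.2)) (fun a => (rng G a.1, rng H a.2))
      (fun x => (one G x.1, one H x.2)) (fun a => (inv G a.1, inv H a.2))
      (fun a b => (mul G a.1 b.1, mul H a.2 b.2)).

Definition dsum_groupoid (I T T' : Type) (G : I -> gpd R T T') :
    gpd R (I * T) (I * T') :=
  Gpd (mdsum (fun i => arr (G i))) (mdsum (fun i => obj (G i)))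
      (fun a => (a.1, src (G a.1) a.2)) (fun a => (a.1, rng (G a.1) a.2))
      (fun x => (x.1, one (G x.1) x.2)) (fun a => (a.1, inv (G a.1) a.2))
      (fun a b => (a.1, mul (G a.1) a.2 b.2)).

(* Gluing along an isomorphism [F], over [f], of the reduction of [G] to [A]
   with a reduction of [H].  It is meant for [A] invariant in [G] and [f @` A]
   invariant in [H], in which case the mixed products do not occur. *)
Definition glue_groupoid (T T' S S' : Type) (G : gpd R T T')
    (H : gpd R S S') (A : set T') (F : T -> S) (f : T' -> S') :
    gpd R (T + S) (T' + S') :=
  let B := src G @^-1` A `&` rng G @^-1` A in
  Gpd (glue (arr G) (arr H) B F) (glue (obj G) (obj H) A f)
      (fun a => match a with
                | inl g => glue_in A f (src G g)
                | inr h => inr (src H h)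
                end)
      (fun a => match a with
                | inl g => glue_in A f (rng G g)
                | inr h => inr (rng H h)
                end)
      (fun x => match x with
                | inl y => glue_in B F (one G y)
                | inr z => inr (one H z)
                end)
      (fun a => match a with
                | inl g => glue_in B F (inv G g)
                | inr h => inr (inv H h)
                end)
      (fun a b => match a, b with
                  | inl g, inl g' => glue_in B F (mul G g g')
                  | inr h, inr h' => inr (mul H h h')
                  | _, _ => a
                  end).

Definition weak_gluing (T T' I : Type) (G : gpd R T T') (U : I -> set T') :
    Prop :=
  forall g h, composable G (g, h) -> exists i,
    car (arr (reduction G (U i))) g /\ car (arr (reduction G (U i))) h.

Definition locally_action (T T' : Type) (G : gpd R T T') (U : set T') :
    Prop :=
  exists (S S' : Type) (X : mfd R S) (K : grp R S') (act : S -> S' -> S)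
         (U' : set S),
    [/\ manifold X /\ mhausdorff X, Lie_group K,
        smooth_right_action X K act, mopen X U'
      & Lie_groupoid_iso (reduction G U)
          (reduction (action_groupoid X K act) U')].

(* For [U] invariant, [reduction G U] is the groupoid of all the arrows with
   domain in [U]. *)
Definition boundary_action_groupoid (T T' : Type) (G : gpd R T T') : Prop :=
  [/\ Lie_groupoid G,
      (exists U, [/\ mopen (obj G) U, mdense (obj G) U, invariant_set G U
         & Lie_groupoid_iso (reduction G U) (pair_groupoid (restr (obj G) U))])
    & exists (I : Type) (U : I -> set T'),
        [/\ (forall i, mopen (obj G) (U i)),
            car (obj G) = \bigcup_i U i,
            (forall i, locally_action G (U i))
          & weak_gluing G U]].

End LieGroupoids.

(* [cphi i] is the diffeomorphism from [cnbhd i] to the unit ball, [cpsi i] is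
   its inverse. *)
Record conical_data (R : realType) (n : nat) := ConicalData {
  cnum : nat;
  cpt : 'I_cnum -> 'rV[R]_n;
  cnbhd : 'I_cnum -> set 'rV[R]_n;
  clink : 'I_cnum -> set 'rV[R]_n;
  cphi : 'I_cnum -> 'rV[R]_n -> 'rV[R]_n;
  cpsi : 'I_cnum -> 'rV[R]_n -> 'rV[R]_n }.

Section LayerPotentials.
Context {R : realType} (n : nat).
Implicit Types (Omega : set 'rV[R]_n) (D : conical_data R n).

Definition smooth_part Omega D : set 'rV[R]_n :=
  frontier Omega `\` range (@cpt _ _ D).

(* The boundary of [clink i] in the unit sphere. *)
Definition link_bd D (i : 'I_(cnum D)) : set 'rV[R]_n :=
  closure (clink i) `&` closure (unit_sphere n `\` clink i).

Definition conical_domain Omega D : Prop :=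
  [/\ [/\ open Omega, connected Omega & bounded_set Omega],
      is_submfd n.-1 (smooth_part Omega D),
      (forall i : 'I_(cnum D),
         [/\ (exists2 O, open O & clink i = O `&` unit_sphere n),
             clink i <> unit_sphere n
           & is_submfd n.-2 (link_bd i)]),
      (forall i : 'I_(cnum D),
         [/\ frontier Omega (cpt i), cnbhd i (cpt i),
             diffeo_on (cnbhd i) (unit_ball n) (cphi i) (cpsi i),
             cphi i (cpt i) = 0
           & cphi i @` (Omega `&` cnbhd i) =
             [set y | exists r x', [/\ 0 < r, r < 1, clink i x'
                                     & y = r *: x']]])
    & (forall i j : 'I_(cnum D), i != j ->
         closure (cnbhd i) `&` closure (cnbhd j) = set0)].

Definition without_cracks Omega : Prop :=
  frontier Omega = frontier (closure Omega).

Definition dilation_groupoid : gpd R (R * R) R :=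
  action_groupoid half_line (Grp pos_line 1 GRing.inv *%R) *%R.

Definition J_groupoid D (i : 'I_(cnum D)) :
    gpd R ((R * R) * ('rV[R]_n * 'rV[R]_n)) (R * 'rV[R]_n) :=
  reduction (prod_groupoid dilation_groupoid
                           (pair_groupoid (submfd n.-2 (link_bd i))))
            ([set t | 0 <= t < 1] `*` link_bd i).

(* On [(0, 1) * link_bd i], this is the map induced by [cphi i] in polar
   coordinates. *)
Definition polar D (z : 'I_(cnum D) * (R * 'rV[R]_n)) : 'rV[R]_n :=
  cpsi z.1 (z.2.1 *: z.2.2).

Definition polar_dom D : set ('I_(cnum D) * (R * 'rV[R]_n)) :=
  [set z | 0 < z.2.1].

(* The identification of [J_groupoid i] over [(0, 1) * link_bd i] with a pair
   groupoid sends an arrow to its range and domain. *)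
Definition layer_groupoid Omega D :
    gpd R ('I_(cnum D) * ((R * R) * ('rV[R]_n * 'rV[R]_n)) +
           'rV[R]_n * 'rV[R]_n)
          ('I_(cnum D) * (R * 'rV[R]_n) + 'rV[R]_n) :=
  let J := dsum_groupoid (@J_groupoid D) in
  glue_groupoid J (pair_groupoid (submfd n.-1 (smooth_part Omega D)))
    (@polar_dom D) (fun g => (polar (rng J g), polar (src J g))) (@polar D).

Definition desing_boundary Omega D :
    mfd R ('I_(cnum D) * (R * 'rV[R]_n) + 'rV[R]_n) :=
  glue (mdsum (fun i : 'I_(cnum D) =>
                 restr (mprod half_line (submfd n.-2 (link_bd i)))
                       ([set t | 0 <= t < 1] `*` link_bd i)))
       (submfd n.-1 (smooth_part Omega D)) (@polar_dom D) (@polar D).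

Lemma obj_layer_groupoid Omega D :
  obj (layer_groupoid Omega D) = desing_boundary Omega D.
Proof. by []. Qed.

End LayerPotentials.

(* Main.v *)
Require Import Defs.
From HB Require Import structures.
From mathcomp Require Import all_boot all_order all_algebra.
From mathcomp Require Import all_classical all_reals all_analysis.

(** Both the space of arrows and the space of units of the groupoid are glued
    from the collars at the conical points and the interior.  The gluing maps
    are polar coordinates, whose inverse is smooth away from the conical points
    because the frontier of a cone over [clink i] is the cone over [link_bd i].

    Any three points of a submanifold have a common open neighbourhood which is
    a union of pairwise disjoint coordinate patches, hence diffeomorphic to an
    open subset [V] of the abelian Lie group ['rV_k * int].  The pair groupoid
    of [V] is the reduction to [V] of the action of this group on itself by
    translations.  Taking the product with the dilation groupoid near a conical
    point, and with nothing elsewhere, gives for each composable pair an open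
    set on which the groupoid is a reduction of an action groupoid; this is the
    weak gluing condition.  As the sets of arrows over these open sets are open,
    the smoothness of the structure maps and the tameness of the domain map are
    inherited from action groupoids, where the domain map is the composition of
    a diffeomorphism with a projection. *)

Set Implicit Arguments.
Unset Strict Implicit.
Unset Printing Implicit Defensive.

Import Order.TTheory GRing.Theory Num.Theory.
Import numFieldNormedType.Exports.

Local Open Scope classical_set_scope.
Local Open Scope ring_scope.

(** * Smooth maps between Euclidean spaces *)

Section Smoothness.
Context {R : realType}.

(** A composable pair involves three objects: the range of the first arrow, the common object and
    the domain of the second. Weak gluing wants all three in one open set whose reduction is an
    action groupoid, which is why triples of points have to be caught. They may lie in different
    components (for [n = 2] a link is discrete), so one connected chart is not enough. No arrow
    joins the boundary to the interior. A composable pair therefore involves either three points of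
    the smooth part, or three points of the link of a single conical point; in the second case the
    open set contains the whole interval [[0, 1)] of radii, and only the points of the link have to
    be caught. As the groupoid is glued by hand, no smoothness of its structure maps is known
    beforehand. The algebraic axioms are checked on normal forms of the arrows, and smoothness
    follows from the very cover that proves weak gluing: a product is smooth near a composable pair
    because the pair lies over one piece. Hausdorffness of the space of units is not local, and
    needs an argument of its own. *)

Lemma near_open (T : topologicalType) (W P : set T) (x : T) :
  open W -> W x -> W `<=` P -> \forall y \near x, P y.
Proof. by move=> oW Wx WP; apply: filterS WP _; apply: open_nbhs_nbhs. Qed.

(** The first-order expansion of [f] at [x] is also one of [g], and by uniqueness its linear part is
    the differential of [g]. *)
Lemma near_eq_differentiable (V W : normedModType R) (f g : V -> W) (x : V) :
  {near x, f =1 g} -> differentiable f x -> differentiable g x.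
Proof.
move=> fg dfx; have [cd fE] := (diff_locallyP x f).1 dfx.
have gE : g \o shift x = cst (g x) + 'd f x +o_ 0 id.
  apply/eqaddoP => e e0; have /eqaddoP /(_ e e0) fe := fE.
  have fgx : \forall y \near 0, f (y + x) = g (y + x).
    case/nbhs_ballP: fg => d /= d0 fg; apply/nbhs_ballP; exists d => //= y.
    rewrite -!ball_normE /= sub0r normrN => yd; apply: fg.
    by rewrite -ball_normE /= opprD addrCA subrr addr0 normrN.
  near=> y.
  have -> : (g \o shift x - (cst (g x) + 'd f x)) y =
            (f \o shift x - (cst (f x) + 'd f x)) y.
    have fgy : f (y + x) = g (y + x) by near: y; apply: fgx.
    change (g (y + x) - (g x + 'd f x y) = f (y + x) - (f x + 'd f x y)).
    by rewrite -(nbhs_singleton fg) fgy.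
  by near: y; apply: fe.
by apply/diff_locallyP; rewrite (diff_unique cd gE).
Unshelve. all: by end_near. Qed.

Lemma Ck_on_subset k a b (W W' : set 'rV[R]_a) (f : 'rV[R]_a -> 'rV[R]_b) :
  W' `<=` W -> Ck_on k W f -> Ck_on k W' f.
Proof.
elim: k f => [|k IH] f sW /=; first by move=> cf x /sW/cf.
by case=> df Df; split=> [x /sW/df|v] //; apply: IH.
Qed.

Lemma Ck_onW k a b (W : set 'rV[R]_a) (f : 'rV[R]_a -> 'rV[R]_b) :
  Ck_on k.+1 W f -> Ck_on k W f.
Proof.
elim: k f => [|k IH] f [df Df] /=.
  by move=> x /df /differentiable_continuous.
by split=> // v; apply: IH.
Qed.

(** A directional derivative depends only on the germ, so equality on the open set [W] passes to all
    derivatives. The inductions below use this to replace ['D_v f] by a formula which is valid on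
    [W] only. *)
Lemma Ck_on_eq k a b (W : set 'rV[R]_a) (f g : 'rV[R]_a -> 'rV[R]_b) :
  open W -> (forall x, W x -> f x = g x) -> Ck_on k W f -> Ck_on k W g.
Proof.
move=> oW; elim: k f g => [|k IH] f g fg /=.
  move=> cf x Wx.
  have nfg : {near x, f =1 g} by apply: near_open oW Wx _ => y /fg.
  have := cf x Wx; rewrite /prop_for /continuous_at -fg //.
  by apply: cvg_trans; exact: (near_eq_cvg nfg).
case=> df Df; split=> [x Wx|v].
  exact: near_eq_differentiable (near_open oW Wx fg) (df x Wx).
by apply: IH (Df v) => x Wx; apply: near_eq_derive; apply: near_open fg.
Qed.

Lemma Ck_on_cst k a b (W : set 'rV[R]_a) (c : 'rV[R]_b) :
  Ck_on k W (cst c : 'rV[R]_a -> 'rV[R]_b).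
Proof.
elim: k c => [|k IH] c /=; first by move=> x _; apply: cst_continuous.
split=> [x _|v]; first exact: differentiable_cst.
by rewrite (_ : 'D_v _ = cst 0) //; apply/funext => x; rewrite derive_cst.
Qed.

Lemma continuous_linear_rV a b (f : {linear 'rV[R]_a -> 'rV[R]_b}) :
  continuous f.
Proof.
have fE (v : 'rV[R]_a) : f v = \sum_i v 0 i *: f (delta_mx 0 i).
  by rewrite {1}(row_sum_delta v) linear_sum; under eq_bigr do rewrite linearZ.
rewrite (_ : (f : _ -> _) =
  \sum_(i < a) fun v : 'rV[R]_a => v 0 i *: f (delta_mx 0 i)); last first.
  by apply/funext => v; rewrite fct_sumE fE.
move=> x; apply: differentiable_continuous; apply: differentiable_sum => i.
by apply: differentiableZl; apply: differentiable_coord.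
Qed.

Lemma Coo_on_linear a b (W : set 'rV[R]_a) (f : {linear 'rV[R]_a -> 'rV[R]_b}) :
  Coo_on W f.
Proof.
have cf := @continuous_linear_rV _ _ f.
case=> [|k] /=; first by move=> x _; apply: cf.
split=> [x _|v]; first exact: linear_differentiable.
rewrite (_ : 'D_v f = cst (f v)); first exact: Ck_on_cst.
apply/funext => x; rewrite deriveE; last exact: linear_differentiable.
by rewrite diff_lin.
Qed.

Lemma Ck_onD k a b (W : set 'rV[R]_a) (f g : 'rV[R]_a -> 'rV[R]_b) : open W ->
  Ck_on k W f -> Ck_on k W g -> Ck_on k W (f \+ g).
Proof.
move=> oW; elim: k f g => [|k IH] f g /=.
  by move=> cf cg x Wx; exact: (cvgD (cf x Wx) (cg x Wx)).
move=> [df Df] [dg Dg]; split=> [x Wx|v].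
  by apply: differentiableD; [apply: df|apply: dg].
apply: Ck_on_eq (IH _ _ (Df v) (Dg v)) => // x Wx /=.
by rewrite -[f \+ g]/(f + g) deriveD //; apply: diff_derivable;
   [apply: df|apply: dg].
Qed.

Lemma Coo_on_subset a b (W W' : set 'rV[R]_a) (f : 'rV[R]_a -> 'rV[R]_b) :
  W' `<=` W -> Coo_on W f -> Coo_on W' f.
Proof. by move=> sW sf k; apply: Ck_on_subset (sf k). Qed.

Lemma Coo_on_eq a b (W : set 'rV[R]_a) (f g : 'rV[R]_a -> 'rV[R]_b) :
  open W -> (forall x, W x -> f x = g x) -> Coo_on W f -> Coo_on W g.
Proof. by move=> oW fg sf k; apply: Ck_on_eq (sf k). Qed.

Lemma Coo_on_differentiable a b (W : set 'rV[R]_a) (f : 'rV[R]_a -> 'rV[R]_b) :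
  Coo_on W f -> forall x, W x -> differentiable f x.
Proof. by move=> /(_ 1%N)[]. Qed.

Lemma Coo_on_continuous a b (W : set 'rV[R]_a) (f : 'rV[R]_a -> 'rV[R]_b) :
  Coo_on W f -> forall x, W x -> {for x, continuous f}.
Proof. by move=> /(_ 0%N). Qed.

(** The product rule, stated for one coordinate of a vector-valued map because every map here is
    between spaces of row vectors. *)
Lemma Ck_on_scale k a b c (W : set 'rV[R]_a) (i : 'I_b)
    (f : 'rV[R]_a -> 'rV[R]_b) (g : 'rV[R]_a -> 'rV[R]_c) :
  open W -> Ck_on k W f -> Ck_on k W g ->
  Ck_on k W (fun x => f x 0 i *: g x).
Proof.
move=> oW; elim: k f g => [|k IH] f g /=.
  move=> cf cg x Wx; apply: (@cvgZ _ _ _ (nbhs x)); last exact: cg.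
  by apply: (continuous_comp (g := fun v : 'rV[R]_b => v 0 i)) (cf x Wx) _;
     apply: coord_continuous.
move=> [df Df] [dg Dg].
have dfi x : W x -> differentiable (fun x => f x 0 i) x.
  move=> Wx; apply: (differentiable_comp (g := fun v : 'rV[R]_b => v 0 i)).
    exact: df.
  exact: differentiable_coord.
have dgj j x : W x -> differentiable (fun x => g x 0 j) x.
  move=> Wx; apply: (differentiable_comp (g := fun v : 'rV[R]_c => v 0 j)).
    exact: dg.
  exact: differentiable_coord.
have dfg x : W x -> differentiable (fun x => f x 0 i *: g x) x.
  move=> Wx; rewrite (_ : (fun x => f x 0 i *: g x) =
      \sum_(j < c) fun x => (f x 0 i * g x 0 j) *: delta_mx 0 j); last first.
    apply/funext => y; rewrite fct_sumE {1}(row_sum_delta (g y)) scaler_sumr.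
    by apply: eq_bigr => j _; rewrite scalerA.
  apply: differentiable_sum => j; apply: differentiableZl.
  by apply: (@differentiableM _ _ (fun x => f x 0 i)); [apply: dfi|apply: dgj].
split=> [x Wx|v]; first exact: dfg.
apply: (@Ck_on_eq _ _ _ _ ((fun x => f x 0 i *: 'D_v g x) \+
                          (fun x => 'D_v f x 0 i *: g x))) => //.
  move=> x Wx /=; apply/rowP => j; rewrite (derive_mx (@diff_derivable _ _ _ _ _ v (dfg x Wx))).
  rewrite [RHS]mxE (_ : (fun t => (f t 0 i *: g t) 0 j) =
      (fun t => f t 0 i) * (fun t => g t 0 j)); last first.
    by apply/funext => t; rewrite mxE.
  rewrite deriveM ?(derive_mx (@diff_derivable _ _ _ _ _ v (df x Wx)))
    ?(derive_mx (@diff_derivable _ _ _ _ _ v (dg x Wx))) ?mxE.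
  - by congr (_ + _); rewrite /GRing.scale /= mulrC.
  - exact/diff_derivable/dfi.
  - exact/diff_derivable/dgj.
apply: Ck_onD => //; apply: IH => //; first exact: (Ck_onW (conj df Df)).
exact: (Ck_onW (conj dg Dg)).
Qed.

Lemma Ck_on_sum k a b c (W : set 'rV[R]_a) (F : 'I_c -> 'rV[R]_a -> 'rV[R]_b) :
  open W -> (forall i, Ck_on k W (F i)) -> Ck_on k W (fun x => \sum_i F i x).
Proof.
move=> oW CF; rewrite (_ : (fun x => _) = \sum_i F i); last first.
  by apply/funext => x; rewrite fct_sumE.
apply: (big_ind (Ck_on k W)) => //; first exact: Ck_on_cst.
by move=> f g; apply: Ck_onD.
Qed.

Lemma derive_comp_rV a b c (f : 'rV[R]_a -> 'rV[R]_b) (g : 'rV[R]_b -> 'rV[R]_c)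
    (x v : 'rV[R]_a) :
  differentiable f x -> differentiable g (f x) ->
  'D_v (g \o f) x = 'D_('D_v f x) g (f x).
Proof.
move=> df dg; rewrite deriveE; last exact: differentiable_comp.
by rewrite diff_comp // !deriveE.
Qed.

Lemma Ck_on_comp k a b c (W : set 'rV[R]_a) (W' : set 'rV[R]_b)
    (f : 'rV[R]_a -> 'rV[R]_b) (g : 'rV[R]_b -> 'rV[R]_c) :
  open W -> open W' -> (forall x, W x -> W' (f x)) ->
  Ck_on k W f -> Ck_on k W' g -> Ck_on k W (g \o f).
Proof.
move=> oW oW' fW; elim: k f g fW => [|k IH] f g fW.
  by move=> /= cf cg x Wx; apply: continuous_comp; [apply: cf|apply/cg/fW].
move=> Cf Cg; have [df Df] := Cf; have [dg Dg] := Cg; split=> [x Wx|v].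
  by apply: differentiable_comp; [apply: df|apply/dg/fW].
(* The direction ['D_v f x] of the chain rule varies with [x], while [Ck_on] controls derivatives in
   fixed directions only. Expanding it along the standard basis gives a sum of products, to which
   the induction hypothesis applies. *)
apply: (@Ck_on_eq _ _ _ _ (fun x => \sum_i ('D_v f x) 0 i *:
                             ('D_(delta_mx 0 i) g \o f) x)) => //.
  move=> x Wx; have dfx := df _ Wx; have dgx := dg _ (fW _ Wx).
  rewrite derive_comp_rV //.
  rewrite [in RHS](row_sum_delta ('D_v f x)) !deriveE ?linear_sum //.
  by apply: eq_bigr => i _; rewrite linearZ /= deriveE.
apply: (@Ck_on_sum _ _ _ _ _ (fun i x => ('D_v f x) 0 i *:
         ('D_(delta_mx 0 i) g \o f) x)) => // i.
apply: Ck_on_scale => //; first exact: Df.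
by apply: IH => //; [apply: Ck_onW|apply: Dg].
Qed.

Lemma Coo_on_comp a b c (W : set 'rV[R]_a) (W' : set 'rV[R]_b)
    (f : 'rV[R]_a -> 'rV[R]_b) (g : 'rV[R]_b -> 'rV[R]_c) :
  open W -> open W' -> (forall x, W x -> W' (f x)) ->
  Coo_on W f -> Coo_on W' g -> Coo_on W (g \o f).
Proof. by move=> oW oW' fW sf sg k; apply: (Ck_on_comp oW oW'). Qed.

Lemma Coo_on_scale a b c (W : set 'rV[R]_a) (i : 'I_b)
    (f : 'rV[R]_a -> 'rV[R]_b) (g : 'rV[R]_a -> 'rV[R]_c) :
  open W -> Coo_on W f -> Coo_on W g -> Coo_on W (fun x => f x 0 i *: g x).
Proof. by move=> oW sf sg k; apply: Ck_on_scale. Qed.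

Lemma Coo_onD a b (W : set 'rV[R]_a) (f g : 'rV[R]_a -> 'rV[R]_b) : open W ->
  Coo_on W f -> Coo_on W g -> Coo_on W (f \+ g).
Proof. by move=> oW sf sg k; apply: Ck_onD. Qed.

Lemma Coo_on_cst a b (W : set 'rV[R]_a) (c : 'rV[R]_b) :
  Coo_on W (cst c : 'rV[R]_a -> 'rV[R]_b).
Proof. by move=> k; apply: Ck_on_cst. Qed.

Lemma Coo_on_id a (W : set 'rV[R]_a) : Coo_on W (fun x => x).
Proof. exact: (@Coo_on_linear _ _ _ idfun). Qed.

Lemma Coo_on_mulmx a b (W : set 'rV[R]_a) (A : 'M[R]_(a, b)) :
  Coo_on W (fun x => x *m A).
Proof. exact: (@Coo_on_linear _ _ _ (mulmxr A)). Qed.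

Lemma Coo_on_lsubmx a b (W : set 'rV[R]_(a + b)) : Coo_on W lsubmx.
Proof. exact: (@Coo_on_linear _ _ _ lsubmx). Qed.

Lemma Coo_on_rsubmx a b (W : set 'rV[R]_(a + b)) : Coo_on W rsubmx.
Proof. exact: (@Coo_on_linear _ _ _ rsubmx). Qed.

Lemma Coo_on_row_mx a b c (W : set 'rV[R]_a)
    (f : 'rV[R]_a -> 'rV[R]_b) (g : 'rV[R]_a -> 'rV[R]_c) :
  open W -> Coo_on W f -> Coo_on W g -> Coo_on W (fun x => row_mx (f x) (g x)).
Proof.
move=> oW sf sg; apply: (@Coo_on_eq _ _ _
    ((fun x => f x *m row_mx 1%:M 0) \+ (fun x => g x *m row_mx 0 1%:M))) => //.
  by move=> x Wx /=; rewrite !mul_mx_row !mulmx1 !mulmx0 add_row_mx addr0 add0r.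
apply: Coo_onD => //.
  exact: (Coo_on_comp oW openT _ sf (@Coo_on_mulmx _ _ setT _)).
exact: (Coo_on_comp oW openT _ sg (@Coo_on_mulmx _ _ setT _)).
Qed.

(** Real functions enter the calculus of [Coo_on] as maps of row vectors of length 1. *)
Definition lift1 (phi : R -> R) (x : 'rV[R]_1) : 'rV[R]_1 :=
  const_mx (phi (x 0 0)).

Lemma is_diff_lift1 (phi : R -> R) (x : 'rV[R]_1) (d : R) :
  is_derive (x 0 0) 1 phi d ->
  differentiable (lift1 phi) x /\
  forall v, 'D_v (lift1 phi) x = const_mx (d * v 0 0).
Proof.
move=> [dphi phiE].
pose co (x : 'rV[R]_1) := x 0 0 : R.
pose mk (r : R) := r *: (const_mx 1 : 'rV[R]_1).
have E : lift1 phi = mk \o (phi \o co).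
  by apply/funext => y; apply/rowP => j; rewrite !mxE mulr1.
have dco : differentiable co x by apply: differentiable_coord.
have /derivable1_diffP dphi' := dphi.
have dc : differentiable (phi \o co) x by apply: differentiable_comp.
have dl : differentiable (lift1 phi) x.
  by rewrite E; apply: differentiable_comp => //; apply: differentiableZl.
split=> // v; apply/rowP => j.
rewrite (derive_mx (@diff_derivable _ _ _ _ _ v dl)) !mxE !ord1.
rewrite (_ : (fun t => lift1 phi t 0 0) = phi \o co); last first.
  by apply/funext => y; rewrite mxE.
rewrite deriveE // diff_comp //= diff1E // derive1E phiE.
rewrite -(@deriveE _ _ _ co) // /GRing.scale /= mulrC; congr (_ * _).
rewrite /co -[RHS]/((v : 'rV[R]_1) 0 0).
rewrite -[in RHS](derive_id x v) derive_mx ?mxE //.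
Qed.

Lemma Coo_on_inv : Coo_on [set x : 'rV[R]_1 | x 0 0 != 0] (lift1 GRing.inv).
Proof.
have oW : open [set x : 'rV[R]_1 | x 0 0 != 0].
  apply: (@open_comp _ _ (fun x : 'rV[R]_1 => x 0 0) [set y | y != 0]).
    by move=> x _; apply: coord_continuous.
  exact: open_neq.
have dV (x : 'rV[R]_1) : x 0 0 != 0 ->
    is_derive (x 0 0) 1 (GRing.inv : R -> R) (- (x 0 0) ^- 2).
  move=> x0; apply: is_derive_eq (is_deriveV (f := idfun) x0 (is_derive_id _ _)) _.
  exact: mulr1.
elim=> [|k IH].
  move=> x /= /dV/is_diff_lift1[d _]; exact: differentiable_continuous.
split=> [x /= /dV/is_diff_lift1[] //|v].
(* The derivative of the inverse is again a product of inverses, so the induction feeds on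
   itself. *)
apply: (@Ck_on_eq _ _ _ _ (fun x => lift1 GRing.inv x 0 0 *:
          (cst (- v) x 0 0 *: lift1 GRing.inv x))) => //.
  move=> x /= /dV/is_diff_lift1[_ ->]; apply/rowP => j; rewrite !mxE.
  by rewrite expr2 invfM !mulNr mulrN -mulrA [_ * v _ _]mulrC.
by do 2 (apply: Ck_on_scale => //); apply: Ck_on_cst.
Qed.

Lemma Coo_on_sqrt : Coo_on [set x : 'rV[R]_1 | 0 < x 0 0] (lift1 Num.sqrt).
Proof.
have oW : open [set x : 'rV[R]_1 | 0 < x 0 0].
  apply: (@open_comp _ _ (fun x : 'rV[R]_1 => x 0 0) [set y | 0 < y]).
    by move=> x _; apply: coord_continuous.
  exact: open_gt.
elim=> [|k IH].
  move=> x /= /is_derive1_sqrt/is_diff_lift1[d _].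
  exact: differentiable_continuous.
split=> [x /= /is_derive1_sqrt/is_diff_lift1[] //|v].
(* The derivative of the root is half the inverse of the root: the induction hypothesis is composed
   with the smooth inverse. *)
apply: (@Ck_on_eq _ _ _ _ (fun x => cst (2^-1 *: v) x 0 0 *:
          (lift1 GRing.inv \o lift1 Num.sqrt) x)) => //.
  move=> x /= /is_derive1_sqrt/is_diff_lift1[_ ->].
  by apply/rowP => j; rewrite !mxE invfM mulrAC.
apply: Ck_on_scale => //; first exact: Ck_on_cst.
apply: (Ck_on_comp oW _ _ IH (Coo_on_inv k)).
  apply: (@open_comp _ _ (fun x : 'rV[R]_1 => x 0 0) [set y | y != 0]).
    by move=> x _; apply: coord_continuous.
  exact: open_neq.
by move=> x /= x0; rewrite mxE gt_eqF // sqrtr_gt0.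
Qed.

End Smoothness.

(** * Manifolds given by atlases *)

Section Atlases.
Context {R : realType}.

(** Indexing by [seq rat] makes the index type independent of the dimension, so that centres in
    charts of unrelated dimensions can be enumerated together. *)
Definition rational_point (d : nat) (s : seq rat) : 'rV[R]_d :=
  \row_i ratr (nth 0 s i).

Lemma rational_ball_basis (d : nat) (V : set 'rV[R]_d) (y : 'rV[R]_d) :
  open V -> V y -> exists s (q : rat),
    ball (rational_point d s) (ratr q) y /\
    ball (rational_point d s) (ratr q) `<=` V.
Proof.
move=> oV Vy; have /nbhs_ballP[e /= e0 eV] := open_nbhs_nbhs (conj oV Vy).
(* The radius [q] is taken below [e / 2]: two points of a ball of radius [q] are then at distance
   less than [e]. *)
have e20 : 0 < e / 2 by rewrite divr_gt0.
have [q] := rat_in_itvoo e20; rewrite in_itv /= => /andP[q0 qe].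
have yq i : y 0 i - ratr q < y 0 i + ratr q.
  by rewrite ltrD2l gtrN.
pose z i := sval (cid (rat_in_itvoo (yq i))).
have zP i : ball (y 0 i) (ratr q) (ratr (z i)).
  rewrite /z; case: cid => r /=; rewrite in_itv /= -ball_normE /= => /andP[r1 r2].
  by rewrite distrC ltr_distl r1.
pose s := mkseq (fun j => if insub j is Some i then z i else 0) d.
have sE : rational_point d s = \row_i ratr (z i).
  apply/rowP => i; rewrite !mxE nth_mkseq //.
  by case: insubP => [j _ /val_inj ->|]; rewrite ?ltn_ord.
have ys : ball (rational_point d s) (ratr q) y.
  by split=> // i j; rewrite ord1 sE mxE; apply/ball_sym/zP.
exists s, q; split=> // x xs; apply: eV.
by rewrite (splitr e); apply: ball_triangle (ball_sym (le_ball (ltW qe) ys)) (le_ball (ltW qe) xs).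
Qed.

Lemma open_preimageI (T U : topologicalType) (W : set T) (V : set U)
    (f : T -> U) :
  open W -> open V -> (forall x, W x -> {for x, continuous f}) ->
  open (W `&` f @^-1` V).
Proof.
move=> oW oV cf; rewrite openE => x [Wx Vx]; apply: filterI.
  exact: open_nbhs_nbhs.
exact: (cf x Wx _ (open_nbhs_nbhs (conj oV Vx))).
Qed.

Lemma open_preimage_Coo a b (W : set 'rV[R]_a) (V : set 'rV[R]_b)
    (f : 'rV[R]_a -> 'rV[R]_b) :
  open W -> open V -> Coo_on W f -> open (W `&` f @^-1` V).
Proof.
move=> oW oV sf; apply: (open_preimageI oW oV) => x Wx.
exact: (Coo_on_continuous sf Wx).
Qed.

Section Charts.
Context {T : Type}.
Implicit Types (M : mfd R T) (c : chart R T).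

Lemma manifold_chart M c : manifold M -> atl M c -> chart_of M c.
Proof. by case=> h _ _ _ _; apply: h. Qed.

Lemma manifold_cover M p : manifold M -> car M p ->
  exists2 c, atl M c & cdom c p.
Proof. by case=> _ h _ _ _; apply: h. Qed.

Lemma manifold_id M : manifold M -> smooth M M idfun.
Proof. by case. Qed.

Lemma cdom_car M c : manifold M -> atl M c -> cdom c `<=` car M.
Proof. by move=> hM hc; have [] := manifold_chart hM hc. Qed.

End Charts.

Section LocalReps.
Context {T T' T'' : Type}.
Implicit Types (M : mfd R T) (N : mfd R T') (P : mfd R T'').

Lemma local_rep_subset (S S' : set T) (f : T -> T') (c : chart R T)
    (c' : chart R T') p W F : S' `<=` S ->
  @local_rep R _ _ S f c c' p W F -> local_rep S' f p W F.
Proof. by move=> sS [oW Wp sF h]; split=> // q /sS; apply: h. Qed.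

Lemma local_rep_eq (S : set T) (f g : T -> T') (c : chart R T)
    (c' : chart R T') p W F : (forall q, S q -> f q = g q) ->
  @local_rep R _ _ S f c c' p W F -> local_rep S g p W F.
Proof.
by move=> fg [oW Wp sF h]; split=> // q Sq; rewrite -fg //; apply: h.
Qed.

(** The representative of the composite is given explicitly because the chain rule for tangent maps
    is later read off from it. *)
Lemma local_rep_comp (S : set T) (S' : set T') (f : T -> T') (g : T' -> T'')
    (c : chart R T) (c' : chart R T') (c'' : chart R T'') p W F W' G :
  S p -> cdom c p -> (forall q, S q -> S' (f q)) ->
  @local_rep R _ _ S f c c' p W F -> @local_rep R _ _ S' g c' c'' (f p) W' G ->
  @local_rep R _ _ S (g \o f) c c'' p (W `&` F @^-1` W') (G \o F).
Proof.
move=> Sp cp fS [oW Wp sF hf] [oW' Wp' sG hg].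
have [c'p fE] := hf _ Sp cp Wp.
have oW'' : open (W `&` F @^-1` W') := open_preimage_Coo oW oW' sF.
split=> //; first by split; rewrite //= -fE.
  apply: (Coo_on_comp oW'' oW') => //; first by move=> x [].
  by apply: Coo_on_subset sF => x [].
move=> q Sq cq [Wq W'q]; have [c'q fqE] := hf _ Sq cq Wq.
rewrite /= -fqE in W'q; have [? ->] := hg _ (fS _ Sq) c'q W'q.
by rewrite fqE.
Qed.

Lemma smooth_on_subset M N (S S' : set T) (f : T -> T') :
  S' `<=` S -> smooth_on M N S f -> smooth_on M N S' f.
Proof.
move=> sS [fN sf]; split=> [p /sS/fN //|c c' hc hc' p /[dup] S'p /sS Sp cp c'p].
have [W [F h]] := sf _ _ hc hc' p Sp cp c'p.
by exists W, F; apply: local_rep_subset h.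
Qed.

Lemma smooth_on_eq M N (S : set T) (f g : T -> T') :
  (forall q, S q -> f q = g q) -> smooth_on M N S f -> smooth_on M N S g.
Proof.
move=> fg [fN sf]; split=> [p Sp|c c' hc hc' p Sp cp]; first by rewrite -fg //; apply: fN.
rewrite -fg // => c'p; have [W [F h]] := sf _ _ hc hc' p Sp cp c'p.
by exists W, F; apply: local_rep_eq h.
Qed.

Lemma smooth_on_comp M N P (S : set T) (S' : set T') (f : T -> T')
    (g : T' -> T'') :
  manifold N -> (forall q, S q -> S' (f q)) ->
  smooth_on M N S f -> smooth_on N P S' g -> smooth_on M P S (g \o f).
Proof.
move=> hN fS [fN sf] [gP sg]; split=> [p /fS/gP //|c c'' hc hc'' p Sp cp c''p].
have [c' hc' c'p] := manifold_cover hN (fN p Sp).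
have [W [F hf]] := sf _ _ hc hc' p Sp cp c'p.
have [W' [G hg]] := sg _ _ hc' hc'' _ (fS _ Sp) c'p c''p.
by do 2 eexists; apply: local_rep_comp hf hg.
Qed.

End LocalReps.

Section Criterion.
Context {T T' : Type} (M : mfd R T) (N : mfd R T').
Hypotheses (hM : manifold M) (hN : manifold N).

Lemma smooth_on_local (S : set T) (f : T -> T') :
  S `<=` car M ->
  (forall p, S p -> exists A, [/\ mopen M A, A p & smooth_on M N (S `&` A) f]) ->
  smooth_on M N S f.
Proof.
move=> SM h; split=> [p Sp|c c' hc hc' p Sp cp c'p].
  by have [A [_ Ap [+ _]]] := h p Sp; apply.
have [A [[AM oA] Ap [_ sf]]] := h p Sp.
have [W [F [oW Wp sF hF]]] := sf _ _ hc hc' p (conj Sp Ap) cp c'p.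
have [V [oV Vp VA]] := oA _ hc _ Ap cp.
exists (W `&` V), F; split=> //; first exact: openI.
  by apply: Coo_on_subset sF => x [].
by move=> q Sq cq [Wq Vq]; apply: hF => //; split=> //; apply: VA.
Qed.

End Criterion.

Section Open.
Context {T : Type}.
Implicit Types (M : mfd R T).

(** By compatibility of the charts, a neighbourhood found in one chart pulls back to every other
    chart through a representative of the identity. *)
Lemma mopenP M (A : set T) : manifold M -> A `<=` car M ->
  (forall p, A p -> exists c V, [/\ atl M c, cdom c p, open V, V (cmap c p)
     & forall q, cdom c q -> V (cmap c q) -> A q]) -> mopen M A.
Proof.
move=> hM AM h; split=> // c1 hc1 p Ap c1p.
have [c [V [hc cp oV Vp VA]]] := h p Ap.
have [W [F [oW Wp sF hF]]] := (manifold_id hM).2 c1 c hc1 hc p (AM _ Ap) c1p cp.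
have [_ Fp] := hF p (AM _ Ap) c1p Wp.
exists (W `&` F @^-1` V); split.
- exact: (open_preimage_Coo oW oV sF).
- by split=> //=; rewrite -Fp.
- move=> q c1q [Wq Vq]; have [cq Fq] := hF q (cdom_car hM hc1 c1q) c1q Wq.
  by apply: VA => //; move: Vq; rewrite /= -Fq.
Qed.

Lemma mopen_chart M c V : manifold M -> atl M c -> open V ->
  mopen M (cdom c `&` cmap c @^-1` V).
Proof.
move=> hM hc oV; apply: mopenP => // [p [cp _]|p [cp Vp]].
  exact: cdom_car hM hc _ cp.
by exists c, V; split=> // q.
Qed.

Lemma mopen_car M : manifold M -> mopen M (car M).
Proof.
move=> hM; split=> // c hc p Mp cp; exists setT; split=> //; first exact: openT.
by move=> q /(cdom_car hM hc).
Qed.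

Lemma mopenI M (A B : set T) : mopen M A -> mopen M B -> mopen M (A `&` B).
Proof.
move=> [AM oA] [_ oB]; split=> [p [/AM]//|c hc p [Ap Bp] cp].
have [V [oV Vp VA]] := oA c hc p Ap cp.
have [V' [oV' V'p VB]] := oB c hc p Bp cp.
exists (V `&` V'); split=> //; first exact: openI.
by move=> q cq [Vq V'q]; split; [apply: VA|apply: VB].
Qed.

Lemma mopen_preimage (T' : Type) M (N : mfd R T') (S : set T) (f : T -> T') A :
  manifold N -> mopen M S -> smooth_on M N S f -> mopen N A ->
  mopen M (S `&` f @^-1` A).
Proof.
move=> hN [SM oS] [fN sf] [_ oA]; split=> [p [/SM]//|c hc p [Sp Ap] cp].
have [c' hc' c'p] := manifold_cover hN (fN p Sp).
have [W [F [oW Wp sF hF]]] := sf c c' hc hc' p Sp cp c'p.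
have [V [oV Vp VA]] := oA c' hc' _ Ap c'p.
have [V' [oV' V'p VS]] := oS c hc p Sp cp.
have [_ Fp] := hF p Sp cp Wp.
exists (W `&` F @^-1` V `&` V'); split.
- exact: (openI (open_preimage_Coo oW oV sF) oV').
- by split=> //; split=> //=; rewrite -Fp.
- move=> q cq [[Wq Vq] /(VS _ cq) Sq]; have [c'q Fq] := hF q Sq cq Wq.
  by split=> //; apply: VA => //; move: Vq; rewrite /= -Fq.
Qed.

(** The rational balls of the charts [C k] form a basis. The sequence may contain default values
    outside the atlas; the sets attached to them are empty. *)
Lemma chart_cover_second_countable M (C : nat -> chart R T) :
  (forall c, atl M c -> cdom c `<=` car M) -> smooth M M idfun ->
  (forall p, car M p -> exists2 k, atl M (C k) & cdom (C k) p) ->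
  msecond_countable M.
Proof.
move=> cM sid cov.
pose I := (nat * seq rat * rat)%type.
pose B (i : I) : set T := [set p | [/\ atl M (C i.1.1), cdom (C i.1.1) p
  & ball (rational_point _ i.1.2) (ratr i.2) (cmap (C i.1.1) p)]].
exists (fun n => if unpickle n is Some i then B i else set0); split.
  move=> n; case: (unpickle n) => [[[k s] q]|]; last by split.
  split=> [p [/= hC Cp _]|c hc p /= [hC Cp Bp] cp]; first exact: cM Cp.
  have [W [F [oW Wp sF hF]]] := sid.2 c (C k) hc hC p (cM _ hC _ Cp) cp Cp.
  have [_ Fp] := hF p (cM _ hC _ Cp) cp Wp.
  exists (W `&` F @^-1` (ball (rational_point _ s) (ratr q))); split.
  - exact: (open_preimage_Coo oW (ball_open _ _) sF).
  - by split=> //=; rewrite -Fp.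
  - move=> x cx [Wx Bx]; have [Cx Fx] := hF x (cM _ hc _ cx) cx Wx.
    by split=> //=; rewrite Fx.
move=> A p [AM oA] Ap; have [k hC Cp] := cov p (AM _ Ap).
have [V [oV Vp VA]] := oA _ hC p Ap Cp.
have [s [q [Bp BO]]] := rational_ball_basis oV Vp.
exists (pickle (k, s, q)); rewrite pickleK; split=> // x [/= _ Cx Bx].
by apply: VA => //; apply: BO.
Qed.

End Open.

End Atlases.

Section Constructions.
Context {R : realType}.

Section Restriction.
Context {T T' : Type}.
Implicit Types (M : mfd R T) (N : mfd R T').

Lemma smooth_on_from_restr M N (A S : set T) (f : T -> T') : S `<=` A ->
  smooth_on (restr M A) N S f -> smooth_on M N S f.
Proof.
move=> SA [fN sf]; split=> // c c' hc hc' p Sp cp c'p.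
have [||W [F [oW Wp sF hF]]] :=
  sf (Chart (cdom c `&` A) (cmap c) (@ccor _ _ c)) c' _ hc' p Sp _ c'p.
- by exists c.
- by split=> //; apply: SA.
- exists W, F; split=> // q Sq cq Wq; apply: hF => //.
  by split=> //; apply: SA.
Qed.

Lemma smooth_on_restr M N (A S : set T) (f : T -> T') :
  smooth_on M N S f -> smooth_on (restr M A) N S f.
Proof.
move=> [fN sf]; split=> // _ c' [c hc ->] hc' p Sp [cp Ap] c'p.
have [W [F [oW Wp sF hF]]] := sf c c' hc hc' p Sp cp c'p.
by exists W, F; split=> // q Sq [cq _] Wq; apply: hF.
Qed.

Lemma smooth_on_to_restr M N (S : set T) (A : set T') (f : T -> T') :
  (forall p, S p -> A (f p)) ->
  smooth_on M N S f -> smooth_on M (restr N A) S f.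
Proof.
move=> SA [fN sf]; split=> [p Sp|c _ hc [c' hc' ->] p Sp cp [c'p _]].
  by split; [apply: fN|apply: SA].
have [W [F [oW Wp sF hF]]] := sf c c' hc hc' p Sp cp c'p.
exists W, F; split=> // q Sq cq Wq; have [c'q Fq] := hF q Sq cq Wq.
by split=> //; split=> //; apply: SA.
Qed.

Lemma smooth_on_into_restr M N (S : set T) (A : set T') (f : T -> T') :
  smooth_on M (restr N A) S f -> smooth_on M N S f.
Proof.
move=> [fN sf]; split=> [p /fN[] //|c c' hc hc' p Sp cp c'p].
have [_ Afp] := fN p Sp.
have [||W [F [oW Wp sF hF]]] :=
  sf c (Chart (cdom c' `&` A) (cmap c') (@ccor _ _ c')) hc _ p Sp cp.
- by exists c'.
- by split.
- by exists W, F; split=> // q Sq cq Wq; have [[]] := hF q Sq cq Wq.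
Qed.

Lemma mopen_restr M (A B : set T) : manifold M ->
  mopen M A -> mopen (restr M A) B <-> mopen M B /\ B `<=` A.
Proof.
move=> hM [AM oA]; split=> [[BA oB]|[[BM oB] BA]].
  split=> [|p /BA[] //]; split=> [p /BA[] //|c hc p Bp cp].
  have [_ Ap] := BA _ Bp; have [V [oV Vp VA]] := oA c hc p Ap cp.
  have [||V' [oV' V'p V'B]] :=
    oB (Chart (cdom c `&` A) (cmap c) (@ccor _ _ c)) _ p Bp.
  - by exists c.
  - by [].
  - exists (V `&` V'); split=> //; first exact: openI.
    by move=> q cq [Vq V'q]; apply: V'B => //; split=> //; apply: VA.
split=> [p Bp|_ [c hc ->] p Bp [cp _]]; first by split; [apply: BM|apply: BA].
have [V [oV Vp VB]] := oB c hc p Bp cp.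
by exists V; split=> // q [cq _]; apply: VB.
Qed.

End Restriction.

Lemma manifold_restr (T : Type) (M : mfd R T) (A : set T) :
  manifold M -> mopen M A -> manifold (restr M A).
Proof.
move=> hM oA; have [AM hA] := oA; split.
- move=> _ [c hc ->]; have [cM ci [U oU cU]] := manifold_chart hM hc.
  split=> /=; first by move=> p [/cM].
    by move=> p q /set_mem[cp _] /set_mem[cq _]; apply: ci; apply/mem_set.
  (* Openness of [A] gives a Euclidean neighbourhood for each point, whereas a chart must have as
     image the trace of a single open set: the union of all admissible ones is taken. *)
  pose V := \bigcup_(V in [set V | open V /\
    (forall q, cdom c q -> V (cmap c q) -> A q)]) V.
  exists (U `&` V).
    apply: openI => //; apply: bigcup_open => V' [] //.
  apply/seteqP; split=> [_ [p [cp Ap] <-]|y [[Uy [V' [oV' V'A] V'y]] sy]].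
    have : (cmap c @` cdom c) (cmap c p) by exists p.
    rewrite cU => -[Up sp]; split=> //; split=> //.
    by have [V' [oV' V'p V'A]] := hA c hc p Ap cp; exists V'.
  have : (U `&` sector (@ccor _ _ c)) y by split.
  rewrite -cU => -[p cp E]; exists p => //; split=> //.
  by apply: V'A; rewrite // E.
- move=> p [/= Mp Ap]; have [c hc cp] := manifold_cover hM Mp.
  by exists (Chart (cdom c `&` A) (cmap c) (@ccor _ _ c)) => //; exists c.
- apply: smooth_on_restr; apply: smooth_on_to_restr; first by move=> p [].
  by apply: smooth_on_subset (manifold_id hM) => p [].
- have [_ _ _ [B [oB hB]] _] := hM.
  exists (fun k => B k `&` A); split=> [k|C p].
    by apply/mopen_restr => //; split; [apply: mopenI|move=> p []].
  move/mopen_restr => [] // oC CA Cp; have [k [Bp BC]] := hB C p oC Cp.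
  by exists k; split=> [|q [/BC]//]; split=> //; apply: CA.
- have [_ _ _ _ [n hn]] := hM; exists n => _ [c hc ->]; exact: (hn c hc).
Qed.

Section Product.
Context {T T' T'' : Type}.
Implicit Types (M : mfd R T) (N : mfd R T') (P : mfd R T'').

Lemma smooth_on_pair M N P (S : set T) (f : T -> T') (g : T -> T'') :
  smooth_on M N S f -> smooth_on M P S g ->
  smooth_on M (mprod N P) S (fun x => (f x, g x)).
Proof.
move=> [fN sf] [gP sg]; split=> [p Sp|c _ hc [c1 [c2 [hc1 hc2 ->]]] p Sp cp].
  by split; [apply: fN|apply: gP].
move=> [/= c1p c2p].
have [W [F [oW Wp sF hF]]] := sf c c1 hc hc1 p Sp cp c1p.
have [W' [G [oW' W'p sG hG]]] := sg c c2 hc hc2 p Sp cp c2p.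
exists (W `&` W'), (fun x => row_mx (F x) (G x)); split=> //.
- exact: openI.
- apply: Coo_on_row_mx; first exact: openI.
    by apply: Coo_on_subset sF => x [].
  by apply: Coo_on_subset sG => x [].
- move=> q Sq cq [Wq W'q]; have [c1q Fq] := hF q Sq cq Wq.
  by have [c2q Gq] := hG q Sq cq W'q; split=> //=; rewrite Fq Gq.
Qed.

Lemma open_lsubmx a b (W : set 'rV[R]_a) :
  open W -> open (@lsubmx R 1 a b @^-1` W).
Proof.
by move=> oW; apply: open_comp => // x _; apply: continuous_linear_rV.
Qed.

Lemma open_rsubmx a b (W : set 'rV[R]_b) :
  open W -> open (@rsubmx R 1 a b @^-1` W).
Proof.
by move=> oW; apply: open_comp => // x _; apply: continuous_linear_rV.
Qed.

Lemma smooth_fst M N : manifold M -> smooth (mprod M N) M fst.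
Proof.
move=> hM; split=> [p [] //|_ c [c1 [c2 [hc1 hc2 ->]]] hc p [Mp _] [/= c1p c2p] cp].
have [W [F [oW Wp sF hF]]] := (manifold_id hM).2 c1 c hc1 hc p.1 Mp c1p cp.
exists (lsubmx @^-1` W), (F \o lsubmx); split=> /=.
- exact: open_lsubmx.
- by rewrite row_mxKl.
- exact: (Coo_on_comp (open_lsubmx oW) oW (fun x h => h) (@Coo_on_lsubmx _ _ _ _) sF).
- move=> q [Mq _] [/= c1q c2q]; rewrite row_mxKl => Wq.
  exact: hF.
Qed.

Lemma smooth_snd M N : manifold N -> smooth (mprod M N) N snd.
Proof.
move=> hN; split=> [p [] //|_ c [c1 [c2 [hc1 hc2 ->]]] hc p [_ Np] [/= c1p c2p] cp].
have [W [F [oW Wp sF hF]]] := (manifold_id hN).2 c2 c hc2 hc p.2 Np c2p cp.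
exists (rsubmx @^-1` W), (F \o rsubmx); split=> /=.
- exact: open_rsubmx.
- by rewrite row_mxKr.
- exact: (Coo_on_comp (open_rsubmx oW) oW (fun x h => h) (@Coo_on_rsubmx _ _ _ _) sF).
- move=> q [_ Nq] [/= c1q c2q]; rewrite row_mxKr => Wq.
  exact: hF.
Qed.

End Product.

Section ProductManifold.
Context {T T' : Type} (M : mfd R T) (N : mfd R T').
Hypotheses (hM : manifold M) (hN : manifold N).

(** For the sup norm, a ball in the product is the product of the balls of the same radius. *)
Lemma open_row_mx a b (V : set 'rV[R]_(a + b)) x y : open V -> V (row_mx x y) ->
  exists V1 V2, [/\ open V1, open V2, V1 x, V2 y
    & forall x' y', V1 x' -> V2 y' -> V (row_mx x' y')].
Proof.
move=> oV Vxy; have /nbhs_ballP[e /= e0 eV] := open_nbhs_nbhs (conj oV Vxy).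
exists (ball x e), (ball y e); split; [exact: ball_open|exact: ball_open|
  exact: ballxx|exact: ballxx|].
move=> x' y' [_ hx] [_ hy]; apply: eV; split=> // i j.
by rewrite ord1 !mxE; case: splitP.
Qed.

Lemma manifold_mprod : manifold (mprod M N).
Proof.
have cov (p : T * T') : car (mprod M N) p ->
    exists2 c, atl (mprod M N) c & cdom c p.
  move=> [Mp Np]; have [c hc cp] := manifold_cover hM Mp.
  have [c' hc' c'p] := manifold_cover hN Np.
  by exists (prod_chart c c') => //; exists c, c'.
have sid : smooth (mprod M N) (mprod M N) idfun.
  apply: (@smooth_on_eq _ _ _ _ _ _ (fun z => (z.1, z.2))); first by case.
  by apply: smooth_on_pair; [apply: smooth_fst|apply: smooth_snd].
split=> //.
- move=> _ [c1 [c2 [hc1 hc2 ->]]].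
  have [c1M i1 [U1 oU1 E1]] := manifold_chart hM hc1.
  have [c2N i2 [U2 oU2 E2]] := manifold_chart hN hc2.
  split=> /=; first by move=> p [/c1M ? /c2N].
    move=> [p q] [p' q'] /set_mem[/= ? ?] /set_mem[/= ? ?] /eq_row_mx[e1 e2].
    by congr (_, _); [apply: i1|apply: i2] => //; apply/mem_set.
  exists (lsubmx @^-1` U1 `&` rsubmx @^-1` U2).
    by apply: openI; [apply: open_lsubmx|apply: open_rsubmx].
  apply/seteqP; split=> [_ [p [c1p c2p] <-]|y [[/= U1y U2y] sy]].
    have : (cmap c1 @` cdom c1) (cmap c1 p.1) by exists p.1.
    have : (cmap c2 @` cdom c2) (cmap c2 p.2) by exists p.2.
    rewrite E1 E2 => -[? s2] [? s1]; split; first by rewrite /= row_mxKl row_mxKr.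
    move=> i; case: (split_ordP i) => j ->.
    - by rewrite row_mxEl; apply: s1.
    - by rewrite row_mxEr; apply: s2.
  have : (U1 `&` sector (@ccor _ _ c1)) (lsubmx y).
    split=> // j cj; rewrite mxE; apply: sy.
    by rewrite /= (unsplitK (inl j)).
  rewrite -E1 => -[p1 c1p e1].
  have : (U2 `&` sector (@ccor _ _ c2)) (rsubmx y).
    split=> // j cj; rewrite mxE; apply: sy.
    by rewrite /= (unsplitK (inr j)).
  rewrite -E2 => -[p2 c2p e2]; exists (p1, p2) => //=.
  by rewrite e1 e2 hsubmxK.
- have [_ _ _ [B [oB hB]] _] := hM; have [_ _ _ [B' [oB' hB']] _] := hN.
  exists (fun n => if unpickle n is Some (k, l) then B k `*` B' l else set0).
  split=> [n|A [p q] [AM oA] Apq].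
    case: (unpickle n) => [[k l]|]; last by split.
    split=> [p [/= /((oB k).1) ? /((oB' l).1)]|] //.
    move=> _ [c1 [c2 [hc1 hc2 ->]]] p [/= B1 B2] [c1p c2p].
    have [V1 [oV1 V1p h1]] := (oB k).2 c1 hc1 _ B1 c1p.
    have [V2 [oV2 V2p h2]] := (oB' l).2 c2 hc2 _ B2 c2p.
    exists (lsubmx @^-1` V1 `&` rsubmx @^-1` V2); split=> /=.
    + by apply: openI; [apply: open_lsubmx|apply: open_rsubmx].
    + by rewrite row_mxKl row_mxKr.
    + move=> q [c1q c2q]; rewrite row_mxKl row_mxKr => -[V1q V2q].
      by split; [apply: h1|apply: h2].
  have [_ [c1 [c2 [hc1 hc2 ->]]] [/= c1p c2q]] := cov _ (AM _ Apq).
  have [||V [oV Vpq VA]] := oA (prod_chart c1 c2) _ (p, q) Apq.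
  - by exists c1, c2.
  - by [].
  have [V1 [V2 [oV1 oV2 V1p V2q V12]]] := open_row_mx oV Vpq.
  have [k [Bp B1]] := hB _ p (mopen_chart hM hc1 oV1) (conj c1p V1p).
  have [l [B'q B2]] := hB' _ q (mopen_chart hN hc2 oV2) (conj c2q V2q).
  exists (pickle (k, l)); rewrite pickleK; split=> // -[p' q'] [/= /B1[? ?] /B2[? ?]].
  by apply: VA => //=; apply: V12.
- have [_ _ _ _ [m hm]] := hM; have [_ _ _ _ [n hn]] := hN.
  by exists (m + n)%N => _ [c1 [c2 [/hm <- /hn <- ->]]].
Qed.

Lemma mopen_mprod (A : set T) (B : set T') :
  mopen M A -> mopen N B -> mopen (mprod M N) (A `*` B).
Proof.
move=> oA oB; have oP := mopen_car manifold_mprod.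
have := mopenI (mopen_preimage hM oP (smooth_fst N hM) oA)
  (mopen_preimage hN oP (smooth_snd M hN) oB).
congr (mopen _ _); apply/seteqP; split=> p /=; first by move=> [[_ ?] [_ ?]].
by move=> [Ap Bp]; do !split=> //; [apply: oA.1|apply: oB.1|apply: oA.1|apply: oB.1].
Qed.

End ProductManifold.

Section Hausdorff.
Context {T T' : Type} (M : mfd R T) (N : mfd R T').

Lemma mhausdorff_inj (f : T -> T') : manifold M -> manifold N -> mhausdorff N ->
  smooth M N f -> (forall p q, car M p -> car M q -> f p = f q -> p = q) ->
  mhausdorff M.
Proof.
move=> hM hN HN sf fi p q Mp Mq pq.
have [|A [B [oA oB Ap Bq AB]]] := HN (f p) (f q) (sf.1 _ Mp) (sf.1 _ Mq).
  by move/(fi _ _ Mp Mq).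
exists (car M `&` f @^-1` A), (car M `&` f @^-1` B); split=> //.
- exact: mopen_preimage (mopen_car hM) sf oA.
- exact: mopen_preimage (mopen_car hM) sf oB.
- by rewrite setIACA -preimage_setI AB preimage_set0 setI0.
Qed.

Lemma mhausdorff_mprod : manifold M -> manifold N ->
  mhausdorff M -> mhausdorff N -> mhausdorff (mprod M N).
Proof.
move=> hM hN HM HN [p p'] [q q'] [/= Mp Np'] [/= Mq Nq'] pq.
have [e|ne] := pselect (p = q); last first.
  have [A [B [oA oB Ap Bq AB]]] := HM p q Mp Mq ne.
  exists (A `*` car N), (B `*` car N); split=> //;
    try by apply: mopen_mprod => //; exact: mopen_car.
  by apply/seteqP; split=> // x [[Ax _] [Bx _]]; have : (A `&` B) x.1 by []; rewrite AB.
have [|A [B [oA oB Ap Bq AB]]] := HN p' q' Np' Nq'; first by move=> e'; rewrite e e' in pq.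
exists (car M `*` A), (car M `*` B); split=> //;
  try by apply: mopen_mprod => //; exact: mopen_car.
by apply/seteqP; split=> // x [[_ Ax] [_ Bx]]; have : (A `&` B) x.2 by []; rewrite AB.
Qed.

End Hausdorff.

End Constructions.

(** * Tangent maps and tame submersions *)

Section Tangent.
Context {R : realType}.

Section Derivatives.
Context {T T' : Type} (M : mfd R T) (N : mfd R T').
Hypothesis hM : manifold M.
Variables (S : set T) (c : chart R T) (p : T).
Hypotheses (oS : mopen M S) (hc : atl M c) (Sp : S p) (cp : cdom c p).

Lemma near_at_right_line d (W : set 'rV[R]_d) (y v : 'rV[R]_d) :
  open W -> W y -> \forall t \near 0^'+, W (t *: v + y).
Proof.
move=> oW Wy; have cl : (fun t : R => t *: v + y) @ (0 : R) --> 0 *: v + y.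
  by apply: cvgD; [apply: cvgZr_tmp|]; [exact: cvg_id|exact: cvg_cst].
rewrite scale0r add0r in cl.
apply: (@cvg_at_right_filter _ _ _ _ _ cl W).
exact: open_nbhs_nbhs.
Qed.

(** Along an inward ray the sector coordinates that vanish at [p] stay nonnegative, and the positive
    ones stay positive for a short time. The ray thus remains in the image of the chart, and in [S]
    because [S] is open. *)
Lemma inward_near (v : 'rV[R]_(cdim c)) : inward (c := c) p v ->
  \forall t \near 0^'+, exists q,
    [/\ S q, cdom c q & cmap c q = t *: v + cmap c p].
Proof.
move=> vin; have [cM ci [U oU cU]] := manifold_chart hM hc.
have [V [oV Vp VS]] := oS.2 c hc p Sp cp.
have [Up sp] : (U `&` sector (@ccor _ _ c)) (cmap c p) by rewrite -cU; exists p.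
have near_sector i : \forall t \near 0^'+,
    ccor (c := c) i -> 0 <= (t *: v + cmap c p) 0 i.
  case ci' : (ccor (c := c) i); last by apply: filterE.
  have := sp i ci'; rewrite le_eqVlt => /predU1P[y0|y0].
    near=> t => _; rewrite !mxE -y0 addr0 mulr_ge0 //.
    exact: (vin i ci' (esym y0)).
  have oP : open [set y : 'rV[R]_(cdim c) | 0 < y 0 i].
    apply: (@open_comp _ _ (fun x : 'rV[R]_(cdim c) => x 0 i) [set y | 0 < y]).
      by move=> x _; apply: coord_continuous.
    exact: open_gt.
  by apply: filterS (near_at_right_line v oP y0) => t /ltW.
have nU := near_at_right_line v oU Up.
have nV := near_at_right_line v oV Vp.
have ns : \forall t \near 0^'+, forall i,
    ccor (c := c) i -> 0 <= (t *: v + cmap c p) 0 i.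
  exact: filter_forall near_sector.
near=> t.
have : (U `&` sector (@ccor _ _ c)) (t *: v + cmap c p).
  split; first by near: t.
  by near: t.
rewrite -cU => -[q cq E]; exists q; split=> //.
by apply: VS => //; rewrite E; near: t.
Unshelve. all: by end_near. Qed.

(** One-sided quotients suffice for a differentiable map, and only they make sense at the boundary,
    where a ray stays in the sector for [t > 0] only. *)
Lemma derive_at_right d e (F : 'rV[R]_d -> 'rV[R]_e) (y v : 'rV[R]_d) :
  differentiable F y ->
  (fun t : R => t^-1 *: (F (t *: v + y) - F y)) @ 0^'+ --> 'D_v F y.
Proof.
move=> dF; have h : derivable F y v := diff_derivable dF.
by apply: cvg_dnbhs_at_right; apply: h.
Qed.

Variables (c' : chart R T') (f : T -> T').
Hypothesis c'p : cdom c' (f p).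

(** A vector with nonnegative coordinates is inward at every point, so the positive and negative
    parts of [v] show that inward vectors span the tangent space. *)
Lemma inward_span d (v : 'rV[R]_d) :
  exists a b : 'rV[R]_d, [/\ forall i, 0 <= a 0 i, forall i, 0 <= b 0 i & v = a - b].
Proof.
exists (\row_i Num.max (v 0 i) 0), (\row_i Num.max (- v 0 i) 0); split.
- by move=> i; rewrite mxE le_max lexx orbT.
- by move=> i; rewrite mxE le_max lexx orbT.
- apply/rowP => i; rewrite !mxE.
  case: (leP (v 0 i) 0) => h; first by rewrite max_l ?oppr_ge0 // opprK add0r.
  by rewrite max_r ?oppr_le0 ?subr0 // ltW.
Qed.

(** Along inward rays both representatives compute the coordinates of [f], so their one-sided
    derivatives agree; linearity of the differential extends this to all vectors. *)
Lemma local_rep_derive_unique W F W' F' :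
  @local_rep R _ _ S f c c' p W F -> @local_rep R _ _ S f c c' p W' F' ->
  forall v, 'D_v F (cmap c p) = 'D_v F' (cmap c p).
Proof.
move=> [oW Wp sF hF] [oW' W'p sF' hF'].
have dF : differentiable F (cmap c p) by apply: Coo_on_differentiable sF _ Wp.
have dF' : differentiable F' (cmap c p) by apply: Coo_on_differentiable sF' _ W'p.
have key v : inward (c := c) p v -> 'D_v F (cmap c p) = 'D_v F' (cmap c p).
  move=> vin; have h := derive_at_right (v := v) dF; have h' := derive_at_right (v := v) dF'.
  have nW := near_at_right_line v oW Wp; have nW' := near_at_right_line v oW' W'p.
  have nq := inward_near vin.
  apply: norm_cvg_unique h _; apply: cvg_trans h'; apply: near_eq_cvg.
  have /= [_ Fp] := hF p Sp cp Wp; have /= [_ F'p] := hF' p Sp cp W'p.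
  near=> t; have [q [Sq cq E]] : exists q,
    [/\ S q, cdom c q & cmap c q = t *: v + cmap c p] by near: t.
  have [_ Fq] : cdom c' (f q) /\ cmap c' (f q) = F (cmap c q).
    by apply: hF => //; rewrite E; near: t.
  have [_ F'q] : cdom c' (f q) /\ cmap c' (f q) = F' (cmap c q).
    by apply: hF' => //; rewrite E; near: t.
  by rewrite -E -Fq -Fp -F'q -F'p.
move=> v; have [a [b [a0 b0 ->]]] := inward_span v.
have E : forall G : 'rV[R]_(cdim c) -> 'rV[R]_(cdim c'), differentiable G (cmap c p) ->
    'D_(a - b) G (cmap c p) = 'D_a G (cmap c p) - 'D_b G (cmap c p).
  by move=> G dG; rewrite !deriveE // linearB.
have ia : inward (c := c) p a by move=> ? _ _; exact: a0.
have ib : inward (c := c) p b by move=> ? _ _; exact: b0.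
by rewrite (E F dF) (E F' dF') (key a ia) (key b ib).
Unshelve. all: by end_near. Qed.

(** The image of an inward ray stays in the target sector, so a coordinate that vanishes at [f p]
    has nonnegative difference quotients. This holds for every smooth map; tameness adds the
    converse. *)
Lemma inward_derive W F v : manifold N -> atl N c' ->
  @local_rep R _ _ S f c c' p W F -> inward (c := c) p v ->
  inward (c := c') (f p) ('D_v F (cmap c p)).
Proof.
move=> hN hc' [oW Wp sF hF] vin i ci fi0.
have dF : differentiable F (cmap c p) by apply: Coo_on_differentiable sF _ Wp.
have h := derive_at_right (v := v) dF.
have nW := near_at_right_line v oW Wp; have nq := inward_near vin.
have hi : (fun t : R => (t^-1 *: (F (t *: v + cmap c p) - F (cmap c p))) 0 i) @ 0^'+
    --> ('D_v F (cmap c p)) 0 i.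
  apply: (cvg_comp _ (fun x : 'rV[R]_(cdim c') => x 0 i) h).
  exact: coord_continuous.
have [_ Fp] := hF p Sp cp Wp.
have ge0 : \forall t \near 0^'+,
    0 <= (t^-1 *: (F (t *: v + cmap c p) - F (cmap c p))) 0 i.
  near=> t; have [q [Sq cq E]] : exists q,
    [/\ S q, cdom c q & cmap c q = t *: v + cmap c p] by near: t.
  have [c'q Fq] : cdom c' (f q) /\ cmap c' (f q) = F (cmap c q).
    by apply: hF => //; rewrite E; near: t.
  rewrite -E -Fq -Fp !mxE fi0 subr0 mulr_ge0 ?invr_ge0 //.
  have [_ _ [U _ cU]] := manifold_chart hN hc'.
  have : (U `&` sector (@ccor _ _ c')) (cmap c' (f q)) by rewrite -cU; exists (f q).
  by case=> _; apply.
exact: cvgr_to_ge hi ge0.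
Unshelve. all: by end_near. Qed.

End Derivatives.

Definition tame_at (T T' : Type) (M : mfd R T) (N : mfd R T') (S : set T) (f : T -> T') (p : T) : Prop :=
  forall c c', atl M c -> atl N c' -> cdom c p -> cdom c' (f p) ->
  forall W F, @local_rep R _ _ S f c c' p W F ->
    (forall w, exists v, 'D_v F (cmap c p) = w) /\
    (forall v, inward (c := c') (f p) ('D_v F (cmap c p)) <->
               inward (c := c) p v).

Section Tame.
Context {T T' T'' : Type}.
Implicit Types (M : mfd R T) (N : mfd R T') (P : mfd R T'').

Lemma local_rep_derive_comp M (S : set T) (S' : set T') (f : T -> T')
    (g : T' -> T'') (c : chart R T) (c' : chart R T') (c'' : chart R T'')
    p W F W' G W'' H :
  manifold M -> mopen M S -> S p -> atl M c -> cdom c p ->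
  (forall q, S q -> S' (f q)) ->
  @local_rep R _ _ S f c c' p W F -> @local_rep R _ _ S' g c' c'' (f p) W' G ->
  @local_rep R _ _ S (g \o f) c c'' p W'' H ->
  forall v, 'D_v H (cmap c p) = 'D_('D_v F (cmap c p)) G (cmap c' (f p)).
Proof.
move=> hM oS Sp hc cp fS hF hG hH v.
have hGF := local_rep_comp Sp cp fS hF hG.
rewrite (local_rep_derive_unique hM oS hc Sp cp hH hGF).
have [_ Wp sF hF'] := hF; have [_ W'p sG _] := hG.
have [_ Fp] := hF' p Sp cp Wp.
rewrite derive_comp_rV -?Fp //; first exact: Coo_on_differentiable sF _ Wp.
exact: Coo_on_differentiable sG _ W'p.
Qed.

(** A representative over the larger set is one over the smaller, so enlarging the set leaves fewer
    representatives to test. Tameness found on an open piece therefore holds globally. *)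
Lemma tame_at_subset M N (S S' : set T) (f : T -> T') p :
  S' `<=` S -> tame_at M N S' f p -> tame_at M N S f p.
Proof.
move=> sS h c c' hc hc' cp c'p W F hF; apply: h => //.
exact: local_rep_subset hF.
Qed.

Lemma tame_at_eq M N (S : set T) (f g : T -> T') p :
  S p -> (forall q, S q -> f q = g q) -> tame_at M N S f p -> tame_at M N S g p.
Proof.
move=> Sp fg h c c' hc hc' cp c'p W F hF.
have := h c c' hc hc' cp; rewrite fg //; apply=> //.
by apply: local_rep_eq hF => q /fg.
Qed.

Lemma tame_at_comp M N P (S : set T) (S' : set T') (f : T -> T') (g : T' -> T'')
    p : manifold M -> manifold N -> mopen M S -> S p ->
  (forall q, S q -> S' (f q)) -> smooth_on M N S f -> smooth_on N P S' g ->
  tame_at M N S f p -> tame_at N P S' g (f p) -> tame_at M P S (g \o f) p.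
Proof.
move=> hM hN oS Sp fS [fN sf] [gP sg] tf tg c c'' hc hc'' cp c''p W H hH.
have [c' hc' c'p] := manifold_cover hN (fN p Sp).
have [W1 [F hF]] := sf c c' hc hc' p Sp cp c'p.
have [W2 [G hG]] := sg c' c'' hc' hc'' _ (fS _ Sp) c'p c''p.
have D := local_rep_derive_comp hM oS Sp hc cp fS hF hG hH.
have [Fs Fi] := tf c c' hc hc' cp c'p _ _ hF.
have [Gs Gi] := tg c' c'' hc' hc'' c'p c''p _ _ hG.
split=> [w|v]; last by rewrite D; apply: (iff_trans (Gi _)).
by have [v <-] := Gs w; have [u <-] := Fs v; exists u; rewrite D.
Qed.

End Tame.

Lemma local_rep_derive_id (T : Type) (M : mfd R T) (S : set T) (c : chart R T) p W F :
  manifold M -> mopen M S -> S p -> atl M c -> cdom c p ->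
  @local_rep R _ _ S idfun c c p W F -> forall v, 'D_v F (cmap c p) = v.
Proof.
move=> hM oS Sp hc cp hF v.
have hid : @local_rep R _ _ S idfun c c p setT idfun.
  by split=> //; [exact: openT|exact: Coo_on_id].
by rewrite (local_rep_derive_unique hM oS hc Sp cp hF hid) derive_id.
Qed.

Section TameDiffeo.
Context {T T' : Type}.
Implicit Types (M : mfd R T) (N : mfd R T').

(** The chain rule for [g \o f] and [f \o g] makes the tangent maps mutually inverse, and
    [inward_derive] for [f] and for [g] gives the two directions of the equivalence. *)
Lemma tame_at_diffeo M N (S : set T) (S' : set T') (f : T -> T') (g : T' -> T)
    p : manifold M -> manifold N -> mopen M S -> mopen N S' -> S p ->
  smooth_on M N S f -> smooth_on N M S' g ->
  (forall q, S q -> S' (f q)) -> (forall q, S' q -> S (g q)) ->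
  (forall q, S q -> g (f q) = q) -> (forall q, S' q -> f (g q) = q) ->
  tame_at M N S f p.
Proof.
move=> hM hN oS oS' Sp [fN sf] [gM sg] fS gS gf fg c c' hc hc' cp c'p W F hF.
have S'p := fS _ Sp.
have [|W' [G hG]] := sg c' c hc' hc (f p) S'p c'p; first by rewrite gf.
have hGF := local_rep_comp Sp cp fS hF hG.
have hGF1 := local_rep_eq gf hGF.
have GF v : 'D_('D_v F (cmap c p)) G (cmap c' (f p)) = v.
  rewrite -(local_rep_derive_comp hM oS Sp hc cp fS hF hG hGF).
  exact: (local_rep_derive_id hM oS Sp hc cp hGF1).
have hF' : @local_rep R _ _ S f c c' (g (f p)) W F by rewrite gf.
have hFG := local_rep_comp S'p c'p gS hG hF'.
have hFG1 := local_rep_eq fg hFG.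
have FG w : 'D_('D_w G (cmap c' (f p))) F (cmap c p) = w.
  have := local_rep_derive_comp hN oS' S'p hc' c'p gS hG hF' hFG.
  rewrite gf // => <-.
  exact: (local_rep_derive_id hN oS' S'p hc' c'p hFG1).
split=> [w|v]; first by exists ('D_w G (cmap c' (f p))); rewrite FG.
split=> h; last exact: (inward_derive hM oS hc Sp cp hN hc' hF).
rewrite -[v]GF -[p in inward p](gf p Sp).
by apply: (inward_derive hN oS' hc' S'p c'p hM hc hG).
Qed.

End TameDiffeo.

Section Projection.
Context {T T' : Type} (M : mfd R T) (N : mfd R T').

(** The chart [c] of the target may differ from the factor [c1] of the product chart, so the
    projection is followed by a change of charts, tame as a diffeomorphism. As [N] has no boundary,
    its sector coordinates never vanish and put no condition on inward vectors. *)
Lemma tame_at_fst (p : T * T') : manifold M -> manifold N ->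
  boundaryless N -> car (mprod M N) p ->
  tame_at (mprod M N) M (car (mprod M N)) fst p.
Proof.
move=> hM hN bN Mp _ c [c1 [c2 [hc1 hc2 ->]]] hc [/= c1p c2p] cp W F hF.
have [W' [G hG]] := (manifold_id hM).2 c1 c hc1 hc p.1 Mp.1 c1p cp.
have hP := manifold_mprod hM hN.
have hcc : atl (mprod M N) (prod_chart c1 c2) by exists c1, c2.
have hfst : @local_rep R _ _ (car (mprod M N)) fst (prod_chart c1 c2) c1 p
    setT lsubmx.
  split=> //; [exact: openT|exact: Coo_on_lsubmx|].
  by move=> q [Mq Nq] [/= c1q c2q] _; rewrite row_mxKl.
have D := local_rep_derive_comp hP (mopen_car hP) Mp hcc (conj c1p c2p)
  (fun q (h : car (mprod M N) q) => h.1) hfst hG hF.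
have Dl v : 'D_v lsubmx (cmap (prod_chart c1 c2) p) = lsubmx v :> 'rV[R]_(cdim c1).
  rewrite deriveE ?diff_lin //; first exact: continuous_linear_rV.
  by apply: linear_differentiable; exact: continuous_linear_rV.
have sid := manifold_id hM.
have [Gs Gi] := tame_at_diffeo hM hM (mopen_car hM) (mopen_car hM) Mp.1 sid sid
  (fun q h => h) (fun q h => h) (fun q h => erefl) (fun q h => erefl)
  hc1 hc c1p cp hG.
split=> [w|v].
  have [v <-] := Gs w; exists (row_mx v 0).
  by rewrite D Dl row_mxKl.
rewrite D Dl; apply: (iff_trans (Gi _)); split=> h i.
  rewrite /=; case: (split_ordP i) => j ->; rewrite ?row_mxEl ?row_mxEr.
    move=> cj y0; have := h j cj y0.
    by rewrite mxE.
  move=> cj y0.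
  by have := bN c2 hc2 p.2 c2p j cj; rewrite y0 ltxx.
move=> ci y0; rewrite mxE; apply: h; first by rewrite /= (unsplitK (inl i)).
by rewrite /= row_mxEl.
Qed.

End Projection.
End Tangent.

(** * Gluing manifolds and groupoids *)

Section Amalgam.
Context {R : realType} {I : countType} {T_ : I -> Type} {T : Type}.
Variables (M_ : forall a, mfd R (T_ a)) (j : forall a, T_ a -> T) (M : mfd R T).

(** A common form for the gluing of objects and of arrows. Transitions are required only near each
    common point, as smooth maps [h] commuting with the inclusions [j]; exchanging [a] and [b]
    provides the other direction. *)
Record amalgam : Prop := Amalgam {
  amalgam_mfd : forall a, manifold (M_ a);
  amalgam_dim : exists n, forall a c, atl (M_ a) c -> cdim c = n;
  amalgam_inj : forall a x y,
    car (M_ a) x -> car (M_ a) y -> j x = j y -> x = y;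
  amalgam_car : forall z,
    car M z <-> exists a (x : T_ a), car (M_ a) x /\ j x = z;
  amalgam_atl : forall c,
    atl M c <-> exists a, push_atlas (@j a) (atl (M_ a)) c;
  amalgam_overlap : forall a b (x : T_ a) (y : T_ b),
    car (M_ a) x -> car (M_ b) y -> j x = j y ->
    exists S h, [/\ mopen (M_ a) S, S x, smooth_on (M_ a) (M_ b) S h
      & forall q, S q -> j (h q) = j q] }.

Hypothesis am : amalgam.
Let hM := amalgam_mfd am.
Let j_inj := amalgam_inj am.
Let carE := amalgam_car am.
Let atlE := amalgam_atl am.

(** Injectivity of [j] on a piece makes the coordinates of a point of the image well defined; off
    the image the value 0 is arbitrary. *)
Lemma push_chart_exists a (c : chart R (T_ a)) : atl (M_ a) c ->
  exists h, (forall x, cdom c x -> h (j x) = cmap c x) /\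
            atl M (Chart (@j a @` cdom c) h (@ccor _ _ c)).
Proof.
move=> hc; pose h z := if pselect (exists x, cdom c x /\ j x = z) is left e
  then cmap c (sval (cid e)) else 0.
have hE x : cdom c x -> h (j x) = cmap c x.
  move=> cx; rewrite /h; case: pselect => [e|[]]; last by exists x.
  have [cy E] := svalP (cid e); congr (cmap c _).
  by apply: j_inj E; apply: (cdom_car (hM a) hc).
by exists h; split=> //; apply/atlE; exists a, c, h.
Qed.

(** Injectivity forces the local transition to send [x] to [y]; read in coordinates, it compares any
    two pushed charts around a common point. *)
Lemma amalgam_overlap_rep a b (c : chart R (T_ a)) (c' : chart R (T_ b)) x y :
  atl (M_ a) c -> atl (M_ b) c' -> cdom c x -> cdom c' y -> j x = j y ->
  exists W F, [/\ open W, W (cmap c x), Coo_on W F & forall q, cdom c q ->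
    W (cmap c q) -> exists q', [/\ cdom c' q', j q' = j q
                                 & cmap c' q' = F (cmap c q)]].
Proof.
move=> hc hc' cx c'y xy; have Mx := cdom_car (hM a) hc cx.
have My := cdom_car (hM b) hc' c'y.
have [S [h [[SM oS] Sx [hN sh] hS]]] := amalgam_overlap am Mx My xy.
have hxy : h x = y by apply: j_inj => //; [apply: hN|rewrite hS].
have [|W [F [oW Wx sF hF]]] := sh c c' hc hc' x Sx cx; first by rewrite hxy.
have [V [oV Vx VS]] := oS c hc x Sx cx.
exists (W `&` V), F; split=> //; first exact: openI.
  by apply: Coo_on_subset sF => z [].
move=> q cq [Wq Vq]; have Sq := VS q cq Vq; have [c'q Fq] := hF q Sq cq Wq.
by exists (h q); split=> //; apply: hS.
Qed.

Lemma smooth_amalgam_in a : smooth (M_ a) M (@j a).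
Proof.
split=> [x Mx|c c0 hc /atlE[b [c' [h [hc' hE ->]]]] x Mx cx [y c'y yx]].
  by apply/carE; exists a, x.
have [W [F [oW Wx sF hF]]] := amalgam_overlap_rep hc hc' cx c'y (esym yx).
exists W, F; split=> // q Mq cq Wq; have [q' [c'q' E Fq']] := hF q cq Wq.
by split; [exists q'|rewrite /= -E hE].
Qed.

Lemma smooth_amalgam_out a (h : T -> T_ a) :
  (forall x, car (M_ a) x -> h (j x) = x) ->
  smooth_on M (M_ a) (@j a @` car (M_ a)) h.
Proof.
move=> hj; split=> [_ [x Mx <-]|]; first by rewrite hj.
move=> c0 c' /atlE[b [c [k [hc kE ->]]]] hc' _ [x Mx <-] [y cy yx] c'x.
rewrite hj // in c'x.
have [W [F [oW Wy sF hF]]] := amalgam_overlap_rep hc hc' cy c'x yx.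
exists W, F; split=> //=; first by rewrite -yx kE.
move=> _ [z Mz <-] [q cq qz] Wq; rewrite -qz kE // in Wq.
have [q' [c'q' E Fq']] := hF q cq Wq.
have -> : h (j z) = q' by rewrite -qz -E hj //; apply: (cdom_car (hM a) hc').
by split=> //; rewrite -qz kE.
Qed.

Lemma mopen_amalgam_in a (A : set (T_ a)) :
  mopen (M_ a) A -> mopen M (@j a @` A).
Proof.
move=> [AM oA]; split=> [_ [x /AM Mx <-]|]; first by apply/carE; exists a, x.
move=> c0 /atlE[b [c [k [hc kE ->]]]] _ [x Ax <-] [y cy yx].
have [c' hc' c'x] := manifold_cover (hM a) (AM _ Ax).
have [V [oV Vx VA]] := oA c' hc' x Ax c'x.
have [W [F [oW Wy sF hF]]] := amalgam_overlap_rep hc hc' cy c'x yx.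
have [q' [c'q' E Fy]] := hF y cy Wy.
have q'x : q' = x.
  by apply: j_inj; [exact: (cdom_car (hM a) hc')|exact: AM|rewrite E].
exists (W `&` F @^-1` V); split=> /=.
- exact: (open_preimage_Coo oW oV sF).
- by rewrite -yx kE //; split=> //=; rewrite -Fy q'x.
- move=> _ [q cq <-]; rewrite kE // => -[Wq Vq].
  have [z [c'z Ez Fz]] := hF q cq Wq.
  by exists z => //; apply: VA => //; rewrite Fz.
Qed.

Lemma manifold_amalgam : manifold M.
Proof.
split.
- move=> _ /atlE[a [c [h [hc hE ->]]]].
  have [cM ci [U oU cU]] := manifold_chart (hM a) hc; split=> /=.
  + by move=> _ [x /cM Mx <-]; apply/carE; exists a, x.
  + move=> p q /set_mem[x cx <-] /set_mem[y cy <-]; rewrite !hE // => E.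
    by congr (j _); apply: ci E; apply/mem_set.
  + exists U => //; rewrite -cU; apply/seteqP; split=> [_ [_ [x cx <-] <-]|].
      by exists x => //; rewrite hE.
    by move=> _ [x cx <-]; exists (j x); [exists x|rewrite hE].
- move=> p /carE[a [x [Mx <-]]]; have [c hc cx] := manifold_cover (hM a) Mx.
  have [h [hE hc0]] := push_chart_exists hc.
  by eexists; [exact: hc0|exists x].
- split=> // c0 c1 /atlE[a [c [h [hc hE ->]]]] hc1 p Mp [x cx xp] c1p.
  subst p; have [W [F [oW Wx sF hF]]] :=
    (smooth_amalgam_in a).2 c c1 hc hc1 x (cdom_car (hM a) hc cx) cx c1p.
  exists W, F; split=> //=; first by rewrite hE.
  move=> _ _ [q cq <-]; rewrite hE // => Wq.
  exact: hF (cdom_car (hM a) hc cq) cq Wq.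
- have exB a : exists B : nat -> set (T_ a), (forall k, mopen (M_ a) (B k)) /\
      forall A p, mopen (M_ a) A -> A p -> exists k, B k p /\ B k `<=` A.
    by have [] := hM a.
  pose B a := sval (cid (exB a)); have hB a := svalP (cid (exB a)).
  (* Bases of the pieces are pushed forward together; this is where the index type has to be
     countable. *)
  exists (fun n => if unpickle n is Some (a, k) then @j a @` B a k else set0).
  split=> [n|A p [AM oA] Ap].
    case: (unpickle n) => [[a k]|]; last by split.
    by apply: mopen_amalgam_in; apply: (hB a).1.
  have [a [x [Mx xp]]] := (carE p).1 (AM _ Ap); subst p.
  have oA' : mopen (M_ a) (car (M_ a) `&` @j a @^-1` A).
    split=> [q []//|c hc q [Mq Aq] cq].
    have [h [hE hc0]] := push_chart_exists hc.
    have [|V [oV Vq VA]] := oA _ hc0 (j q) Aq; first by exists q.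
    rewrite /= hE // in Vq; exists V; split=> // z cz Vz.
    split; first exact: (cdom_car (hM a) hc).
    by apply: VA; [exists z|rewrite /= hE].
  have [k [Bx BA]] := (hB a).2 _ x oA' (conj Mx Ap).
  exists (pickle (a, k)); rewrite pickleK; split; first by exists x.
  by move=> _ [q /BA[_ Aq] <-].
- have [n hn] := amalgam_dim am.
  by exists n => _ /atlE[a [c [h [hc _ ->]]]]; apply: (hn a c).
Qed.

(** This concerns two points of one piece. Gluing Hausdorff manifolds can create inseparable points,
    so pairs taken from different pieces need a separate argument. *)
Lemma amalgam_separate a (x y : T_ a) : mhausdorff (M_ a) ->
  car (M_ a) x -> car (M_ a) y -> x <> y ->
  exists A B, [/\ mopen M A, mopen M B, A (j x), B (j y) & A `&` B = set0].
Proof.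
move=> Ha Mx My xy; have [A [B [oA oB Ax By AB]]] := Ha x y Mx My xy.
exists (@j a @` A), (@j a @` B); split.
- exact: mopen_amalgam_in.
- exact: mopen_amalgam_in.
- by exists x.
- by exists y.
- apply/seteqP; split=> // _ [[p Ap <-] [q Bq E]].
  have qp : q = p by apply: j_inj => //; [apply: oB.1|apply: oA.1].
  by have : (A `&` B) p; [split=> //; rewrite -qp|rewrite AB].
Qed.

End Amalgam.

(** * Smoothness and tameness for action groupoids *)

Section ActionGroupoid.
Context {R : realType} {S S' : Type}.
Variables (X : mfd R S) (K : grp R S') (act : S -> S' -> S).
Hypotheses (hX : manifold X) (hK : Lie_group K)
  (hact : smooth_right_action X K act).

Let A := action_groupoid X K act.
Let hKm : manifold (gcar K). Proof. by case: hK => -[]. Qed.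
Let hXK : manifold (arr A). Proof. exact: manifold_mprod. Qed.

Lemma smooth_act (T : Type) (M : mfd R T) (Z : set T) f g :
  smooth_on M X Z f -> smooth_on M (gcar K) Z g ->
  smooth_on M X Z (fun z => act (f z) (g z)).
Proof.
move=> sf sg; have [sact _ _] := hact.
apply: (@smooth_on_comp _ _ _ _ M (mprod X (gcar K)) X Z _
  (fun z => (f z, g z)) _ hXK _ _ sact).
  by move=> q Zq; split; [apply: sf.1|apply: sg.1].
exact: smooth_on_pair.
Qed.

Lemma smooth_ginv (T : Type) (M : mfd R T) (Z : set T) g :
  smooth_on M (gcar K) Z g -> smooth_on M (gcar K) Z (fun z => ginv K (g z)).
Proof.
move=> sg; have [_ _ _ _ [_ sV]] := hK.
exact: (smooth_on_comp hKm sg.1 sg sV).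
Qed.

Lemma smooth_gmul (T : Type) (M : mfd R T) (Z : set T) f g :
  smooth_on M (gcar K) Z f -> smooth_on M (gcar K) Z g ->
  smooth_on M (gcar K) Z (fun z => gmul K (f z) (g z)).
Proof.
move=> sf sg; have [_ _ _ _ [sM _]] := hK.
apply: (@smooth_on_comp _ _ _ _ M (mprod (gcar K) (gcar K)) _ Z _
  (fun z => (f z, g z)) _ _ _ _ sM).
- exact: manifold_mprod.
- by move=> q Zq; split; [apply: sf.1|apply: sg.1].
- exact: smooth_on_pair.
Qed.

Lemma smooth_cst (T T' : Type) (M : mfd R T) (N : mfd R T') (Z : set T) y :
  manifold M -> Z `<=` car M -> manifold N -> car N y ->
  smooth_on M N Z (fun=> y).
Proof.
move=> hM ZM hN Ny; split=> // c c' hc hc' p Zp cp c'y.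
exists setT, (cst (cmap c' y)); split=> //; first exact: openT.
exact: Coo_on_cst.
Qed.

Lemma action_src_smooth : smooth (arr A) X (src A).
Proof.
by apply: smooth_act; [apply: smooth_fst|apply/smooth_ginv/smooth_snd].
Qed.

Lemma gmulKV x k : car X x -> car (gcar K) k ->
  act (act x (ginv K k)) k = x /\ act (act x k) (ginv K k) = x.
Proof.
move=> Xx Kk; have [_ K1 _ h [_ [sV _]]] := hK.
have [_ a1 aM] := hact; have [_ _ e1 e2] := h k Kk.
have KV : car (gcar K) (ginv K k) := sV _ Kk.
by rewrite !aM // e1 e2 a1.
Qed.

Lemma action_src_tame a : car (arr A) a ->
  tame_at (arr A) X (car (arr A)) (src A) a.
Proof.
move=> Aa; have [[_ _ bK] K1 _ h [_ sV]] := hK.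
have [sact _ _] := hact.
(* [Phi] replaces the range of an arrow by its domain and keeps the group element, so that the
   domain map is [fst \o Phi]; [Psi] undoes it. The projection is tame because a Lie group has no
   boundary. *)
pose Phi (a : S * S') := (act a.1 (ginv K a.2), a.2).
pose Psi (a : S * S') := (act a.1 a.2, a.2).
have sPhi : smooth (arr A) (arr A) Phi.
  by apply: smooth_on_pair; [exact: action_src_smooth|exact: smooth_snd].
have sPsi : smooth (arr A) (arr A) Psi.
  by apply: smooth_on_pair; [exact: sact|exact: smooth_snd].
apply: (@tame_at_comp _ _ _ _ (arr A) (arr A) X (car (arr A)) (car (arr A)) Phi fst);
  rewrite //.
- exact: mopen_car.
- exact: sPhi.1.
- exact: smooth_fst.
- apply: (tame_at_diffeo hXK hXK (mopen_car hXK) (mopen_car hXK) Aa sPhi sPsi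
    sPhi.1 sPsi.1).
  + by move=> [x k] [/= Xx Kk]; rewrite /Psi /= (gmulKV Xx Kk).1.
  + by move=> [x k] [/= Xx Kk]; rewrite /Phi /= (gmulKV Xx Kk).2.
- apply: tame_at_fst => //; exact: sPhi.1.
Qed.

Lemma action_one_smooth : smooth X (arr A) (Defs.one A).
Proof.
apply: smooth_on_pair; first exact: manifold_id.
by apply: smooth_cst => //; have [] := hK.
Qed.

Lemma action_inv_smooth : smooth (arr A) (arr A) (Defs.inv A).
Proof.
apply: smooth_on_pair; first exact: action_src_smooth.
exact/smooth_ginv/smooth_snd.
Qed.

Lemma action_mul_smooth : smooth (mprod (arr A) (arr A)) (arr A)
  (fun z => Defs.mul A z.1 z.2).
Proof.
have hAA := manifold_mprod hXK hXK.
have s1 := smooth_fst (arr A) hXK; have s2 := smooth_snd (arr A) hXK.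
apply: smooth_on_pair.
  exact: (smooth_on_comp hXK s1.1 s1 (smooth_fst _ hX)).
apply: smooth_gmul.
  exact: (smooth_on_comp hXK s2.1 s2 (smooth_snd _ hKm)).
exact: (smooth_on_comp hXK s1.1 s1 (smooth_snd _ hKm)).
Qed.

End ActionGroupoid.

(** * Lie groupoids from covers by action groupoids *)

Section LieCover.
Context {R : realType} {T T' : Type} (G : gpd R T T').
Hypotheses (hA : manifold (arr G)) (hO : manifold (obj G))
  (Gax : groupoid_axioms G)
  (car_srng : forall g, car (arr G) g ->
     car (obj G) (src G g) /\ car (obj G) (rng G g))
  (car_one : forall x, car (obj G) x -> car (arr G) (Defs.one G x))
  (car_inv : forall g, car (arr G) g -> car (arr G) (Defs.inv G g))
  (car_mul : forall g h, composable G (g, h) -> car (arr G) (Defs.mul G g h)).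

(** Convertible to the carrier of the arrows of [reduction G U], but regarded as a subset of the
    unrestricted manifold of arrows. *)
Definition arrows_over (U : set T') : set T :=
  car (arr G) `&` (src G @^-1` U `&` rng G @^-1` U).

Section Piece.
Variable U : set T'.
Hypotheses (oU : mopen (obj G) U) (oA : mopen (arr G) (arrows_over U))
  (hU : locally_action G U).

(** Each structure map of [G] is the one of the action groupoid conjugated by the isomorphism: for
    instance the domain map is [f' \o src H \o F] over [U]. Only the algebraic axioms of [G] are
    assumed, and its smoothness is carried back from [H]. *)
Lemma locally_action_smooth :
  [/\ smooth_on (arr G) (obj G) (arrows_over U) (src G) /\
      smooth_on (arr G) (obj G) (arrows_over U) (rng G),
      smooth_on (obj G) (arr G) U (Defs.one G),
      smooth_on (arr G) (arr G) (arrows_over U) (Defs.inv G),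
      smooth_on (mprod (arr G) (arr G)) (arr G)
        (composable G `&` arrows_over U `*` arrows_over U)
        (fun z => Defs.mul G z.1 z.2)
    & forall g, arrows_over U g ->
        tame_at (arr G) (obj G) (arrows_over U) (src G) g].
Proof.
have [S [S' [X [K [act [U' [[hX _] hK hact oU' iso]]]]]]] := hU.
have [F [F' [f [f' [[sF sF' FK F'K] [sf sf' fK f'K] Fsr F1 FM]]]]] := iso.
set H := action_groupoid X K act; set B := arrows_over U.
have hKm : manifold (gcar K) by case: hK => -[].
have hH : manifold (arr H) := manifold_mprod hX hKm.
pose B' := car (arr H) `&` (src H @^-1` U' `&` rng H @^-1` U').
have sH := action_src_smooth hX hK hact; have rH : smooth (arr H) X (rng H) := smooth_fst _ hX.
have oH := mopen_car hH.
have oB' : mopen (arr H) B'.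
  have := mopenI (mopen_preimage hX oH sH oU') (mopen_preimage hX oH rH oU').
  congr (mopen _ _); apply/seteqP; split=> a; first by move=> [[? ?] [_ ?]].
  by move=> [? []].
have FB : forall g, B g -> B' (F g) := sF.1.
have F'B : forall a, B' a -> B (F' a) := sF'.1.
pose V := car (obj G) `&` U; pose V' := car X `&` U'.
have fV : forall x, V x -> V' (f x) := sf.1.
have f'V : forall x, V' x -> V (f' x) := sf'.1.
have UV x : U x -> V x by move=> Ux; split=> //; apply: oU.1.
have {}sF : smooth_on (arr G) (arr H) B F.
  have BB : B `<=` src G @^-1` U `&` rng G @^-1` U by move=> g [].
  exact: smooth_on_into_restr (smooth_on_from_restr BB sF).
have {}sF' : smooth_on (arr H) (arr G) B' F'.
  have BB : B' `<=` src H @^-1` U' `&` rng H @^-1` U' by move=> g [].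
  exact: smooth_on_into_restr (smooth_on_from_restr BB sF').
have {}sf : smooth_on (obj G) X V f.
  have BB : V `<=` U by move=> g [].
  exact: smooth_on_into_restr (smooth_on_from_restr BB sf).
have {}sf' : smooth_on X (obj G) V' f'.
  have BB : V' `<=` U' by move=> g [].
  exact: smooth_on_into_restr (smooth_on_from_restr BB sf').
have srcV g : B g -> V (src G g) by move=> [_ [? _]]; apply: UV.
have rngV g : B g -> V (rng G g) by move=> [_ [_ ?]]; apply: UV.
have srcE g : B g -> f' (src H (F g)) = src G g.
  by move=> Bg; rewrite -[src H _]/(src (reduction H U') (F g)) (Fsr g Bg).1 fK //; exact: srcV.
have rngE g : B g -> f' (rng H (F g)) = rng G g.
  by move=> Bg; rewrite -[rng H _]/(rng (reduction H U') (F g)) (Fsr g Bg).2 fK //; exact: rngV.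
have [ax1 ax2 _ ax3 ax4] := Gax.
have oneB x : U x -> B (Defs.one G x).
  move=> Ux; have Ox := oU.1 _ Ux; have [s1 r1] := ax1 x Ox.
  by split; [apply: car_one|split; rewrite /= ?s1 ?r1].
have invB g : B g -> B (Defs.inv G g).
  move=> [Ag [Us Ur]]; have [si ri _ _] := ax4 g Ag.
  by split; [apply: car_inv|split; rewrite /= ?si ?ri].
have subH (Z : set (S * S')) : Z `<=` B' -> Z `<=` car (arr H).
  by move=> ZB a /ZB[].
have restrict (T1 : Type) (M : mfd R T1) (h : S * S' -> T1) :
    smooth (arr H) M h -> smooth_on (arr H) M B' h.
  by apply: smooth_on_subset => a [].
have srcHV a : B' a -> V' (src H a) by move=> [Ha [? ?]]; split=> //; apply: sH.1.
have rngHV a : B' a -> V' (rng H a) by move=> [Ha [? ?]]; split=> //; apply: rH.1.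
have Finv g : B g -> F (Defs.inv G g) = Defs.inv H (F g).
  move=> Bg; have [si ri miv _] := ax4 g Bg.1.
  have := FM (Defs.inv G g) g (And3 (invB g Bg) Bg si).
  rewrite -[X in F X]/(Defs.mul G (Defs.inv G g) g) miv.
  rewrite -[Defs.one G _]/(Defs.one (reduction G U) (src G g)).
  rewrite F1; last exact: srcV.
  have <- : src H (F g) = f (src G g) by exact: (Fsr g Bg).1.
  have [[Xg Kg] _] := FB g Bg.
  have [[Xi Ki] _] := FB _ (invB g Bg).
  move: (F g) (F (Defs.inv G g)) Xg Kg Xi Ki => [x k] [y l] /= Xx Kk Xy Kl [-> E].
  congr (_, _); have [_ K1 KA h _] := hK.
  have [_ _ e1 e2] := h k Kk; have [e3 _ _ _] := h l Kl.
  have [_ _ _ _ [_ sV]] := hK; have KV : car (gcar K) (ginv K k) := sV.1 k Kk.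
  have [_ e4 _ _] := h _ KV.
  by rewrite -e3 -e1 -KA // -E e4.
have stepF (T1 : Type) (M : mfd R T1) (Z : set T1) (u : S * S' -> T1) :
  smooth (arr H) M u -> smooth_on (arr G) M B (u \o F).
  move=> su; exact: smooth_on_comp hH FB sF (restrict _ _ _ su).
split.
- split.
  + apply: (smooth_on_eq srcE).
    apply: (smooth_on_comp hX _ (stepF _ _ setT _ sH) sf').
    by move=> g Bg; apply/srcHV/FB.
  + apply: (smooth_on_eq rngE).
    apply: (smooth_on_comp hX _ (stepF _ _ setT _ rH) sf').
    by move=> g Bg; apply/rngHV/FB.
- have oneE x : U x -> F' (Defs.one H (f x)) = Defs.one G x.
    by move=> Ux; have := F1 x (UV x Ux) => /= <-; rewrite FK //; exact: oneB.
  apply: (smooth_on_eq oneE).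
  apply: (smooth_on_comp hH _ _ sF').
    by move=> x Ux; have := F1 x (UV x Ux) => /= <-; apply/FB/oneB.
  apply: (smooth_on_comp hX _ _ (action_one_smooth act hX hK)).
    by move=> x /UV/fV[].
  by apply: smooth_on_subset sf.
- have invE g : B g -> F' (Defs.inv H (F g)) = Defs.inv G g.
    by move=> Bg; rewrite -Finv // FK //; exact: invB.
  apply: (smooth_on_eq invE).
  apply: (smooth_on_comp hH _ _ sF').
    by move=> g Bg; rewrite -Finv //; apply/FB/invB.
  exact: (stepF _ _ setT _ (action_inv_smooth hX hK hact)).
- have mulB g h : composable G (g, h) -> B g -> B h -> B (Defs.mul G g h).
    move=> gh [_ [_ Ur]] [_ [Us _]]; have [sm rm] := ax2 g h gh.
    by split; [exact: car_mul|split; rewrite /= ?sm ?rm].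
  have mulE z : (composable G `&` B `*` B) z ->
      F' (Defs.mul H (F z.1) (F z.2)) = Defs.mul G z.1 z.2.
    case: z => g h [gh [/= Bg Bh]]; have [_ _ sr] := gh.
    have := FM g h (And3 Bg Bh sr) => /= <-; rewrite FK //; exact: mulB.
  have hGG := manifold_mprod hA hA.
  apply: (smooth_on_eq mulE).
  apply: (smooth_on_comp hH _ _ sF').
    case=> g h [gh [/= Bg Bh]]; have [_ _ sr] := gh.
    by have := FM g h (And3 Bg Bh sr) => /= <-; apply/FB/mulB.
  apply: (smooth_on_comp (f := fun z => (F z.1, F z.2)) (manifold_mprod hH hH)
    _ _ (action_mul_smooth act hX hK)).
    by move=> [g h] [_ [/= /FB[? _] /FB[? _]]]; split.
  apply: smooth_on_pair.
    apply: (smooth_on_comp hA _ _ sF); first by move=> z [_ []].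
    by apply: smooth_on_subset (smooth_fst _ hA) => z [[]].
  apply: (smooth_on_comp hA _ _ sF); first by move=> z [_ []].
  by apply: smooth_on_subset (smooth_snd _ hA) => z [[]].
- move=> g Bg; apply: (tame_at_eq Bg srcE).
  have sHF := stepF _ _ setT _ sH.
  have oV' : mopen X V' by apply: mopenI => //; apply: mopen_car.
  have oV : mopen (obj G) V by apply: mopenI => //; apply: mopen_car.
  apply: (tame_at_comp hA hX oA Bg _ sHF sf').
  + by move=> h Bh; apply/srcHV/FB.
  + apply: (tame_at_comp hA hH oA Bg _ sF sH).
    * by move=> h /FB[].
    * exact: (tame_at_diffeo hA hH oA oB' Bg sF sF').
    * by apply: (action_src_tame hX hK hact); have [] := FB g Bg.
  + exact: (tame_at_diffeo hX hO oV' oV (srcHV _ (FB _ Bg)) sf' sf).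
Qed.

End Piece.

(** Weak gluing says that the open sets [arrows_over (U i)], multiplied by themselves, cover the
    composable pairs; this makes smoothness of the product a local question over the pieces. *)
Theorem Lie_groupoid_of_cover (I : Type) (U : I -> set T') :
  mhausdorff (obj G) -> (forall i, mopen (obj G) (U i)) ->
  (forall i, mopen (arr G) (arrows_over (U i))) ->
  (forall i, locally_action G (U i)) -> weak_gluing G U ->
  Lie_groupoid G.
Proof.
move=> hT oU oA hU hG; have [ax1 ax2 _ ax3 ax4] := Gax.
have cover g : car (arr G) g -> exists i, arrows_over (U i) g.
  move=> Ag; have [Og _] := car_srng Ag; have [s1 r1] := ax1 _ Og.
  (* Pairing an arrow with the unit at its domain turns weak gluing into a cover of the arrows. *)
  have [|i [h _]] := hG g (Defs.one G (src G g)).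
    by split=> /=; [|exact: car_one|rewrite r1].
  by exists i.
have coverO x : car (obj G) x -> exists i, U i x.
  move=> Ox; have [i [_ [/= h _]]] := cover _ (car_one Ox).
  by exists i; rewrite (ax1 x Ox).1 in h.
have P i := locally_action_smooth (oU i) (oA i) (hU i).
have local (T1 : Type) (M : mfd R T1) (u : T -> T1) : manifold M ->
    (forall i, smooth_on (arr G) M (arrows_over (U i)) u) -> smooth (arr G) M u.
  move=> hM su; apply: smooth_on_local => // p Ap.
  have [i Ui] := cover p Ap; exists (arrows_over (U i)); split=> //.
  by apply: smooth_on_subset (su i) => q [].
split=> //.
- split.
    split.
      by apply: local => // i; have [[]] := P i.
    move=> c c' hc hc' p cp c'p W F hF.
    have Ap := cdom_car hA hc cp; have [i Ui] := cover p Ap.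
    have [_ _ _ _ tm] := P i.
    have sub : arrows_over (U i) `<=` car (arr G) by move=> ? [].
    exact: (tame_at_subset sub (tm p Ui) hc hc' cp c'p hF).
  by apply: local => // i; have [[]] := P i.
- split.
    apply: smooth_on_local => // x Ox; have [i Ui] := coverO x Ox.
    exists (U i); split=> //; have [_ + _ _ _] := P i.
    by apply: smooth_on_subset => q [].
  by apply: local => // i; have [] := P i.
- have hGG := manifold_mprod hA hA.
  apply: smooth_on_local => // [[g h] []//|[g h] gh].
  have [i [gi hi]] := hG g h gh.
  exists (arrows_over (U i) `*` arrows_over (U i)); split=> //.
    exact: mopen_mprod.
  by have [_ _ _] := P i.
Qed.

End LieCover.

(** * Euclidean spaces, half-lines and discrete manifolds *)

Section Models.
Context {R : realType}.

Lemma manifold_single_chart (T : Type) (c : chart R T) :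
  chart_of (Mfd (cdom c) [set c]) c -> manifold (Mfd (cdom c) [set c]).
Proof.
move=> hc; have sid : smooth (Mfd (cdom c) [set c]) (Mfd (cdom c) [set c]) idfun.
  split=> // _ _ -> -> p cp _ _; exists setT, idfun; split=> //.
    exact: openT.
  exact: Coo_on_id.
split=> //.
- by move=> _ ->.
- by move=> p cp; exists c.
- apply: (@chart_cover_second_countable R T _ (fun=> c)) => //; first by move=> _ ->.
  by move=> p cp; exists 0%N.
- by exists (cdim c) => _ ->.
Qed.

Definition eucl (n : nat) : mfd R 'rV[R]_n :=
  Mfd setT [set Chart setT idfun (fun=> false)].

Lemma manifold_eucl n : manifold (eucl n).
Proof.
apply: (@manifold_single_chart _ (Chart setT idfun (fun=> false))).
split=> //; exists setT; first exact: openT.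
by apply/seteqP; split=> [y _|y _]; [split|exists y].
Qed.

Lemma mopen_eucl n (W : set 'rV[R]_n) : open W -> mopen (eucl n) W.
Proof. by move=> oW; split=> // c -> p Wp _; exists W. Qed.

Lemma mhausdorff_eucl n : mhausdorff (eucl n).
Proof.
move=> p q _ _ pq; have e0 : 0 < `|p - q| / 2.
  by rewrite divr_gt0 // normr_gt0 subr_eq0; apply/eqP.
exists (ball p (`|p - q| / 2)), (ball q (`|p - q| / 2)).
split; try exact: ballxx; try exact/mopen_eucl/ball_open.
apply/seteqP; split=> // x [px qx].
have := ball_triangle px (ball_sym qx); rewrite -splitr -ball_normE /=.
by rewrite ltxx.
Qed.

Section ToEucl.
Context {T : Type} (M : mfd R T) (S : set T).

Lemma smooth_eucl_comp a b (W : set 'rV[R]_a) (f : T -> 'rV[R]_a)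
    (g : 'rV[R]_a -> 'rV[R]_b) : open W -> Coo_on W g ->
  (forall x, S x -> W (f x)) -> smooth_on M (eucl a) S f ->
  smooth_on M (eucl b) S (g \o f).
Proof.
move=> oW sg fW sf; apply: smooth_on_comp (manifold_eucl a) fW sf _.
by split=> // c c' -> -> p Wp _ _; exists W, g; split.
Qed.

Lemma smooth_row_mx a b (f : T -> 'rV[R]_a) (g : T -> 'rV[R]_b) :
  smooth_on M (eucl a) S f -> smooth_on M (eucl b) S g ->
  smooth_on M (eucl (a + b)) S (fun x => row_mx (f x) (g x)).
Proof.
move=> [_ sf] [_ sg]; split=> // c c' hc -> p Sp cp _.
have [//|W [F [oW Wp sF hF]]] := sf c _ hc erefl p Sp cp.
have [//|W' [G [oW' W'p sG hG]]] := sg c _ hc erefl p Sp cp.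
exists (W `&` W'), (fun x => row_mx (F x) (G x)); split=> //=.
- exact: openI.
- apply: Coo_on_row_mx; first exact: openI.
    by apply: Coo_on_subset sF => x [].
  by apply: Coo_on_subset sG => x [].
- move=> q Sq cq [Wq W'q]; have [_ /= ->] := hF q Sq cq Wq.
  by have [_ /= ->] := hG q Sq cq W'q.
Qed.

Lemma smooth_addr a (f g : T -> 'rV[R]_a) :
  smooth_on M (eucl a) S f -> smooth_on M (eucl a) S g ->
  smooth_on M (eucl a) S (fun x => f x + g x).
Proof.
move=> sf sg; pose P (v : 'rV[R]_(a + a)) := lsubmx v + rsubmx v.
apply: (@smooth_on_eq _ _ _ _ _ _ (P \o (fun x => row_mx (f x) (g x)))).
  by move=> x _; rewrite /P /= row_mxKl row_mxKr.
apply: (smooth_eucl_comp openT) => //; last exact: smooth_row_mx.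
exact: (Coo_onD openT (@Coo_on_lsubmx _ _ _ _) (@Coo_on_rsubmx _ _ _ _)).
Qed.

Lemma smooth_scaler a (t : T -> R) (f : T -> 'rV[R]_a) :
  smooth_on M (eucl 1) S (fun x => const_mx (t x)) -> smooth_on M (eucl a) S f ->
  smooth_on M (eucl a) S (fun x => t x *: f x).
Proof.
move=> st sf; pose P (v : 'rV[R]_(1 + a)) := lsubmx v 0 0 *: rsubmx v.
apply: (@smooth_on_eq _ _ _ _ _ _ (P \o (fun x => row_mx (const_mx (t x)) (f x)))).
  by move=> x _; rewrite /P /= row_mxKl row_mxKr mxE.
apply: (smooth_eucl_comp openT) => //; last exact: smooth_row_mx.
exact: (Coo_on_scale 0 openT (@Coo_on_lsubmx _ _ _ _) (@Coo_on_rsubmx _ _ _ _)).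
Qed.

Lemma smooth_oppr a (f : T -> 'rV[R]_a) :
  smooth_on M (eucl a) S f -> smooth_on M (eucl a) S (fun x => - f x).
Proof.
move=> sf; apply: (smooth_eucl_comp (W := setT) openT _ _ sf) => //.
exact: (@Coo_on_linear _ _ _ _ -%R).
Qed.

Lemma smooth_mulr (t u : T -> R) :
  smooth_on M (eucl 1) S (fun x => const_mx (t x)) ->
  smooth_on M (eucl 1) S (fun x => const_mx (u x)) ->
  smooth_on M (eucl 1) S (fun x => const_mx (t x * u x)).
Proof.
move=> st su; apply: smooth_on_eq (smooth_scaler st su) => x _.
by apply/rowP => i; rewrite !mxE.
Qed.

Lemma smooth_invr (t : T -> R) : (forall x, S x -> t x != 0) ->
  smooth_on M (eucl 1) S (fun x => const_mx (t x)) ->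
  smooth_on M (eucl 1) S (fun x => const_mx (t x)^-1).
Proof.
move=> t0 st; apply: (@smooth_on_eq _ _ _ _ _ _
    (lift1 GRing.inv \o (fun x => const_mx (t x)))).
  by move=> x _; apply/rowP => i; rewrite !mxE.
apply: smooth_eucl_comp (@Coo_on_inv R) _ st; last by move=> x /t0; rewrite /= mxE.
apply: (@open_comp _ _ (fun x : 'rV[R]_1 => x 0 0) [set y | y != 0]).
  by move=> x _; apply: coord_continuous.
exact: open_neq.
Qed.

Lemma smooth_sqrtr (t : T -> R) : (forall x, S x -> 0 < t x) ->
  smooth_on M (eucl 1) S (fun x => const_mx (t x)) ->
  smooth_on M (eucl 1) S (fun x => const_mx (Num.sqrt (t x))).
Proof.
move=> t0 st; apply: (@smooth_on_eq _ _ _ _ _ _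
    (lift1 Num.sqrt \o (fun x => const_mx (t x)))).
  by move=> x _; apply/rowP => i; rewrite !mxE.
apply: smooth_eucl_comp (@Coo_on_sqrt R) _ st; last by move=> x /t0; rewrite /= mxE.
apply: (@open_comp _ _ (fun x : 'rV[R]_1 => x 0 0) [set y | 0 < y]).
  by move=> x _; apply: coord_continuous.
exact: open_gt.
Qed.

Lemma smooth_sqnorm a (f : T -> 'rV[R]_a) : smooth_on M (eucl a) S f ->
  smooth_on M (eucl 1) S (fun x => const_mx (\sum_i f x 0 i ^+ 2)).
Proof.
move=> sf; pose P (v : 'rV[R]_a) : 'rV[R]_1 :=
  \sum_i v 0 i *: (v 0 i *: const_mx 1).
apply: (@smooth_on_eq _ _ _ _ _ _ (P \o f)).
  move=> x _; apply/rowP => i; rewrite mxE summxE.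
  by apply: eq_bigr => j _; rewrite !mxE mulr1 expr2.
apply: (smooth_eucl_comp (W := setT) openT _ _ sf) => // k.
apply: (@Ck_on_sum _ _ _ _ _ _ (fun i v => v 0 i *: (v 0 i *: const_mx 1)) openT) => i.
by do 2 (apply: Ck_on_scale; [exact: openT|exact: Coo_on_id|]); exact: Ck_on_cst.
Qed.

Lemma smooth_to_half_line (t : T -> R) : (forall x, S x -> 0 <= t x) ->
  smooth_on M (eucl 1) S (fun x => const_mx (t x)) ->
  smooth_on M half_line S t.
Proof.
move=> t0 [_ st]; split=> // c c' hc -> p Sp cp _.
have [//|W [F [oW Wp sF hF]]] := st c _ hc erefl p Sp cp.
exists W, F; split=> // q Sq cq Wq; have [_ Fq] := hF q Sq cq Wq.
by split=> //=; apply: t0.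
Qed.

Lemma smooth_to_pos_line (t : T -> R) : (forall x, S x -> 0 < t x) ->
  smooth_on M (eucl 1) S (fun x => const_mx (t x)) ->
  smooth_on M pos_line S t.
Proof.
move=> t0 [_ st]; split=> // c c' hc -> p Sp cp _.
have [//|W [F [oW Wp sF hF]]] := st c _ hc erefl p Sp cp.
exists W, F; split=> // q Sq cq Wq; have [_ Fq] := hF q Sq cq Wq.
by split=> //=; apply: t0.
Qed.

End ToEucl.

Lemma smooth_half_line : smooth half_line (eucl 1) (fun t => const_mx t).
Proof.
split=> // c c' -> -> p p0 _ _; exists setT, idfun; split=> //; first exact: openT.
exact: Coo_on_id.
Qed.

Lemma smooth_pos_line : smooth pos_line (eucl 1) (fun t => const_mx t).
Proof.
split=> // c c' -> -> p p0 _ _; exists setT, idfun; split=> //; first exact: openT.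
exact: Coo_on_id.
Qed.

Lemma const_rV1 (x : 'rV[R]_1) : const_mx (x 0 0) = x.
Proof. by apply/rowP => i; rewrite mxE ord1. Qed.

Lemma const_rV1_inj (x y : R) : const_mx x = const_mx y :> 'rV[R]_1 -> x = y.
Proof. by move/rowP/(_ 0); rewrite !mxE. Qed.

Lemma manifold_half_line : manifold (@half_line R).
Proof.
apply: (@manifold_single_chart _ (@Chart R R 1 [set x | 0 <= x]
  (fun x => const_mx x) (fun=> true))).
split=> //=; first by move=> x y _ _; apply: const_rV1_inj.
exists setT; first exact: openT.
apply/seteqP; split=> [_ [x x0 <-]|y [_ y0]].
  by split=> // i _; rewrite mxE.
by exists (y 0 0); [exact: y0|exact: const_rV1].
Qed.

Lemma manifold_pos_line : manifold (@pos_line R).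
Proof.
apply: (@manifold_single_chart _ (@Chart R R 1 [set x | 0 < x]
  (fun x => const_mx x) (fun=> false))).
split=> //=; first by move=> x y _ _; apply: const_rV1_inj.
exists [set y | 0 < y 0 0].
  apply: (@open_comp _ _ (fun x : 'rV[R]_1 => x 0 0) [set y | 0 < y]).
    by move=> x _; apply: coord_continuous.
  exact: open_gt.
apply/seteqP; split=> [_ [x x0 <-]|y [y0 _]].
  by split=> //=; rewrite mxE.
by exists (y 0 0); [exact: y0|exact: const_rV1].
Qed.

Lemma mhausdorff_half_line : mhausdorff (@half_line R).
Proof.
apply: (mhausdorff_inj manifold_half_line (manifold_eucl 1) (@mhausdorff_eucl 1)
  smooth_half_line) => p q _ _; exact: const_rV1_inj.
Qed.

Lemma mhausdorff_pos_line : mhausdorff (@pos_line R).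
Proof.
apply: (mhausdorff_inj manifold_pos_line (manifold_eucl 1) (@mhausdorff_eucl 1)
  smooth_pos_line) => p q _ _; exact: const_rV1_inj.
Qed.

Definition discrete_mfd (T : countType) : mfd R T :=
  Mfd setT [set c | exists z, c = @Chart R T 0 [set z] (fun=> 0) (fun=> false)].

Lemma manifold_discrete (T : countType) : manifold (discrete_mfd T).
Proof.
have sid : smooth (discrete_mfd T) (discrete_mfd T) idfun.
  split=> // _ _ [z ->] [z' ->] p _ /= pz pz'.
  exists setT, idfun; split=> //; [exact: openT|exact: Coo_on_id|].
  by move=> q _ /= qz _; split=> //; rewrite qz -pz.
split=> //.
- move=> _ [z ->]; split=> //=.
    by move=> x y /set_mem -> /set_mem ->.
  exists setT; first exact: openT.
  apply/seteqP; split=> [y _|y _]; first by split.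
  by exists z => //; rewrite thinmx0.
- by move=> p _; eexists; [exists p; reflexivity|].
(* Enumerating the charts needs a default point for the integers that code nothing, so the empty
   type is treated apart. *)
- have [[z0]|h] := pselect (inhabited T); last first.
    exists (fun=> set0); split; first by move=> _; split.
    by move=> A p _ _; case: h.
  pose C n : chart R T := @Chart R T 0 [set odflt z0 (unpickle n)] (fun=> 0) (fun=> false).
  apply: (@chart_cover_second_countable R T _ C) => //.
  move=> p _; exists (pickle p); last by rewrite /= pickleK.
  by eexists; rewrite /C; reflexivity.
- by exists 0%N => _ [z ->].
Qed.

Lemma mopen_discrete (T : countType) (A : set T) : mopen (discrete_mfd T) A.
Proof.
split=> // _ [z ->] p Ap /= pz; exists setT; split=> //; first exact: openT.
by move=> q -> _; rewrite -pz.
Qed.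

Lemma mhausdorff_discrete (T : countType) : mhausdorff (discrete_mfd T).
Proof.
move=> p q _ _ pq; exists [set p], [set q]; split=> //; try exact: mopen_discrete.
by apply/seteqP; split=> // x [-> /= qp]; case: pq.
Qed.

Lemma smooth_on_locally_cst (T T' : Type) (M : mfd R T) (N : mfd R T')
    (S : set T) (f : T -> T') :
  manifold M -> manifold N -> S `<=` car M -> (forall p, S p -> car N (f p)) ->
  (forall p, S p -> exists A, [/\ mopen M A, A p &
     forall q, A q -> S q -> f q = f p]) -> smooth_on M N S f.
Proof.
move=> hM hN SM fN h; apply: smooth_on_local => // p Sp.
have [A [oA Ap fA]] := h p Sp; exists A; split=> //.
apply: (@smooth_on_eq _ _ _ _ _ _ (fun=> f p)); first by move=> q [Sq Aq]; rewrite fA.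
by apply: smooth_cst => //; [move=> q [/SM]|apply: fN].
Qed.

End Models.

(** * Lie groups and their actions *)

Section LieGroups.
Context {R : realType}.

Definition positive_group : grp R R := Grp pos_line 1 GRing.inv *%R.

Lemma Lie_group_positive : Lie_group positive_group.
Proof.
have hP := @manifold_pos_line R; have sP := @smooth_pos_line R.
split=> //=.
- split=> //; first exact: mhausdorff_pos_line.
  by move=> _ -> p _ i.
- by move=> g h k _ _ _; rewrite mulrA.
- move=> g g0; have gn0 : g != 0 by rewrite gt_eqF.
  by split; rewrite ?mul1r ?mulr1 ?mulVf ?mulfV.
- have s1 := smooth_fst (@pos_line R) hP; have s2 := smooth_snd (@pos_line R) hP.
  split.
    apply: smooth_to_pos_line; first by move=> x [/= ? ?]; rewrite mulr_gt0.
    apply: smooth_mulr.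
      exact: (smooth_on_comp hP s1.1 s1 sP).
    exact: (smooth_on_comp hP s2.1 s2 sP).
  apply: smooth_to_pos_line; first by move=> x; rewrite /= invr_gt0.
  by apply: smooth_invr => // x /= x0; rewrite gt_eqF.
Qed.

Lemma dilation_action : smooth_right_action half_line positive_group *%R.
Proof.
have hP := @manifold_pos_line R; have hH := @manifold_half_line R.
split=> [|x _|x g h _ _ _] /=; rewrite ?mulr1 ?mulrA //.
have s1 := smooth_fst (@pos_line R) hH; have s2 := smooth_snd (@half_line R) hP.
apply: smooth_to_half_line.
  by move=> x [/= x0 g0]; rewrite mulr_ge0 // ltW.
apply: smooth_mulr.
  exact: (smooth_on_comp hH s1.1 s1 (@smooth_half_line R)).
exact: (smooth_on_comp hP s2.1 s2 (@smooth_pos_line R)).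
Qed.

Definition additive_group (V : zmodType) (M : mfd R V) : grp R V :=
  Grp M 0 -%R +%R.

Lemma Lie_group_additive (V : zmodType) (M : mfd R V) :
  manifold M -> mhausdorff M -> boundaryless M -> (forall x, car M x) ->
  smooth (mprod M M) M (fun z => z.1 + z.2) -> smooth M M -%R ->
  Lie_group (additive_group M).
Proof.
move=> hM HM bM cM sD sN; split=> //=.
- by move=> g h k _ _ _; rewrite addrA.
- by move=> g _; rewrite add0r addr0 addNr addrN.
Qed.

Lemma additive_action (V : zmodType) (M : mfd R V) :
  smooth (mprod M M) M (fun z => z.1 + z.2) ->
  smooth_right_action M (additive_group M) +%R.
Proof. by move=> sD; split=> [|x _|x g h _ _ _] /=; rewrite ?addr0 ?addrA. Qed.

(* The discrete factor makes disjoint unions of open subsets of ['rV_k] into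
   open subsets of a single group, even for [k = 0]. *)
Definition sheets (k : nat) : mfd R ('rV[R]_k * int) :=
  mprod (eucl k) (discrete_mfd int).

Lemma manifold_sheets k : manifold (sheets k).
Proof. exact: manifold_mprod (manifold_eucl k) (manifold_discrete _). Qed.

Lemma mhausdorff_sheets k : mhausdorff (sheets k).
Proof.
apply: mhausdorff_mprod; [exact: manifold_eucl|exact: manifold_discrete|
  exact: mhausdorff_eucl|exact: mhausdorff_discrete].
Qed.

Lemma boundaryless_mprod (T T' : Type) (M : mfd R T) (N : mfd R T') :
  boundaryless M -> boundaryless N -> boundaryless (mprod M N).
Proof.
move=> bM bN _ [c1 [c2 [hc1 hc2 ->]]] p [c1p c2p] i.
rewrite /=; case: (split_ordP i) => j ->; rewrite ?row_mxEl ?row_mxEr.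
  exact: bM.
exact: bN.
Qed.

Lemma smooth_sheets_add k :
  smooth (mprod (sheets k) (sheets k)) (sheets k) (fun z => z.1 + z.2).
Proof.
have hE := @manifold_eucl R k; have hD := @manifold_discrete R int.
have hS := manifold_sheets k; have hSS := manifold_mprod hS hS.
have s1 := smooth_fst (sheets k) hS; have s2 := smooth_snd (sheets k) hS.
have f := smooth_fst (discrete_mfd int) hE; have s := smooth_snd (eucl k) hD.
have s1s := smooth_on_comp hS s1.1 s1 s; have s2s := smooth_on_comp hS s2.1 s2 s.
apply: smooth_on_pair.
  apply: smooth_addr.
    exact: (smooth_on_comp hS s1.1 s1 f).
  exact: (smooth_on_comp hS s2.1 s2 f).
apply: smooth_on_locally_cst => // p _.
(* Both integer components are constant near [p], and so is their sum. *)
exists ((car (mprod (sheets k) (sheets k)) `&` (snd \o fst) @^-1` [set p.1.2]) `&`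
        (car (mprod (sheets k) (sheets k)) `&` (snd \o snd) @^-1` [set p.2.2])).
split=> //.
  apply: mopenI; apply: mopen_preimage hD (mopen_car hSS) _ _ => //;
    exact: mopen_discrete.
by move=> q [[_ /= e1] [_ /= e2]] _; rewrite /= e1 e2.
Qed.

Lemma smooth_sheets_opp k : smooth (sheets k) (sheets k) -%R.
Proof.
have hE := @manifold_eucl R k; have hD := @manifold_discrete R int.
have hS := manifold_sheets k.
have f := smooth_fst (discrete_mfd int) hE; have s := smooth_snd (eucl k) hD.
apply: (@smooth_on_pair _ _ _ _ (sheets k) (eucl k) _ _
  (fun z => - z.1) (fun z => - z.2)); first exact: smooth_oppr.
apply: smooth_on_locally_cst => // p _.
exists (car (sheets k) `&` snd @^-1` [set p.2]); split=> //.
  by apply: mopen_preimage hD (mopen_car hS) s _; exact: mopen_discrete.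
by move=> q [_ /= ->].
Qed.

Lemma boundaryless_eucl n : boundaryless (eucl n : mfd R _).
Proof. by move=> _ -> p _ i. Qed.

Lemma Lie_group_sheets k : Lie_group (additive_group (sheets k)).
Proof.
apply: Lie_group_additive; [exact: manifold_sheets|exact: mhausdorff_sheets| |by []
  |exact: smooth_sheets_add|exact: smooth_sheets_opp].
apply: boundaryless_mprod; first exact: boundaryless_eucl.
by move=> _ [z ->] p _ [].
Qed.

Lemma smooth_eucl_add n : smooth (mprod (eucl n) (eucl n)) (eucl n)
  (fun z : 'rV[R]_n * 'rV[R]_n => z.1 + z.2).
Proof.
have hE := @manifold_eucl R n.
by apply: smooth_addr; [exact: smooth_fst|exact: smooth_snd].
Qed.

Lemma Lie_group_eucl n : Lie_group (additive_group (eucl n)).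
Proof.
apply: Lie_group_additive; [exact: manifold_eucl|exact: mhausdorff_eucl|
  exact: boundaryless_eucl|by []|exact: smooth_eucl_add|].
by apply: smooth_oppr; apply: manifold_id; exact: manifold_eucl.
Qed.

Definition prod_group (T T' : Type) (G : grp R T) (H : grp R T') :
    grp R (T * T') :=
  Grp (mprod (gcar G) (gcar H)) (gone G, gone H)
      (fun g => (ginv G g.1, ginv H g.2))
      (fun g h => (gmul G g.1 h.1, gmul H g.2 h.2)).

Lemma Lie_group_prod (T T' : Type) (G : grp R T) (H : grp R T') :
  Lie_group G -> Lie_group H -> Lie_group (prod_group G H).
Proof.
move=> LG LH; have [[mG hG bG] oneG aG uG [sG iG]] := LG.
have [[mH hH bH] oneH aH uH [sH iH]] := LH.
have mGH := manifold_mprod mG mH.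
have s1 := smooth_fst (mprod (gcar G) (gcar H)) mGH.
have s2 := smooth_snd (mprod (gcar G) (gcar H)) mGH.
have f := smooth_fst (gcar H) mG; have s := smooth_snd (gcar G) mH.
split=> //.
- split=> //; first exact: mhausdorff_mprod.
  exact: boundaryless_mprod.
- by move=> g h k [/= ? ?] [/= ? ?] [/= ? ?]; rewrite /= aG ?aH.
- move=> [g g'] [/= Gg Hg']; have [-> -> -> ->] := uG g Gg.
  by have [-> -> -> ->] := uH g' Hg'.
- split; apply: smooth_on_pair.
  + apply: (smooth_gmul LG).
      exact: (smooth_on_comp mGH s1.1 s1 f).
    exact: (smooth_on_comp mGH s2.1 s2 f).
  + apply: (smooth_gmul LH).
      exact: (smooth_on_comp mGH s1.1 s1 s).
    exact: (smooth_on_comp mGH s2.1 s2 s).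
  + exact: smooth_ginv.
  + exact: smooth_ginv.
Qed.

Lemma prod_action (S S' T T' : Type) (X : mfd R S) (Y : mfd R S')
    (G : grp R T) (H : grp R T') actX actY :
  manifold X -> manifold Y -> Lie_group G -> Lie_group H ->
  smooth_right_action X G actX -> smooth_right_action Y H actY ->
  smooth_right_action (mprod X Y) (prod_group G H)
    (fun x g => (actX x.1 g.1, actY x.2 g.2)).
Proof.
move=> mX mY LG LH hX hY; have [_ X1 XM] := hX; have [_ Y1 YM] := hY.
have [[mG _ _] _ _ _ _] := LG; have [[mH _ _] _ _ _ _] := LH.
have mXY := manifold_mprod mX mY; have mGH := manifold_mprod mG mH.
split.
- have s1 := smooth_fst (mprod (gcar G) (gcar H)) mXY.
  have s2 := smooth_snd (mprod X Y) mGH.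
  apply: smooth_on_pair.
    apply: (smooth_act mX LG hX).
      exact: (smooth_on_comp mXY s1.1 s1 (smooth_fst _ mX)).
    exact: (smooth_on_comp mGH s2.1 s2 (smooth_fst _ mG)).
  apply: (smooth_act mY LH hY).
    exact: (smooth_on_comp mXY s1.1 s1 (smooth_snd _ mY)).
  exact: (smooth_on_comp mGH s2.1 s2 (smooth_snd _ mH)).
- by move=> [x y] [/= Xx Yy]; rewrite X1 ?Y1.
- by move=> [x y] [g g'] [h h'] [/= ? ?] [/= ? ?] [/= ? ?]; rewrite /= XM ?YM.
Qed.

End LieGroups.

Section Isomorphisms.
Context {R : realType}.

Lemma Lie_groupoid_iso_trans (T1 O1 T2 O2 T3 O3 : Type) (G1 : gpd R T1 O1)
    (G2 : gpd R T2 O2) (G3 : gpd R T3 O3) :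
  manifold (arr G2) -> manifold (obj G2) ->
  (forall x, car (obj G1) x -> car (arr G1) (Defs.one G1 x)) ->
  Lie_groupoid_iso G1 G2 -> Lie_groupoid_iso G2 G3 -> Lie_groupoid_iso G1 G3.
Proof.
move=> mA mO oneG [F [F' [f [f' [[sF sF' FK F'K] [sf sf' fK f'K] Fsr F1 FM]]]]].
move=> [H [H' [h [h' [[sH sH' HK H'K] [sh sh' hK h'K] Hsr H1 HM]]]]].
exists (H \o F), (F' \o H'), (h \o f), (f' \o h'); split.
- split=> [||g Gg|g Gg] /=.
  + exact: (smooth_on_comp mA sF.1 sF sH).
  + exact: (smooth_on_comp mA sH'.1 sH' sF').
  + by rewrite HK ?FK //; apply: sF.1.
  + by rewrite F'K ?H'K //; apply: sH'.1.
- split=> [||g Gg|g Gg] /=.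
  + exact: (smooth_on_comp mO sf.1 sf sh).
  + exact: (smooth_on_comp mO sh'.1 sh' sf').
  + by rewrite hK ?fK //; apply: sf.1.
  + by rewrite f'K ?h'K //; apply: sh'.1.
- move=> g Gg; have [s r] := Fsr g Gg; have [s' r'] := Hsr _ (sF.1 g Gg).
  by rewrite /= s' s r' r.
- by move=> x Gx; rewrite /= F1 // H1 //; apply: sf.1.
- move=> a b [/= Ga Gb ab]; rewrite /= FM // HM //; split; [exact: sF.1|exact: sF.1|].
  by rewrite /= (Fsr a Ga).1 (Fsr b Gb).2 ab.
Qed.

End Isomorphisms.

(** * Pair groupoids as reductions of translation groupoids *)

Section SheetCharts.
Context {R : realType}.

(** A reduction restricts to a preimage, which need not lie in the carrier, while [mopen] asks for
    inclusion in the carrier; this reconciles the two. *)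
Lemma restr_carI (T : Type) (M : mfd R T) (A : set T) : manifold M ->
  restr M (car M `&` A) = restr M A.
Proof.
move=> hM; rewrite /restr setIA setIid; congr Mfd.
have E c : atl M c -> cdom c `&` (car M `&` A) = cdom c `&` A.
  move=> hc; rewrite setIA; congr (_ `&` _); apply: setIidl.
  exact: cdom_car.
by apply/seteqP; split=> _ [c hc ->]; exists c => //; rewrite E.
Qed.

Lemma manifold_restr_carI (T : Type) (M : mfd R T) (A : set T) : manifold M ->
  mopen M (car M `&` A) -> manifold (restr M A).
Proof. by move=> hM oA; rewrite -restr_carI //; apply: manifold_restr. Qed.

Lemma mopen_local (T : Type) (M : mfd R T) (A : set T) :
  (forall p, A p -> exists B, [/\ mopen M B, B p & B `<=` A]) -> mopen M A.
Proof.
move=> h; split=> [p /h[B [[BM _] Bp _]]|c hc p Ap cp]; first exact: BM.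
have [B [[_ oB] Bp BA]] := h p Ap; have [V [oV Vp VB]] := oB c hc p Bp cp.
by exists V; split=> // q cq /(VB _ cq)/BA.
Qed.

Lemma smooth_fst_comp (Q T T' : Type) (L : mfd R Q) (M : mfd R T) (N : mfd R T')
    (Z : set Q) f : manifold M -> manifold N ->
  smooth_on L (mprod M N) Z f -> smooth_on L M Z (fun z => (f z).1).
Proof.
move=> hM hN sf; have hMN := manifold_mprod hM hN.
exact: (smooth_on_comp hMN sf.1 sf (smooth_fst N hM)).
Qed.

Lemma smooth_snd_comp (Q T T' : Type) (L : mfd R Q) (M : mfd R T) (N : mfd R T')
    (Z : set Q) f : manifold M -> manifold N ->
  smooth_on L (mprod M N) Z f -> smooth_on L N Z (fun z => (f z).2).
Proof.
move=> hM hN sf; have hMN := manifold_mprod hM hN.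
exact: (smooth_on_comp hMN sf.1 sf (smooth_snd M hN)).
Qed.

Lemma smooth_restr_restr (T T' : Type) (M : mfd R T) (N : mfd R T')
    (A : set T) (B : set T') f :
  (forall x, car M x -> A x -> B (f x)) -> smooth_on M N (car M `&` A) f ->
  smooth (restr M A) (restr N B) f.
Proof.
move=> fB sf; apply: smooth_on_restr; apply: smooth_on_to_restr => //.
by move=> x [/= Mx Ax]; apply: fB.
Qed.

Lemma smooth_sheets_sub (T : Type) (M : mfd R T) (Z : set T) k f g :
  smooth_on M (sheets k) Z f -> smooth_on M (sheets k) Z g ->
  smooth_on M (sheets k) Z (fun z => f z - g z).
Proof.
move=> sf sg; have hS := @manifold_sheets R k.
apply: (@smooth_on_comp _ _ _ _ M (mprod (sheets k) (sheets k)) (sheets k) Z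
  (car (mprod (sheets k) (sheets k)))
  (fun z => (f z, - g z)) (fun z => z.1 + z.2)).
- exact: manifold_mprod.
- by [].
- apply: smooth_on_pair => //.
  exact: (smooth_on_comp hS sg.1 sg (smooth_sheets_opp k)).
- exact: smooth_sheets_add.
Qed.

Section Chart.
Context {S0 S0' S1 : Type} (X0 : mfd R S0) (K0 : grp R S0')
  (act0 : S0 -> S0' -> S0) (L : mfd R S1) (k : nat).
Variables (A0 : set S0) (W : set S1) (theta : S1 -> 'rV[R]_k * int)
  (theta' : 'rV[R]_k * int -> S1).
Hypotheses (hX0 : manifold X0) (hK0 : Lie_group K0)
  (hact0 : smooth_right_action X0 K0 act0) (hL : manifold L)
  (oA0 : mopen X0 A0) (oW : mopen L W)
  (stheta : smooth_on L (sheets k) W theta)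
  (stheta' : smooth_on (sheets k) L (theta @` W) theta')
  (thetaK : forall x, W x -> theta' (theta x) = x).

Let P := prod_groupoid (action_groupoid X0 K0 act0) (pair_groupoid L).
Let X := mprod X0 (sheets k).
Let K := prod_group K0 (additive_group (sheets k)).
Let act x g := (act0 x.1 g.1, x.2 + g.2) : S0 * ('rV[R]_k * int).
Let H := action_groupoid X K act.

Let mK0 : manifold (gcar K0). Proof. by case: hK0 => -[]. Qed.
Let mS : manifold (sheets k) := @manifold_sheets R k.
Let mA0 : manifold (arr (action_groupoid X0 K0 act0)) := manifold_mprod hX0 mK0.
Let mLL : manifold (mprod L L) := manifold_mprod hL hL.
Let mP : manifold (arr P) := manifold_mprod mA0 mLL.
Let mOP : manifold (obj P) := manifold_mprod hX0 hL.
Let mX : manifold X := manifold_mprod hX0 mS.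
Let mK : manifold (gcar K) := manifold_mprod mK0 mS.
Let mH : manifold (arr H) := manifold_mprod mX mK.

Lemma pair_src_smooth : smooth (arr P) (obj P) (src P).
Proof.
have sid := manifold_id mP; have sl := smooth_fst_comp mA0 mLL sid.
apply: smooth_on_pair.
  exact: (smooth_on_comp mA0 sl.1 sl (action_src_smooth hX0 hK0 hact0)).
exact: (smooth_snd_comp hL hL (smooth_snd_comp mA0 mLL sid)).
Qed.

Lemma pair_rng_smooth : smooth (arr P) (obj P) (rng P).
Proof.
have sid := manifold_id mP; have sl := smooth_fst_comp mA0 mLL sid.
apply: smooth_on_pair; first exact: (smooth_fst_comp hX0 mK0 sl).
exact: (smooth_fst_comp hL hL (smooth_snd_comp mA0 mLL sid)).
Qed.

Lemma arrows_over_mopen (A : set (S0 * S1)) : mopen (obj P) A ->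
  mopen (arr P) (arrows_over P A).
Proof.
move=> oA; have oP := mopen_car mP.
have := mopenI (mopen_preimage mOP oP pair_src_smooth oA)
  (mopen_preimage mOP oP pair_rng_smooth oA).
congr (mopen _ _); apply/seteqP; split=> a; first by move=> [[? ?] [_ ?]].
by move=> [? []].
Qed.

Lemma theta'K y : (theta @` W) y -> theta (theta' y) = y.
Proof. by move=> [x Wx <-]; rewrite thetaK. Qed.

Lemma theta'W y : (theta @` W) y -> W (theta' y).
Proof. by move=> [x Wx <-]; rewrite thetaK. Qed.

Lemma sheets_chart_iso :
  Lie_groupoid_iso (reduction P (A0 `*` W)) (reduction H (A0 `*` (theta @` W))).
Proof.
(* The domain of an action arrow is its range moved by the inverse of the group element; the element
   leading from the range [theta a.2.1] to the domain [theta a.2.2] is therefore their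
   difference. *)
exists (fun a => ((a.1.1, theta a.2.1), (a.1.2, theta a.2.1 - theta a.2.2))).
exists (fun b => ((b.1.1, b.2.1), (theta' b.1.2, theta' (b.1.2 - b.2.2)))).
exists (fun x => (x.1, theta x.2)), (fun y => (y.1, theta' y.2)).
split.
- split.
  + apply: smooth_restr_restr.
      move=> [[t s] [x y]] /= _ [[/= ? Wy] [/= ? Wx]].
      split; split=> //=; last by exists x.
      by rewrite subKr; exists y.
    set Z := car (arr P) `&` _.
    have sid : smooth_on (arr P) (arr P) Z idfun.
      by apply: smooth_on_subset (manifold_id mP) => a [].
    have sl := smooth_fst_comp mA0 mLL sid; have sr := smooth_snd_comp mA0 mLL sid.
    have sx : smooth_on (arr P) (sheets k) Z (fun a => theta a.2.1).
      apply: (smooth_on_comp hL _ (smooth_fst_comp hL hL sr) stheta).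
      by move=> a [_ [_ []]].
    have sy : smooth_on (arr P) (sheets k) Z (fun a => theta a.2.2).
      apply: (smooth_on_comp hL _ (smooth_snd_comp hL hL sr) stheta).
      by move=> a [_ [[]]].
    apply: smooth_on_pair; apply: smooth_on_pair => //.
    * exact: (smooth_fst_comp hX0 mK0 sl).
    * exact: (smooth_snd_comp hX0 mK0 sl).
    * exact: smooth_sheets_sub.
  + apply: smooth_restr_restr.
      move=> [[t a] [s b]] /= _ [[/= ? Wb] [/= ? Wa]].
      by split; split=> //=; apply: theta'W.
    set Z := car (arr H) `&` _.
    have sid : smooth_on (arr H) (arr H) Z idfun.
      by apply: smooth_on_subset (manifold_id mH) => a [].
    have sl := smooth_fst_comp mX mK sid; have sr := smooth_snd_comp mX mK sid.
    have s1 := smooth_snd_comp hX0 mS sl; have s2 := smooth_snd_comp mK0 mS sr.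
    apply: smooth_on_pair; apply: smooth_on_pair.
    * exact: (smooth_fst_comp hX0 mS sl).
    * exact: (smooth_fst_comp mK0 mS sr).
    * by apply: (smooth_on_comp mS _ s1 stheta') => a [_ [_ []]].
    * apply: (smooth_on_comp mS _ (smooth_sheets_sub s1 s2) stheta').
      by move=> a [_ [[]]].
  + by move=> [[t s] [x y]] /= [_ [[_ /= Wy] [_ /= Wx]]]; rewrite subKr !thetaK.
  + move=> [[t a] [s b]] /= [_ [[_ /= Wb] [_ /= Wa]]].
    by rewrite !theta'K // subKr.
- have sid : smooth_on (obj P) (obj P) (car (obj P) `&` A0 `*` W) idfun.
    by apply: smooth_on_subset (manifold_id mOP) => a [].
  have sid' : smooth_on X X (car X `&` A0 `*` (theta @` W)) idfun.
    by apply: smooth_on_subset (manifold_id mX) => a [].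
  split.
  + apply: smooth_restr_restr; first by move=> [t x] _ [/= ? ?]; split=> //; exists x.
    apply: smooth_on_pair; first exact: (smooth_fst_comp hX0 hL sid).
    by apply: (smooth_on_comp hL _ (smooth_snd_comp hX0 hL sid) stheta) => a [_ []].
  + apply: smooth_restr_restr; first by move=> [t x] _ [/= ? ?]; split=> //; apply: theta'W.
    apply: smooth_on_pair; first exact: (smooth_fst_comp hX0 mS sid').
    by apply: (smooth_on_comp mS _ (smooth_snd_comp hX0 mS sid') stheta') => a [_ []].
  + by move=> [t x] /= [_ [_ /= Wx]]; rewrite thetaK.
  + by move=> [t a] /= [_ [_ /= Wa]]; rewrite theta'K.
- by move=> [[t s] [x y]] _; rewrite /= /act /= subKr.
- by move=> [t x] _; rewrite /= subrr.
- by move=> [[t s] [x y]] [[t' s'] [x' y']] [_ _ [/= _ <-]]; rewrite /= [X in _ = (_, (_, X))]addrC subrKA.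
Qed.

(** The factor [X0] is left free: it is the half-line with its dilations at a conical point, and a
    single point in the interior. *)
Lemma locally_action_of_sheets (T T' : Type) (G : gpd R T T') (U : set T') :
  mhausdorff X0 -> mopen (sheets k) (theta @` W) ->
  (forall x, car (obj (reduction G U)) x ->
     car (arr (reduction G U)) (Defs.one G x)) ->
  Lie_groupoid_iso (reduction G U) (reduction P (A0 `*` W)) ->
  locally_action G U.
Proof.
move=> HX0 oV oneG iso; have hXK := prod_action hX0 mS hK0 (Lie_group_sheets k)
  hact0 (additive_action (smooth_sheets_add k)).
exists _, _, X, K, act, (A0 `*` (theta @` W)); split=> //.
- by split=> //; apply: mhausdorff_mprod => //; apply: mhausdorff_sheets.
- exact: Lie_group_prod (Lie_group_sheets k).
- exact: mopen_mprod.
apply: Lie_groupoid_iso_trans iso sheets_chart_iso => //.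
  apply: manifold_restr_carI => //.
  by apply: arrows_over_mopen; apply: mopen_mprod.
by apply: manifold_restr => //; apply: mopen_mprod.
Qed.

End Chart.

End SheetCharts.

(** * Submanifolds of Euclidean spaces *)

Section Submanifolds.
Context {R : realType} (n k : nat).
Hypothesis kn : (k <= n)%N.
Implicit Types (S : set 'rV[R]_n).

Let drop_last : 'M[R]_(n, k) := pid_mx k.
Let pad : 'M[R]_(k, n) := pid_mx k.

Lemma padK (u : 'rV[R]_k) : u *m pad *m drop_last = u.
Proof.
by rewrite -mulmxA mul_pid_mx minnn (minn_idPr kn) pid_mx_1 mulmx1.
Qed.

Lemma pad_high (u : 'rV[R]_k) (j : 'I_n) : (k <= j)%N -> (u *m pad) 0 j = 0.
Proof.
move=> kj; rewrite mxE big1 // => i _; rewrite mxE.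
by case: eqP => [ij|_] /=; rewrite ?mulr0 //; move: (ltn_ord i); rewrite ij ltnNge kj.
Qed.

Lemma drop_lastK (y : 'rV[R]_n) : (forall j : 'I_n, (k <= j)%N -> y 0 j = 0) ->
  y *m drop_last *m pad = y.
Proof.
move=> y0; rewrite -mulmxA mul_pid_mx !minnn; apply/rowP => j.
rewrite mxE (bigD1 j) //= big1 ?addr0 => [|i ij].
  by rewrite mxE eqxx /=; case: ltnP => [_|/y0 ->]; rewrite ?mulr1 ?mul0r.
by rewrite mxE (inj_eq val_inj) (negbTE ij) mulr0.
Qed.

Definition slice_data S (V W : set 'rV[R]_n) (f g : 'rV[R]_n -> 'rV[R]_n) : Prop :=
  diffeo_on V W f g /\
  forall x, V x -> (S x <-> forall j : 'I_n, (k <= j)%N -> f x 0 j = 0).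

Definition slice S (V : set 'rV[R]_n) (f : 'rV[R]_n -> 'rV[R]_n) :
    chart R 'rV[R]_n :=
  @Chart R 'rV[R]_n k (S `&` V) (fun x => f x *m drop_last) (fun=> false).

Lemma slice_padK S V W f g x : slice_data S V W f g -> S x -> V x ->
  f x *m drop_last *m pad = f x.
Proof. by case=> d h Sx Vx; apply: drop_lastK; apply/h. Qed.

Lemma open_pad (W : set 'rV[R]_n) : open W ->
  open [set u : 'rV[R]_k | W (u *m pad)].
Proof.
move=> oW; apply: open_comp => // x _.
exact: (@continuous_linear_rV _ _ _ (mulmxr pad)).
Qed.

Lemma Coo_on_pad b (W : set 'rV[R]_n) (g : 'rV[R]_n -> 'rV[R]_b) : open W -> Coo_on W g ->
  Coo_on [set u : 'rV[R]_k | W (u *m pad)] (fun u => g (u *m pad)).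
Proof.
move=> oW sg; apply: (Coo_on_comp (f := mulmxr pad) (open_pad oW) oW _ _ sg) => //.
exact: Coo_on_linear.
Qed.

(** In a slice chart the inclusion is padding by zeros followed by the inverse [g] of the
    straightening map. *)
Lemma submfd_incl S : smooth_on (submfd k S) (eucl n) S idfun.
Proof.
split=> // c c' [V [W [f [g [[[oV oW] [sf sg] [fV gW] gf fg] h ->]]]]] -> p Sp [_ Vp] _.
have d : slice_data S V W f g by split.
exists [set u : 'rV[R]_k | W (u *m pad)], (fun u => g (u *m pad)); split=> //=.
- exact: open_pad.
- by rewrite (slice_padK d) //; apply: fV; exists p.
- exact: Coo_on_pad.
- by move=> q _ [Sq Vq] _; rewrite (slice_padK d) ?gf.
Qed.

(** A representative into the ambient space, followed by the straightening map and the projection,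
    is one into the slice chart: this is the universal property of embedded submanifolds. *)
Lemma smooth_to_submfd (T : Type) (M : mfd R T) (Z : set T) S f :
  (forall x, Z x -> S (f x)) -> smooth_on M (eucl n) Z f ->
  smooth_on M (submfd k S) Z f.
Proof.
move=> fS [_ sf]; split=> // c c' hc [V [W [F [G [[[oV oW] [sF sG] _ _ _] h ->]]]]].
move=> p Zp cp [_ Vp].
have [//|U [H [oU Up sH hH]]] := sf c _ hc erefl p Zp cp.
have [_ /= Hp] := hH p Zp cp Up.
have oUV : open (U `&` H @^-1` V).
  exact: (open_preimage_Coo oU oV sH).
exists (U `&` H @^-1` V), (fun u => F (H u) *m drop_last); split=> //.
- by split=> //=; rewrite -Hp.
- have sFH : Coo_on (U `&` H @^-1` V) (F \o H).
    apply: (Coo_on_comp (f := H) oUV oV) => //; first by move=> x [].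
    by apply: Coo_on_subset sH => x [].
  exact: (Coo_on_comp oUV openT (fun _ _ => I) sFH (@Coo_on_mulmx _ _ _ setT drop_last)).
- move=> q Zq cq [Uq Vq]; have [_ /= E] := hH q Zq cq Uq.
  by rewrite /= -E in Vq; split; [split=> //; exact: fS|rewrite /= E].
Qed.

Lemma manifold_submfd S : is_submfd k S -> manifold (submfd k S).
Proof.
move=> hS; have sid : smooth (submfd k S) (submfd k S) idfun.
  exact: smooth_to_submfd (submfd_incl S).
split=> //.
- move=> _ [V [W [f [g [d0 h ->]]]]]; have d : slice_data S V W f g by split.
  have [[oV oW] _ [fV gW] gf fg] := d0; split=> /=; first by move=> x [].
    move=> x y /set_mem[Sx Vx] /set_mem[Sy Vy] E.
    by rewrite -(gf x Vx) -(gf y Vy) -(slice_padK d Sx Vx) -(slice_padK d Sy Vy) E.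
  exists [set u : 'rV[R]_k | W (u *m pad)]; first exact: open_pad.
  apply/seteqP; split=> [_ [x [Sx Vx] <-]|u [/= Wu _]].
    by split=> //=; rewrite (slice_padK d) //; apply: fV; exists x.
  have Vg : V (g (u *m pad)) by apply: gW; exists (u *m pad).
  exists (g (u *m pad)); last by rewrite fg // padK.
  by split=> //; apply/h => // j kj; rewrite fg // pad_high.
(* The atlas contains all slice charts, in general uncountably many. As in the theorem of Lindelof,
   each rational ball whose trace on [S] fits in some slice chart selects one such chart. *)
- pose good (i : seq rat * rat) (c : chart R 'rV[R]_n) := slice_chart k S c /\
    S `&` ball (rational_point _ i.1) (ratr i.2) `<=` cdom c.
  pose c0 : chart R 'rV[R]_n := @Chart R _ 0 set0 (fun=> 0) (fun=> false).
  pose C i := if pselect (exists c, good i c) is left e then sval (cid e) else c0.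
  apply: (@chart_cover_second_countable R _ _
    (fun m => if unpickle m is Some i then C i else c0)).
  + by move=> _ [V [W [f [g [_ _ ->]]]]] x [].
  + exact: sid.
  + move=> p Sp; have [_ [V [W [f [g [d h ->]]]]] [_ Vp]] := hS p Sp.
    have [[oV _] _ _ _ _] := d.
    have [s [q [Bp BV]]] := rational_ball_basis oV Vp.
    exists (pickle (s, q)); rewrite pickleK /C; case: pselect => [e|[]].
    * by have [] := svalP (cid e).
    * exists (slice S V f); split; first by exists V, W, f, g.
      by move=> x [Sx /BV Vx]; split.
    * by have [_] := svalP (cid e); apply.
    * exists (slice S V f); split; first by exists V, W, f, g.
      by move=> x [Sx /BV Vx]; split.
- by exists k => _ [V [W [f [g [_ _ ->]]]]].
Qed.

Lemma mopen_submfd S (V : set 'rV[R]_n) : is_submfd k S -> open V ->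
  mopen (submfd k S) (S `&` V).
Proof.
move=> hS oV; apply: mopen_preimage (manifold_eucl n) _ (submfd_incl S) _.
  exact: (mopen_car (manifold_submfd hS)).
exact: mopen_eucl.
Qed.

Lemma mhausdorff_submfd S : is_submfd k S -> mhausdorff (submfd k S).
Proof.
move=> hS; apply: (mhausdorff_inj (manifold_submfd hS) (manifold_eucl n)
  (@mhausdorff_eucl R n) (submfd_incl S)) => //.
Qed.

Lemma min_distance (s : seq 'rV[R]_n) : exists2 e : R, 0 < e &
  forall a b, a \in s -> b \in s -> a != b -> e <= `|a - b|.
Proof.
pose l := [seq `|p.1 - p.2| | p <- [seq (a, b) | a <- s, b <- s] & p.1 != p.2].
have l0 : all (fun x => 0 < x) l.
  apply/allP => x /mapP[p]; rewrite mem_filter => /andP[ab _] ->.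
  by rewrite normr_gt0 subr_eq0.
have pos_min (l' : seq R) : all (fun x => 0 < x) l' ->
    exists2 e : R, 0 < e & all (fun x => e <= x) l'.
  elim: l' => [|x l' IH]; first by exists 1.
  move=> /= /andP[x0 /IH[e e0 he]]; exists (Num.min x e); first by rewrite lt_min x0.
  rewrite ge_min lexx /=; apply: sub_all he => y ey.
  by rewrite ge_min ey orbT.
have [e e0 he] := pos_min l l0.
exists e => // a b sa sb ab; apply: (allP he); apply/mapP; exists (a, b) => //.
by rewrite mem_filter ab; apply/allpairsP; exists (a, b).
Qed.

(* Each listed point is put on its own sheet. *)
Lemma finite_points_sheets S (s : seq 'rV[R]_n) : is_submfd k S ->
  (forall a, a \in s -> S a) ->
  exists W (theta : 'rV[R]_n -> 'rV[R]_k * int) theta',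
    [/\ mopen (submfd k S) W /\ (forall a, a \in s -> W a),
        smooth_on (submfd k S) (sheets k) W theta,
        mopen (sheets k) (theta @` W),
        smooth_on (sheets k) (submfd k S) (theta @` W) theta'
      & forall x, W x -> theta' (theta x) = x].
Proof.
move=> hS sS; have [e e0 he] := min_distance s.
pose D a (d : set 'rV[R]_n * set 'rV[R]_n * ('rV[R]_n -> 'rV[R]_n) *
  ('rV[R]_n -> 'rV[R]_n)) := slice_data S d.1.1.1 d.1.1.2 d.1.2 d.2 /\ d.1.1.1 a.
have exD a : S a -> exists d, D a d.
  by move=> Sa; have [c [V [W [f [g [d h ->]]]]] [_ Va]] := hS a Sa;
    exists (V, W, f, g); split.
pose ch a := if pselect (exists d, D a d) is left h then sval (cid h)
  else (set0, set0, idfun, idfun).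
have chP a : S a -> D a (ch a).
  move=> /exD h; rewrite /ch; case: pselect => // h'; exact: svalP (cid h').
pose V a := (ch a).1.1.1; pose V' a := (ch a).1.1.2.
pose f a := (ch a).1.2; pose g a := (ch a).2.
(* Distinct listed points are at distance at least [e], so a point is within [e / 2] of at most one
   of them. *)
pose near_pt q (a : 'rV[R]_n) := `|a - q| < e / 2.
(* The sheet of [q] is the first position of the listed point close to it, so repeated points share
   a sheet. The value [size s] means that no listed point is close, and [W] excludes it. *)
pose idx q := find (near_pt q) s; pose pt j := nth 0 s j.
pose W := [set q | [/\ S q, (idx q < size s)%N & V (pt (idx q)) q]].
pose theta q := (f (pt (idx q)) q *m drop_last, Posz (idx q)).
pose theta' (z : 'rV[R]_k * int) := g (pt `|z.2|%N) (z.1 *m pad).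
have ptS j : (j < size s)%N -> S (pt j) by move=> js; apply/sS/mem_nth.
have uniq_near q q' a : a \in s -> near_pt q a -> near_pt q' a -> idx q' = idx q.
  have one_near r b : a \in s -> b \in s -> near_pt r a -> near_pt r b = (b == a).
    move=> sa sb ra; apply/idP/eqP => [rb|-> //]; apply/eqP.
    apply: contraT => /(he b a sb sa); rewrite leNgt => /negP; case.
    rewrite -(subrKA r) (le_lt_trans (ler_normD _ _)) // (splitr e).
    by rewrite ltrD // distrC.
  move=> sa qa q'a; apply: eq_in_find => b sb.
  by rewrite (one_near q') // (one_near q).
have idx_near q : (idx q < size s)%N -> near_pt q (pt (idx q)).
  by move=> h; apply: nth_find; rewrite has_find.
pose B q := ball (pt (idx q)) (e / 2) `&` V (pt (idx q)).
have oB q : W q -> open (B q).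
  move=> [Sq js Vq]; apply: openI; first exact: ball_open.
  by have [[[[oV _] _ _ _ _] _] _] := chP _ (ptS _ js).
have idxB q q' : W q -> B q q' -> idx q' = idx q.
  move=> [Sq js Vq] [bq' _]; apply: (uniq_near q q' (pt (idx q))).
  - exact: mem_nth.
  - exact: idx_near.
  - by move: bq'; rewrite -ball_normE.
have Bq q : W q -> B q q.
  move=> [Sq js Vq]; split=> //; rewrite -ball_normE; exact: idx_near.
have BW q q' : W q -> S q' -> B q q' -> W q'.
  move=> Wq Sq' Bq'; have [Sq js Vq] := Wq.
  by rewrite /W /= (idxB q q') //; split=> //; case: Bq'.
have theta'K x : W x -> theta' (theta x) = x.
  move=> [Sx js Vx]; have [d _] := chP _ (ptS _ js).
  rewrite /theta' /theta /= (slice_padK d) //.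
  by have [[_ _ _ gf _] _] := d; apply: gf.
have hM := manifold_submfd hS; have hE := @manifold_eucl R k.
have hD := @manifold_discrete R int; have hSh := @manifold_sheets R k.
have incl := submfd_incl S.
have WS : W `<=` S by move=> q [].
have oW : mopen (submfd k S) W.
  apply: mopen_local => q Wq; exists (S `&` B q); split.
  - exact/mopen_submfd/oB.
  - by split; [apply: WS|apply: Bq].
  - by move=> q' [Sq' Bq']; apply: BW Bq'.
have sheet_open q : W q -> exists U, [/\ open U, U (theta q).1 &
    forall u, U u -> let x := theta' (u, Posz (idx q)) in
      [/\ V' (pt (idx q)) (u *m pad), W x & theta x = (u, Posz (idx q))]].
  move=> Wq; have [Sq js Vq] := Wq; have [d _] := chP _ (ptS _ js).
  have [[[oV oV'] [_ sg] [fV gV'] gf fg] h] := d.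
  have oU : open (V' (pt (idx q)) `&` g (pt (idx q)) @^-1` B q).
    exact: (open_preimage_Coo oV' (oB q Wq) sg).
  exists [set u | (V' (pt (idx q)) `&` g (pt (idx q)) @^-1` B q) (u *m pad)].
  split; first exact: open_pad.
    rewrite /= (slice_padK d) //; split; first by apply: fV; exists q.
    by rewrite /= /f /g (gf q Vq); apply: Bq.
  move=> u [/= V'u Bu]; rewrite /theta' /=; set x := g _ _.
  have Vx : V (pt (idx q)) x by apply: gV'; exists (u *m pad).
  have fx : f (pt (idx q)) x = u *m pad by apply: fg.
  have Sx : S x by apply/(h x Vx) => j kj; rewrite [LHS](congr1 (fun v : 'rV[R]_n => v 0 j) fx) pad_high.
  split=> //; first exact: BW Bu.
  by rewrite /theta (idxB q x) // fx padK.
exists W, theta, theta'; split=> //.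
- split=> // a sa; have [near_a aS] : near_pt a a /\ S a.
    by split; [rewrite /near_pt subrr normr0 divr_gt0|apply: sS].
  have js : (idx a < size s)%N by rewrite -has_find; apply/hasP; exists a.
  have pa : pt (idx a) = a.
    apply/eqP; apply: contraT => /(he _ _ (mem_nth 0 js) sa).
    rewrite leNgt => /negP; case; rewrite (lt_trans (idx_near a js)) //.
    by rewrite ltr_pdivrMr // ltr_pMr // ltr1n.
  by split=> //; rewrite pa; have [_] := chP a aS.
- apply: smooth_on_local => // q Wq; exists (S `&` B q); split.
  + exact/mopen_submfd/oB.
  + by split; [apply: WS|apply: Bq].
  have [Sq js Vq] := Wq; have [[[[oV _] [sf _] _ _ _] _] _] := chP _ (ptS _ js).
  apply: (@smooth_on_eq _ _ _ _ _ _
    (fun x => (f (pt (idx q)) x *m drop_last, Posz (idx q)))).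
    by move=> x [_ [_ Bx]]; rewrite /theta (idxB q x).
  apply: smooth_on_pair; last first.
    by apply: smooth_cst => //; move=> x [/WS].
  apply: (smooth_eucl_comp (g := mulmxr drop_last) openT) => //.
    exact: Coo_on_linear.
  apply: (smooth_eucl_comp (f := idfun) oV sf); first by move=> x [_ [_ []]].
  by apply: smooth_on_subset incl => x [/WS].
- apply: mopen_local => _ [q Wq <-]; have [U [oU Uq hU]] := sheet_open q Wq.
  exists (U `*` [set Posz (idx q)]); split=> //.
    by apply: mopen_mprod => //; [exact: mopen_eucl|exact: mopen_discrete].
  by move=> [u i] [/= Uu ->]; have [_ Wx <-] := hU u Uu; exists (theta' (u, Posz (idx q))).
- apply: smooth_on_local => // _ [q Wq <-]; have [U [oU Uq hU]] := sheet_open q Wq.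
  exists (U `*` [set Posz (idx q)]); split=> //.
    by apply: mopen_mprod => //; [exact: mopen_eucl|exact: mopen_discrete].
  apply: smooth_to_submfd; first by move=> z [[x Wx <-] _]; rewrite theta'K //; apply: WS.
  have [Sq js Vq] := Wq; have [[[[_ oV'] [_ sg] _ _ _] _] _] := chP _ (ptS _ js).
  apply: (@smooth_on_eq _ _ _ _ _ _ ((fun u => g (pt (idx q)) (u *m pad)) \o fst)).
    by move=> [u i] [_ [/= _ ->]].
  apply: (smooth_eucl_comp (open_pad oV') (Coo_on_pad oV' sg)).
    by move=> [u i] [_ [/= Uu _]]; have [] := hU u Uu.
  by apply: smooth_on_subset (smooth_fst (discrete_mfd int) hE).
Qed.

End Submanifolds.

(** * Polar coordinates at the conical points *)

Section EuclideanNorm.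
Context {R : realType} (n : nat).
Implicit Types (x y : 'rV[R]_n).

Definition enorm x : R := Num.sqrt (\sum_i x 0 i ^+ 2).

Lemma sqnorm_ge0 x : 0 <= \sum_i x 0 i ^+ 2.
Proof. by apply: sumr_ge0 => i _; apply: sqr_ge0. Qed.

Lemma enorm_ge0 x : 0 <= enorm x.
Proof. exact: sqrtr_ge0. Qed.

Lemma enormZ (r : R) x : 0 <= r -> enorm (r *: x) = r * enorm x.
Proof.
move=> r0; rewrite /enorm (eq_bigr (fun i => r ^+ 2 * x 0 i ^+ 2)); last first.
  by move=> i _; rewrite mxE exprMn.
by rewrite -mulr_sumr sqrtrM ?sqr_ge0 // sqrtr_sqr ger0_norm.
Qed.

Lemma sqnorm_gt0 x : x != 0 -> 0 < \sum_i x 0 i ^+ 2.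
Proof.
move=> x0; rewrite lt_neqAle sqnorm_ge0 andbT eq_sym.
apply: contraNneq x0 => /eqP; rewrite psumr_eq0 => [|i _]; last exact: sqr_ge0.
move=> /allP h; apply/eqP/rowP => i; rewrite mxE.
by have := h i (mem_index_enum i); rewrite /= sqrf_eq0 => /eqP.
Qed.

Lemma enorm_gt0 x : x != 0 -> 0 < enorm x.
Proof. by move=> /sqnorm_gt0; rewrite sqrtr_gt0. Qed.

Lemma enorm0 : enorm 0 = 0.
Proof. by rewrite /enorm big1 ?sqrtr0 // => i _; rewrite mxE expr0n. Qed.

Lemma unit_sphereP x : unit_sphere n x <-> enorm x = 1.
Proof.
rewrite /unit_sphere /enorm /=; split=> [->|h]; first by rewrite sqrtr1.
by rewrite -(sqr_sqrtr (sqnorm_ge0 x)) h expr1n.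
Qed.

Lemma unit_ballP x : unit_ball n x <-> enorm x < 1.
Proof.
rewrite /unit_ball /enorm /=; split=> h.
  by rewrite -sqrtr1 ltr_sqrt.
by move: h; rewrite -{1}sqrtr1 ltr_sqrt.
Qed.

Definition normalize x : 'rV[R]_n := (enorm x)^-1 *: x.

Lemma enorm_normalize x : x != 0 -> enorm (normalize x) = 1.
Proof.
move=> x0; rewrite enormZ ?invr_ge0 ?enorm_ge0 // mulVf //.
by rewrite gt_eqF // enorm_gt0.
Qed.

Lemma normalizeK x : x != 0 -> enorm x *: normalize x = x.
Proof.
by move=> x0; rewrite scalerA mulfV ?scale1r // gt_eqF // enorm_gt0.
Qed.

Lemma normalizeZ (r : R) x : 0 < r -> enorm x = 1 -> normalize (r *: x) = x.
Proof.
move=> r0 x1; rewrite /normalize enormZ ?(ltW r0) // x1 mulr1 scalerA mulVf ?scale1r //.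
by rewrite gt_eqF.
Qed.

Lemma smooth_enorm (T : Type) (M : mfd R T) (Z : set T) (f : T -> 'rV[R]_n) :
  (forall z, Z z -> f z != 0) -> smooth_on M (eucl n) Z f ->
  smooth_on M (eucl 1) Z (fun z => const_mx (enorm (f z))).
Proof.
move=> f0 sf; apply: smooth_sqrtr; last exact: smooth_sqnorm.
by move=> x /f0; apply: sqnorm_gt0.
Qed.

Lemma smooth_normalize (T : Type) (M : mfd R T) (Z : set T) (f : T -> 'rV[R]_n) :
  (forall z, Z z -> f z != 0) -> smooth_on M (eucl n) Z f ->
  smooth_on M (eucl n) Z (fun z => normalize (f z)).
Proof.
move=> f0 sf; apply: smooth_scaler => //; apply: smooth_invr.
  by move=> x /f0/enorm_gt0; apply: lt0r_neq0.
exact: smooth_enorm.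
Qed.

Lemma smooth_eucl_continuous a b (W : set 'rV[R]_a) (f : 'rV[R]_a -> 'rV[R]_b) :
  open W -> smooth_on (eucl a) (eucl b) W f ->
  forall p, W p -> {for p, continuous f}.
Proof.
move=> oW [_ sf] p Wp; have [||W' [F [oW' W'p sF hF]]] :=
  sf _ _ erefl erefl p Wp; [by []|by []|].
have [_ /= Fp] := hF p Wp I W'p.
have := Coo_on_continuous sF W'p; rewrite /prop_for /continuous_at -Fp.
have near_fF : {near p, F =1 f}.
  apply: (near_open (W := W `&` W')); [exact: openI|by []|].
  by move=> q [Wq W'q]; have [_ /= ->] := hF q Wq I W'q.
by apply: cvg_trans; exact: (near_eq_cvg near_fF).
Qed.

Lemma open_neq0 : open [set x : 'rV[R]_n | x != 0].
Proof.
rewrite (_ : [set x | _] = ~` [set 0]); last first.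
  by apply/seteqP; split=> x /= /eqP.
by apply: closed_openC; apply: accessible_closed_set1; apply: hausdorff_accessible; exact: norm_hausdorff.
Qed.

Lemma continuous_normalize x : x != 0 -> {for x, continuous normalize}.
Proof.
move=> x0; apply: (smooth_eucl_continuous open_neq0 _ (p := x)) => //.
apply: smooth_normalize => //.
by apply: smooth_on_subset (manifold_id (manifold_eucl n)).
Qed.

Lemma continuous_sqnorm : continuous (fun x => \sum_i x 0 i ^+ 2).
Proof.
rewrite (_ : (fun x => _) = \sum_i (fun x : 'rV[R]_n => x 0 i) ^+ 2); last first.
  by apply/funext => x; rewrite fct_sumE; apply: eq_bigr.
move=> x; apply: differentiable_continuous; apply: differentiable_sum => i.
by apply: differentiableX; apply: differentiable_coord.
Qed.

Lemma closed_unit_sphere : closed (unit_sphere n : set 'rV[R]_n).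
Proof.
apply: (@closed_comp _ _ (fun x : 'rV[R]_n => \sum_i x 0 i ^+ 2) [set y | y = 1]).
  by move=> x _; apply: continuous_sqnorm.
exact: closed_eq.
Qed.

End EuclideanNorm.

Lemma closure_map (T U : topologicalType) (f : T -> U) (A : set T) (B : set U)
    (p : T) : {for p, continuous f} -> closure A p ->
  (forall a, A a -> B (f a)) -> closure B (f p).
Proof.
by move=> cf clA AB N /cf/clA[a [Aa Na]]; exists (f a); split=> //; apply: AB.
Qed.

Lemma closureI_open (T : topologicalType) (A V : set T) (p : T) :
  closure A p -> open V -> V p -> closure (A `&` V) p.
Proof.
move=> clA oV Vp N Np; have [|a [Aa [Na Va]]] := clA (N `&` V).
  by apply: filterI => //; apply: open_nbhs_nbhs.
by exists a; split.
Qed.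

Section Cone.
Context {R : realType} {n : nat} (Omega : set 'rV[R]_n) (D : conical_data R n).
Hypothesis hD : conical_domain Omega D.
Implicit Type i : 'I_(cnum D).

Let Omega0 := smooth_part Omega D.

Definition pol i (z : R * 'rV[R]_n) : 'rV[R]_n := cpsi i (z.1 *: z.2).
Definition polV i (p : 'rV[R]_n) : R * 'rV[R]_n :=
  (enorm (cphi i p), normalize (cphi i p)).

Let cD i : [/\ frontier Omega (cpt i), cnbhd i (cpt i),
  diffeo_on (cnbhd i) (unit_ball n) (cphi i) (cpsi i), cphi i (cpt i) = 0
  & cphi i @` (Omega `&` cnbhd i) =
    [set y | exists r x', [/\ 0 < r, r < 1, clink i x' & y = r *: x']]].
Proof. by have [_ _ _ h _] := hD; apply: h. Qed.

Lemma clink_sphere i x : clink i x -> enorm x = 1.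
Proof.
have [_ _ h _ _] := hD; have [[V oV ->] _ _] := h i.
by move=> [_ /unit_sphereP].
Qed.

Lemma link_bd_sphere i x : link_bd i x -> enorm x = 1.
Proof.
move=> [clx _]; apply/unit_sphereP.
have := closed_unit_sphere (R := R) (n := n); rewrite closure_id => ->.
by apply: closure_subset clx => y /clink_sphere/unit_sphereP.
Qed.

Lemma cnbhd_inj i j p : cnbhd i p -> cnbhd j p -> i = j.
Proof.
move=> Vi Vj; apply/eqP; apply: contraT => ij; have [_ _ _ _ h] := hD.
have : (closure (cnbhd i) `&` closure (cnbhd j)) p.
  by split; apply: subset_closure.
by rewrite h.
Qed.

Lemma cphi_eq0 i p : cnbhd i p -> cphi i p = 0 -> p = cpt i.
Proof.
have [_ Vc [_ _ _ gf _] c0 _] := cD i.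
by move=> Vp p0; rewrite -(gf p Vp) p0 -c0 gf.
Qed.

Lemma Omega0_cphi i p : Omega0 p -> cnbhd i p -> cphi i p != 0.
Proof.
by move=> [_ pc] Vp; apply/eqP => /(cphi_eq0 Vp) E; apply: pc; exists i.
Qed.

Lemma cone_Omega i y : unit_ball n y -> Omega (cpsi i y) <->
  exists r x', [/\ 0 < r, r < 1, clink i x' & y = r *: x'].
Proof.
have [_ _ [_ _ [_ gW] gf fg] _ E] := cD i => By; split=> [Oy|Cy].
  have : (cphi i @` (Omega `&` cnbhd i)) y.
    by exists (cpsi i y); [split=> //; apply: gW; exists y|exact: fg].
  by rewrite E.
have : (cphi i @` (Omega `&` cnbhd i)) y by rewrite E.
by move=> [p [Op Vp] <-]; rewrite gf.
Qed.

Lemma scale_unit_ball (r : R) (x : 'rV[R]_n) : 0 <= r -> r < 1 -> enorm x = 1 ->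
  unit_ball n (r *: x).
Proof. by move=> r0 r1 x1; apply/unit_ballP; rewrite enormZ // x1 mulr1. Qed.

(** The cone is a union of whole open rays and polar coordinates are unique away from the vertex, so
    membership depends on the direction only. *)
Lemma cone_ray i (r : R) (x : 'rV[R]_n) : 0 < r -> r < 1 -> enorm x = 1 ->
  Omega (cpsi i (r *: x)) <-> clink i x.
Proof.
move=> r0 r1 x1; rewrite cone_Omega; last by apply: scale_unit_ball => //; apply: ltW.
split=> [[s [y [s0 s1 cy E]]]|cx]; last by exists r, x.
by rewrite -(normalizeZ r0 x1) E normalizeZ // (clink_sphere cy).
Qed.

Lemma continuous_ray i (r : R) (x : 'rV[R]_n) : 0 <= r -> r < 1 -> enorm x = 1 ->
  {for x, continuous (fun y : 'rV[R]_n => cpsi i (r *: y) : 'rV[R]_n)}.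
Proof.
move=> r0 r1 x1; apply: (continuous_comp (f := fun x : 'rV[R]_n => r *: x)).
  exact: scaler_continuous.
have [_ _ [_ [_ sg] _ _ _] _ _] := cD i.
exact: (Coo_on_continuous sg (scale_unit_ball r0 r1 x1)).
Qed.

Lemma pol_cnbhd i (r : R) (x : 'rV[R]_n) : 0 <= r -> r < 1 -> enorm x = 1 ->
  cnbhd i (pol i (r, x)).
Proof.
move=> r0 r1 x1; have [_ _ [_ _ [_ gW] _ _] _ _] := cD i.
by apply: gW; exists (r *: x) => //; apply: scale_unit_ball.
Qed.

Lemma polK i (r : R) (x : 'rV[R]_n) : 0 < r -> r < 1 -> enorm x = 1 ->
  polV i (pol i (r, x)) = (r, x).
Proof.
move=> r0 r1 x1; have [_ _ [_ _ _ _ fg] _ _] := cD i.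
rewrite /polV /pol /= fg; last by apply: scale_unit_ball => //; apply: ltW.
by rewrite enormZ ?(ltW r0) // x1 mulr1 normalizeZ.
Qed.

(** At a fixed radius the ray map is continuous. By [cone_ray] it sends [clink i] into [Omega] and
    the rest of the sphere outside, hence the boundary of the link into the frontier. *)
Lemma pol_Omega0 i (r : R) (x : 'rV[R]_n) : 0 < r -> r < 1 -> link_bd i x ->
  Omega0 (pol i (r, x)).
Proof.
move=> r0 r1 Lx; have x1 := link_bd_sphere Lx; have [clx clx'] := Lx.
have cont := @continuous_ray i r x (ltW r0) r1 x1.
split; first split.
- by apply: (closure_map cont clx) => y cy; apply/cone_ray => //; apply: clink_sphere cy.
- apply: (closure_map cont clx') => y [/unit_sphereP y1 cy].
  by move=> /(cone_ray i r0 r1 y1).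
(* A conical point in this neighbourhood must be [cpt i], which has radius 0, against [0 < r]. *)
- move=> [j _ E]; have [_ Vj _ c0 _] := cD j.
  have Vi := pol_cnbhd i (ltW r0) r1 x1.
  have ij : i = j by apply: (cnbhd_inj Vi); rewrite -E.
  subst j; have := congr1 fst (polK i r0 r1 x1).
  by rewrite -E /= c0 enorm0 => e; rewrite -e ltxx in r0.
Qed.

Lemma polVK i p : Omega0 p -> cnbhd i p -> pol i (polV i p) = p.
Proof.
move=> Op Vp; have [_ _ [_ _ _ gf _] _ _] := cD i.
by rewrite /pol /polV /= normalizeK ?gf // Omega0_cphi.
Qed.

(** The direction is continuous where [cphi i] does not vanish. This happens on a neighbourhood of
    [p], so both closures defining the frontier may first be cut down to it and then mapped to the
    sphere. *)
Lemma polV_dom i p : Omega0 p -> cnbhd i p ->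
  [/\ 0 < (polV i p).1, (polV i p).1 < 1 & link_bd i (polV i p).2].
Proof.
move=> Op Vp; have y0 := Omega0_cphi Op Vp; have [[clp clp'] _] := Op.
have [_ _ [[oV oB] [sf _] [fV _] gf fg] _ _] := cD i.
have cf : {for p, continuous (cphi i)} := Coo_on_continuous sf Vp.
have cN : {for p, continuous (@normalize R n \o cphi i)}.
  by apply: continuous_comp cf _; apply: continuous_normalize.
have norm_lt1 q : cnbhd i q -> enorm (cphi i q) < 1.
  by move=> Vq; apply/unit_ballP; apply: fV; exists q.
have ray q : cnbhd i q -> cphi i q != 0 ->
    Omega q <-> clink i (normalize (cphi i q)).
  move=> Vq q0; rewrite -(cone_ray i (enorm_gt0 q0) (norm_lt1 q Vq)).
    by rewrite normalizeK // gf.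
  exact: enorm_normalize.
have oV' : open (cnbhd i `&` cphi i @^-1` [set y | y != 0]).
  exact: (open_preimage_Coo oV (@open_neq0 R n) sf).
split; [exact: enorm_gt0|exact: norm_lt1|split].
- apply: (closure_map cN (closureI_open clp oV' (conj Vp y0))).
  by move=> q [Oq [Vq q0]]; apply/ray.
- apply: (closure_map cN (closureI_open clp' oV' (conj Vp y0))).
  move=> q [Oq [Vq q0]]; split; first by apply/unit_sphereP/enorm_normalize.
  by move=> /(ray q Vq q0).
Qed.

End Cone.

(** * The layer potentials groupoid *)

Section GlueSum.
Context {R : realType} {I : countType} {T T' : Type}.
Variables (M : I -> mfd R T) (N : mfd R T') (A : set (I * T)) (f : I * T -> T')
  (V : I -> set T') (g : I -> T' -> T).

(** Collars and interior have different ambient types, so the pieces form a family over [option I],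
    where [None] stands for the interior. *)
Definition piece_type (o : option I) : Type := if o is Some _ then T else T'.

Definition piece (o : option I) : mfd R (piece_type o) :=
  match o with Some i => M i | None => N end.

Definition piece_in (o : option I) : piece_type o -> (I * T) + T' :=
  match o with Some i => fun x => glue_in A f (i, x) | None => inr end.

Lemma glue_in_in z : A z -> glue_in A f z = inr (f z).
Proof. by move=> Az; rewrite /glue_in asboolT. Qed.

Lemma glue_in_out z : ~ A z -> glue_in A f z = inl z.
Proof. by move=> Az; rewrite /glue_in asboolF. Qed.

Hypotheses (hM : forall i, manifold (M i)) (hN : manifold N)
  (dimMN : exists n, (forall i c, atl (M i) c -> cdim c = n) /\
                     (forall c, atl N c -> cdim c = n))
  (oA : forall i, mopen (M i) (car (M i) `&` [set x | A (i, x)]))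
  (oV : forall i, mopen N (V i))
  (V_inj : forall i j y, V i y -> V j y -> i = j)
  (fP : forall i x, car (M i) x -> A (i, x) -> V i (f (i, x)) /\ g i (f (i, x)) = x)
  (gP : forall i y, V i y -> [/\ car (M i) (g i y), A (i, g i y) & f (i, g i y) = y])
  (sf : forall i, smooth_on (M i) N (car (M i) `&` [set x | A (i, x)])
                    (fun x => f (i, x)))
  (sg : forall i, smooth_on N (M i) (V i) (g i)).

Lemma piece_in_inj i j x y : car (M i) x -> car (M j) y ->
  piece_in (o := Some i) x = piece_in (o := Some j) y -> i = j /\ x = y.
Proof.
move=> Mx My; rewrite /piece_in.
have [Ax|Ax] := pselect (A (i, x)); have [Ay|Ay] := pselect (A (j, y)).
- rewrite !glue_in_in // => -[E]; have [Vx gx] := fP Mx Ax; have [Vy gy] := fP My Ay.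
  have ij : i = j by apply: V_inj Vx _; rewrite E.
  by subst j; split=> //; rewrite -gx E gy.
- by rewrite glue_in_in // glue_in_out.
- by rewrite glue_in_out // glue_in_in.
- by rewrite !glue_in_out // => -[].
Qed.

(** Two different collars never meet, since their images lie in the disjoint sets [V i]. A collar
    meets the interior along [A], with transition [f] in one direction and [g] in the other. *)
Lemma glue_sum_amalgam : amalgam piece piece_in (Defs.glue (mdsum M) N A f).
Proof.
split.
- by case.
- by have [n [h1 h2]] := dimMN; exists n; case.
- case=> [i|] x y Mx My; last by case.
  by move=> /(piece_in_inj Mx My)[].
- move=> z; split=> [[[[i x] /= Mx <-]|[y Ny <-]]|[[i|] [x [Mx <-]]]].
  + by exists (Some i), x.
  + by exists None, y.
  + by left; exists (i, x).
  + by right; exists x.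
- move=> c; split=> [[|]|].
  + move=> [c1 [h [[i _ [c0 [h0 [hc0 h0E E1]]]] hE ->]]]; subst c1.
    exists (Some i), c0, h; split=> //.
      by move=> x cx; rewrite -h0E //; apply: (hE (i, x)); exists x.
    congr (@Chart R _ _ _ h _); rewrite image_comp; reflexivity.
  + by move=> hc; exists None.
  + move=> [[i|] [c0 [h [hc0 hE ->]]]]; last by right; exists c0, h.
    left; exists (Chart (pair i @` cdom c0) (fun z => cmap c0 z.2) (@ccor _ _ c0)), h.
    split.
    * by exists i => //; exists c0, (fun z => cmap c0 z.2); split.
    * by move=> _ [x cx <-]; rewrite /= hE.
    * by congr (@Chart R _ _ _ h _); rewrite /= image_comp.
- case=> [i|] [j|] x y Mx My E.
  + have [ij xy] := piece_in_inj Mx My E; subst j.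
    exists (car (M i)), idfun; split=> //; [exact: mopen_car (hM i)|exact: manifold_id (hM i)].
  + have Ax : A (i, x).
      by apply: contrapT => Ax; move: E; rewrite /= glue_in_out.
    exists (car (M i) `&` [set x | A (i, x)]), (fun x => f (i, x)); split.
    * exact: oA.
    * by [].
    * exact: sf.
    * by move=> q [_ Aq]; rewrite /= glue_in_in.
  + have Ay : A (j, y).
      by apply: contrapT => Ay; move: E; rewrite /= glue_in_out.
    move: E; rewrite /= glue_in_in // => -[E].
    exists (V j), (g j); split.
    * exact: oV.
    * by rewrite E; apply: (fP My Ay).1.
    * exact: sg.
    * by move=> q /gP[_ Ag Eg]; rewrite glue_in_in // Eg.
  + exists (car N), idfun; split=> //; [exact: mopen_car hN|exact: manifold_id hN].
Qed.

End GlueSum.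

Section Layer.
Context {R : realType} {n : nat} (Omega : set 'rV[R]_n) (D : conical_data R n).
Hypotheses (hn : (2 <= n)%N) (hD : conical_domain Omega D).
Implicit Type i : 'I_(cnum D).

Notation Omega0 := (smooth_part Omega D).
Notation Om := (submfd n.-1 Omega0).
Notation link i := (submfd n.-2 (link_bd i)).
Notation G := (layer_groupoid Omega D).

Lemma manifold_Omega0 : manifold Om.
Proof. by have [_ h _ _ _] := hD; apply: manifold_submfd h; apply: leq_pred. Qed.

Lemma is_submfd_link i : is_submfd n.-2 (link_bd i).
Proof. by have [_ _ h _ _] := hD; have [] := h i. Qed.

Lemma manifold_link i : manifold (link i).
Proof.
by apply: manifold_submfd (is_submfd_link (i := i)); apply: leq_trans (leq_pred _) (leq_pred _).
Qed.

Lemma le_pred2 : (n.-2 <= n)%N.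
Proof. exact: leq_trans (leq_pred _) (leq_pred _). Qed.

Section Polar.
Context {T : Type} (M : mfd R T) (Z : set T) (i : 'I_(cnum D)).

Lemma smooth_pol (t : T -> R) (x : T -> 'rV[R]_n) :
  (forall z, Z z -> [/\ 0 < t z, t z < 1 & link_bd i (x z)]) ->
  smooth_on M (eucl 1) Z (fun z => const_mx (t z)) -> smooth_on M (eucl n) Z x ->
  smooth_on M Om Z (fun z => pol i (t z, x z)).
Proof.
move=> tx st sx; apply: smooth_to_submfd.
  by move=> z /tx[t0 t1 Lx]; apply: pol_Omega0.
have [_ _ _ h _] := hD; have [_ _ [[_ oB] [_ sg] _ _ _] _ _] := h i.
apply: (smooth_eucl_comp (f := fun z => t z *: x z) oB sg).
  move=> z /tx[t0 t1 Lx]; apply: scale_unit_ball => //; first exact: ltW.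
  exact: (link_bd_sphere hD Lx).
exact: smooth_scaler.
Qed.

Lemma smooth_polV (p : T -> 'rV[R]_n) :
  (forall z, Z z -> Omega0 (p z) /\ cnbhd i (p z)) -> smooth_on M (eucl n) Z p ->
  smooth_on M (eucl 1) Z (fun z => const_mx (polV i (p z)).1) /\
  smooth_on M (link i) Z (fun z => (polV i (p z)).2).
Proof.
move=> pP sp; have [_ _ _ h _] := hD; have [_ _ [[oV _] [sF _] _ _ _] _ _] := h i.
have sc : smooth_on M (eucl n) Z (fun z => cphi i (p z)).
  by apply: (smooth_eucl_comp (f := p) oV sF) => // z /pP[].
have c0 z : Z z -> cphi i (p z) != 0 by move=> /pP[Op Vp]; exact: (Omega0_cphi hD Op Vp).
split; first exact: smooth_enorm.
apply: smooth_to_submfd; last exact: smooth_normalize.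
by move=> z /pP[Op Vp]; have [] := polV_dom hD Op Vp.
Qed.

End Polar.

Lemma smooth_Omega0_eucl (T : Type) (M : mfd R T) (Z : set T) f :
  smooth_on M Om Z f -> smooth_on M (eucl n) Z f.
Proof.
move=> sf; apply: (smooth_on_comp (g := idfun) manifold_Omega0 sf.1 sf).
by apply: submfd_incl; apply: leq_pred.
Qed.

Lemma smooth_link_eucl (T : Type) (M : mfd R T) (Z : set T) i f :
  smooth_on M (link i) Z f -> smooth_on M (eucl n) Z f.
Proof.
move=> sf; apply: (smooth_on_comp (g := idfun) (manifold_link i) sf.1 sf).
by apply: submfd_incl; apply: le_pred2.
Qed.

Lemma smooth_half_line_eucl (T : Type) (M : mfd R T) (Z : set T) t :
  smooth_on M half_line Z t -> smooth_on M (eucl 1) Z (fun z => const_mx (t z)).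
Proof.
by move=> st; exact: (smooth_on_comp (@manifold_half_line R) st.1 st (@smooth_half_line R)).
Qed.

Lemma smooth_pos_line_eucl (T : Type) (M : mfd R T) (Z : set T) t :
  smooth_on M pos_line Z t -> smooth_on M (eucl 1) Z (fun z => const_mx (t z)).
Proof.
by move=> st; exact: (smooth_on_comp (@manifold_pos_line R) st.1 st (@smooth_pos_line R)).
Qed.

Lemma mopen_half_line (W : set R) : open W -> mopen half_line ([set t : R | 0 <= t] `&` W).
Proof.
move=> oW; have oV : open [set y : 'rV[R]_1 | W (y 0 0)].
  apply: (@open_comp _ _ (fun x : 'rV[R]_1 => x 0 0) W) => //.
  by move=> x _; apply: coord_continuous.
have := mopen_preimage (manifold_eucl 1) (mopen_car (@manifold_half_line R))
  (@smooth_half_line R) (mopen_eucl oV).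
by congr (mopen _ _); apply/seteqP; split=> t /= [? ]; rewrite ?mxE; split; rewrite ?mxE.
Qed.

Lemma mopen_collar : mopen half_line [set t : R | 0 <= t < 1].
Proof.
have := mopen_half_line (@open_lt R 1).
by congr (mopen _ _); apply/seteqP; split=> t /=; [case=> -> ->|case/andP].
Qed.

Notation collar_mfd i := (restr (mprod half_line (link i))
  ([set t : R | 0 <= t < 1] `*` link_bd i)).

Lemma manifold_cylinder i : manifold (mprod half_line (link i)).
Proof. exact: manifold_mprod (@manifold_half_line R) (manifold_link i). Qed.

Lemma mopen_cylinder i : mopen (mprod half_line (link i))
  ([set t : R | 0 <= t < 1] `*` link_bd i).
Proof.
apply: mopen_mprod; [exact: manifold_half_line|exact: manifold_link|exact: mopen_collar|].
by apply: mopen_car; apply: manifold_link.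
Qed.

Lemma manifold_collar i : manifold (collar_mfd i).
Proof. exact: manifold_restr (manifold_cylinder i) (mopen_cylinder i). Qed.

Definition cone_part i : set 'rV[R]_n := Omega0 `&` cnbhd i.

Lemma mopen_cone_part i : mopen Om (cone_part i).
Proof.
have [_ h _ c _] := hD; have [_ _ [[oV _] _ _ _ _] _ _] := c i.
by apply: mopen_submfd => //; apply: leq_pred.
Qed.

Lemma dim_submfd m k S (c : chart R 'rV[R]_m) : atl (submfd k S) c -> cdim c = k.
Proof. by move=> [V [W [f [g [_ _ ->]]]]]. Qed.

(** Predecessors are truncated at 0, so collar and interior have the same dimension only when
    [2 <= n]. *)
Lemma dim_cylinder : (1 + n.-2)%N = n.-1.
Proof. by case: n hn => [|[|m]]. Qed.

Definition obj_piece := piece (fun i => collar_mfd i) Om.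
Definition obj_in := piece_in (I := 'I_(cnum D)) (@polar_dom R n D) (@polar R n D).

Lemma obj_amalgam : amalgam obj_piece obj_in (obj G).
Proof.
apply: (@glue_sum_amalgam _ _ _ _ _ _ _ _ cone_part (@polV R n D)).
- exact: manifold_collar.
- exact: manifold_Omega0.
- exists n.-1; split=> [i _ [_ [c1 [c2 [-> hc2 ->]]] ->]|c /dim_submfd //].
  by rewrite /= (dim_submfd hc2) dim_cylinder.
- move=> i; apply/mopen_restr; [exact: manifold_cylinder|exact: mopen_cylinder|].
  split; last by move=> x [[]].
  have oP : mopen half_line [set t : R | 0 <= t < 1 /\ 0 < t].
    have := mopenI mopen_collar (mopen_half_line (@open_gt R 0)).
    by congr (mopen _ _); apply/seteqP; split=> t /=; [case=> ? []|case=> /[dup] ? /andP[]].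
  have := mopen_mprod (@manifold_half_line R) (manifold_link i) oP
    (mopen_car (manifold_link i)).
  congr (mopen _ _); apply/seteqP; split=> [[t x] [/= [t01 t0] Lx]|].
    by move/andP: (t01) => [? ?]; split; [split; split|exact: t0].
  by move=> [t x] /= [[_ [t01 Lx]] t0].
- exact: mopen_cone_part.
- by move=> i j y [_ Vi] [_ Vj]; apply: (cnbhd_inj hD Vi Vj).
- move=> i [t x] [_ [/= /andP[_ t1] Lx]] t0; have x1 := link_bd_sphere hD Lx.
  split; last exact: (polK hD).
  split; first exact: (pol_Omega0 hD).
  by apply: (pol_cnbhd hD) => //; apply: ltW.
- move=> i p [Op Vp]; have [r0 r1 Lx] := polV_dom hD Op Vp; split=> //.
    by do !split=> //=; rewrite ?ltW.
  exact: (polVK hD).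
- move=> i; apply: smooth_on_restr; set Z := _ `&` _.
  have mC := manifold_cylinder i.
  have sid : smooth_on (mprod half_line (link i)) (mprod half_line (link i)) Z idfun.
    by apply: smooth_on_subset (manifold_id mC) => x [[]].
  have h := @manifold_half_line R; have l := manifold_link i.
  apply: (@smooth_pol _ _ Z i (fun x => x.1) (fun x => x.2)).
  + by move=> [t x] [[_ [/= /andP[_ t1] Lx]] t0].
  + exact: smooth_half_line_eucl (smooth_fst_comp h l sid).
  + exact: smooth_link_eucl (smooth_snd_comp h l sid).
- move=> i; apply: smooth_on_to_restr.
    move=> p [Op Vp]; have [r0 r1 Lx] := polV_dom hD Op Vp.
    by split=> //=; rewrite ltW.
  have sid : smooth_on Om Om (cone_part i) idfun.
    by apply: smooth_on_subset (manifold_id manifold_Omega0) => x [].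
  have [s1 s2] := @smooth_polV _ Om (cone_part i) i idfun (fun p h => h)
    (smooth_Omega0_eucl sid).
  apply: smooth_on_pair => //; apply: smooth_to_half_line => //.
  by move=> p [Op Vp]; have [/ltW] := polV_dom hD Op Vp.
Qed.

End Layer.

(** * The manifold of arrows *)

Section LayerArrows.
Context {R : realType} {n : nat} (Omega : set 'rV[R]_n) (D : conical_data R n).
Hypotheses (hn : (2 <= n)%N) (hD : conical_domain Omega D).
Implicit Type i : 'I_(cnum D).

Notation Omega0 := (smooth_part Omega D).
Notation Om := (submfd n.-1 Omega0).
Notation link i := (submfd n.-2 (link_bd i)).
Notation G := (layer_groupoid Omega D).
Notation J := (dsum_groupoid (@J_groupoid R n D)).
Notation P i := (prod_groupoid (@dilation_groupoid R) (pair_groupoid (link i))).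

Definition polar_arrows : set ('I_(cnum D) * ((R * R) * ('rV[R]_n * 'rV[R]_n))) :=
  src J @^-1` (@polar_dom R n D) `&` rng J @^-1` (@polar_dom R n D).

Definition polar_arrow (g : 'I_(cnum D) * ((R * R) * ('rV[R]_n * 'rV[R]_n))) :=
  (polar (rng J g), polar (src J g)).

Let mH := @manifold_half_line R.
Let mL i := manifold_link hD i.
Let mOm := manifold_Omega0 hD.

Lemma manifold_dilation_arrows : manifold (arr (@dilation_groupoid R)).
Proof. exact: manifold_mprod (@manifold_half_line R) (@manifold_pos_line R). Qed.

Lemma manifold_P_arrows i : manifold (arr (P i)).
Proof.
by apply: manifold_mprod manifold_dilation_arrows _; apply: manifold_mprod.
Qed.

Lemma P_src_smooth i : smooth (arr (P i)) (obj (P i)) (src (P i)).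
Proof.
exact: (pair_src_smooth mH (@Lie_group_positive R) (@dilation_action R) (mL i)).
Qed.

Lemma P_rng_smooth i : smooth (arr (P i)) (obj (P i)) (rng (P i)).
Proof.
exact: (pair_rng_smooth _ mH (@Lie_group_positive R) (mL i)).
Qed.

Lemma manifold_J_arrows i : manifold (arr (J_groupoid i)).
Proof.
apply: manifold_restr_carI (manifold_P_arrows i) _.
apply: (arrows_over_mopen mH (@Lie_group_positive R) (@dilation_action R) (mL i)).
exact: (mopen_cylinder hD).
Qed.

(** Here [t] is the radius of the range and [t * s^-1] that of the domain; nonnegativity of the
    latter is automatic. *)
Lemma J_arrowsP i t s x y : car (arr (J_groupoid i)) ((t, s), (x, y)) <->
  [/\ 0 < s, link_bd i x /\ link_bd i y, 0 <= t, t < 1 & t * s^-1 < 1].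
Proof.
split.
  move=> [[[/= t0 s0] [/= Lx Ly]] [[/= /andP[_ ts1] _] [/= /andP[_ t1] _]]].
  by split.
move=> [s0 [Lx Ly] t0 t1 ts1]; split; first by [].
by split; split=> //=; rewrite ?t0 ?t1 ?ts1 // mulr_ge0 // invr_ge0 ltW.
Qed.

Lemma J_src_smooth i : smooth (arr (J_groupoid i)) (obj (P i)) (src (P i)).
Proof.
by apply: smooth_on_restr; apply: smooth_on_subset (P_src_smooth i) => a [].
Qed.

Lemma J_rng_smooth i : smooth (arr (J_groupoid i)) (obj (P i)) (rng (P i)).
Proof.
by apply: smooth_on_restr; apply: smooth_on_subset (P_rng_smooth i) => a [].
Qed.

Lemma J_arrows_mopen i (A : set (R * 'rV[R]_n)) : mopen (obj (P i)) A ->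
  mopen (arr (J_groupoid i)) (arrows_over (J_groupoid i) A).
Proof.
move=> oA; have mC := manifold_cylinder hD i.
have oJ := mopen_car (manifold_J_arrows i).
have := mopenI (mopen_preimage mC oJ (J_src_smooth i) oA)
  (mopen_preimage mC oJ (J_rng_smooth i) oA).
congr (mopen _ _); apply/seteqP; split=> a; first by move=> [[? ?] [_ ?]].
by move=> [? []].
Qed.

(** The dilation factor is the quotient of the radii, range over domain, because the domain has
    radius [t * s^-1]. *)
Definition polV_arrow i (z : 'rV[R]_n * 'rV[R]_n) :
    (R * R) * ('rV[R]_n * 'rV[R]_n) :=
  (((polV i z.1).1, (polV i z.1).1 * (polV i z.2).1^-1),
   ((polV i z.1).2, (polV i z.2).2)).

Lemma div_divK (r s : R) : r != 0 -> r * (r * s^-1)^-1 = s.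
Proof. by move=> r0; rewrite invfM invrK mulrA mulfV // mul1r. Qed.

Definition arr_piece := piece (fun i => arr (J_groupoid i)) (mprod Om Om).
Definition arr_in := piece_in (I := 'I_(cnum D)) polar_arrows polar_arrow.

Lemma polar_arrowsP i t s x y : 0 < s ->
  polar_arrows (i, ((t, s), (x, y))) <-> 0 < t.
Proof.
move=> s0; split=> [[]//|t0]; split=> //.
by rewrite /polar_dom /= divr_gt0.
Qed.

Lemma arr_amalgam : amalgam arr_piece arr_in (arr G).
Proof.
have mOO := manifold_mprod mOm mOm.
apply: (@glue_sum_amalgam _ _ _ _ _ _ _ _
  (fun i => cone_part Omega i `*` cone_part Omega i) polV_arrow).
- exact: manifold_J_arrows.
- exact: mOO.
- exists (n.-1 + n.-1)%N; split.
    move=> i _ [_ [_ [_ [[_ [_ [-> -> ->]]] [c1 [c2 [hc1 hc2 ->]]] ->]]] ->].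
    (* The radius, the dilation factor and the two points of the link regroup into two copies of the
       collar coordinates. *)
    by rewrite /= (dim_submfd hc1) (dim_submfd hc2) addnACA dim_cylinder.
  by move=> _ [c1 [c2 [h1 h2 ->]]]; rewrite /= (dim_submfd h1) (dim_submfd h2).
- move=> i; have oP : mopen (obj (P i)) ([set t : R | 0 <= t /\ 0 < t] `*` link_bd i).
    apply: (mopen_mprod mH (mL i)); last exact: (mopen_car (mL i)).
    have := mopen_half_line (@open_gt R 0).
    by congr (mopen _ _); apply/seteqP; split=> t /= [? ?]; split.
  have := J_arrows_mopen oP; congr (mopen _ _); apply/seteqP.
  split=> [a [Ja [[[/= _ ?] _] [[/= _ ?] _]]]|]; first by [].
  move=> [[t s] [x y]] [/[dup] Ja /J_arrowsP[s0 [Lx Ly] t0 t1 ts1]].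
  rewrite /= polar_arrowsP // => tt0; split=> //.
  have ts0 : 0 < t * s^-1 by rewrite divr_gt0.
  by split; split=> //=; split=> //; apply: ltW.
- by move=> i; apply: mopen_mprod => //; apply: (mopen_cone_part hD).
- by move=> i j y [[_ Vi] _] [[_ Vj] _]; apply: (cnbhd_inj hD Vi Vj).
- move=> i [[t s] [x y]] /J_arrowsP[s0 [Lx Ly] t0 t1 ts1].
  rewrite polar_arrowsP // => tt0; have ts0 : 0 < t * s^-1 by rewrite divr_gt0.
  have x1 := link_bd_sphere hD Lx; have y1 := link_bd_sphere hD Ly.
  split.
    split; split.
    + exact: (pol_Omega0 hD).
    + exact: (pol_cnbhd hD).
    + exact: (pol_Omega0 hD).
    + by apply: (pol_cnbhd hD) => //; apply: ltW.
  rewrite /polV_arrow /polar_arrow /polar -!/(pol i (_, _)) !(polK hD) //=.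
  by rewrite div_divK // gt_eqF.
- move=> i [p q] [[/= Op Vp] [/= Oq Vq]].
  have [r0 r1 Lx] := polV_dom hD Op Vp; have [s0 s1 Ly] := polV_dom hD Oq Vq.
  have rs0 : 0 < (polV i p).1 * (polV i q).1^-1 by rewrite divr_gt0.
  split.
  + apply/J_arrowsP; split; [exact: rs0|exact: (conj Lx Ly)|exact: ltW|exact: r1|].
    by rewrite div_divK ?gt_eqF.
  + exact/polar_arrowsP.
  + rewrite /polar_arrow /polV_arrow /polar /= div_divK ?gt_eqF //.
    by congr (_, _); [exact: (polVK hD Op Vp)|exact: (polVK hD Oq Vq)].
- move=> i; apply: smooth_on_restr; set Z := _ `&` _.
  have mPA := manifold_P_arrows i; have mD := manifold_dilation_arrows.
  have mLL := manifold_mprod (mL i) (mL i).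
  have sid : smooth_on (arr (P i)) (arr (P i)) Z idfun.
    by apply: smooth_on_subset (manifold_id mPA) => a [[]].
  have sl := smooth_fst_comp mD mLL sid; have sr := smooth_snd_comp mD mLL sid.
  have st := smooth_half_line_eucl (smooth_fst_comp mH (@manifold_pos_line R) sl).
  have ss := smooth_pos_line_eucl (smooth_snd_comp mH (@manifold_pos_line R) sl).
  have ZP a : Z a -> [/\ 0 < a.1.2, link_bd i a.2.1 /\ link_bd i a.2.2,
      0 < a.1.1, a.1.1 < 1 & 0 < a.1.1 * a.1.2^-1 /\ a.1.1 * a.1.2^-1 < 1].
    move: a => [[t s] [x y]] [/J_arrowsP[s0 L t0 t1 ts1]].
    rewrite /= polar_arrowsP // => tt0; split=> //; split=> //.
    by rewrite divr_gt0.
  apply: smooth_on_pair.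
    apply: (@smooth_pol _ _ _ _ hD _ _ Z i (fun a => a.1.1) (fun a => a.2.1)) => //.
    + by move=> a /ZP[_ [? _] ? ? _].
    + exact: (smooth_link_eucl hD (smooth_fst_comp (mL i) (mL i) sr)).
  apply: (@smooth_pol _ _ _ _ hD _ _ Z i (fun a => a.1.1 * a.1.2^-1) (fun a => a.2.2)).
  + by move=> a /ZP[_ [_ ?] _ _ [? ?]].
  + apply: smooth_mulr => //; apply: smooth_invr => //.
    by move=> a /ZP[s0 _ _ _ _]; rewrite gt_eqF.
  + exact: (smooth_link_eucl hD (smooth_snd_comp (mL i) (mL i) sr)).
- move=> i; set Z := _ `*` _; apply: smooth_on_to_restr.
    move=> [p q] [[/= Op Vp] [/= Oq Vq]].
    have [r0 r1 Lx] := polV_dom hD Op Vp; have [s0 s1 Ly] := polV_dom hD Oq Vq.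
    have r01 : 0 <= (polV i p).1 < 1 by rewrite ltW.
    have s01 : 0 <= (polV i p).1 * ((polV i p).1 * (polV i q).1^-1)^-1 < 1.
      by rewrite div_divK ?gt_eqF // ltW.
    by split; [exact: (conj s01 Ly)|exact: (conj r01 Lx)].
  have sid : smooth_on (mprod Om Om) (mprod Om Om) Z idfun.
    by apply: smooth_on_subset (manifold_id mOO) => a [[? _] [? _]].
  have sp := smooth_Omega0_eucl hD (smooth_fst_comp mOm mOm sid).
  have sq := smooth_Omega0_eucl hD (smooth_snd_comp mOm mOm sid).
  have [sp1 sp2] := @smooth_polV _ _ _ _ hD _ _ Z i fst (fun z (h : Z z) => h.1) sp.
  have [sq1 sq2] := @smooth_polV _ _ _ _ hD _ _ Z i snd (fun z (h : Z z) => h.2) sq.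
  have r0 (z : 'rV[R]_n * 'rV[R]_n) : Z z -> 0 < (polV i z.1).1 /\ 0 < (polV i z.2).1.
    move=> [[Op Vp] [Oq Vq]]; have [? _ _] := polV_dom hD Op Vp.
    by have [? _ _] := polV_dom hD Oq Vq.
  apply: smooth_on_pair; apply: smooth_on_pair => //.
    by apply: smooth_to_half_line => // z /r0[/ltW].
  apply: smooth_to_pos_line; first by move=> z /r0[? ?]; rewrite divr_gt0.
  apply: smooth_mulr => //; apply: smooth_invr => // z /r0[_ ?].
  by rewrite gt_eqF.
Qed.

End LayerArrows.

(** * Normal forms and algebraic axioms *)

Section LayerGroupoid.
Context {R : realType} {n : nat} (Omega : set 'rV[R]_n) (D : conical_data R n).
Hypotheses (hn : (2 <= n)%N) (hD : conical_domain Omega D).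
Implicit Type i : 'I_(cnum D).

Notation Omega0 := (smooth_part Omega D).
Notation G := (layer_groupoid Omega D).

Let oam := obj_amalgam hn hD.
Let aam := arr_amalgam hn hD.

(** Collar points of positive radius are represented in the interior by [glue_in], so the elements
    of the quotient still of the form [inl] are exactly those of radius 0. *)
Definition bd_pt i (x : 'rV[R]_n) : 'I_(cnum D) * (R * 'rV[R]_n) + 'rV[R]_n :=
  inl (i, (0, x)).

Definition bd_arr i (s : R) (x y : 'rV[R]_n) :
    'I_(cnum D) * ((R * R) * ('rV[R]_n * 'rV[R]_n)) + 'rV[R]_n * 'rV[R]_n :=
  inl (i, ((0, s), (x, y))).

Lemma obj_in_bd i x : glue_in (@polar_dom R n D) (@polar R n D) (i, (0, x)) = bd_pt i x.
Proof. by rewrite glue_in_out // /polar_dom /= ltxx. Qed.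

Lemma arr_in_bd i s x y :
  glue_in (@polar_arrows R n D) (@polar_arrow R n D) (i, ((0, s), (x, y))) =
  bd_arr i s x y.
Proof. by rewrite glue_in_out // => -[_]; rewrite /polar_dom /= ltxx. Qed.

Lemma src_bd i s x y : src G (bd_arr i s x y) = bd_pt i y.
Proof. by rewrite /= mul0r obj_in_bd. Qed.

Lemma rng_bd i s x y : rng G (bd_arr i s x y) = bd_pt i x.
Proof. by rewrite /= obj_in_bd. Qed.

Lemma one_bd i x : Defs.one G (bd_pt i x) = bd_arr i 1 x x.
Proof. exact: arr_in_bd. Qed.

Lemma inv_bd i s x y : Defs.inv G (bd_arr i s x y) = bd_arr i s^-1 y x.
Proof. by rewrite /= mul0r; exact: arr_in_bd. Qed.

(** The dilation factors multiply in reverse order, as in the groupoid of a right action. *)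
Lemma mul_bd i s s' x y z :
  Defs.mul G (bd_arr i s x y) (bd_arr i s' y z) = bd_arr i (s' * s) x z.
Proof. exact: arr_in_bd. Qed.

Lemma car_obj_bd i x : link_bd i x -> car (obj G) (bd_pt i x).
Proof.
move=> Lx; apply/(amalgam_car oam); exists (Some i), (0, x).
split; last exact: obj_in_bd.
by split; split=> //=; rewrite ?lexx ?ltr01.
Qed.

Lemma car_obj_int p : Omega0 p -> car (obj G) (inr p).
Proof. by move=> Op; apply/(amalgam_car oam); exists None, p. Qed.

Lemma car_arr_bd i s x y : 0 < s -> link_bd i x -> link_bd i y ->
  car (arr G) (bd_arr i s x y).
Proof.
move=> s0 Lx Ly; apply/(amalgam_car aam); exists (Some i), ((0, s), (x, y)).
split; last exact: arr_in_bd.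
by apply/J_arrowsP; rewrite mul0r; split.
Qed.

Lemma car_arr_int p q : Omega0 p -> Omega0 q -> car (arr G) (inr (p, q)).
Proof. by move=> Op Oq; apply/(amalgam_car aam); exists None, (p, q). Qed.

Lemma obj_cases z : car (obj G) z -> (exists2 p, Omega0 p & z = inr p) \/
  (exists i x, link_bd i x /\ z = bd_pt i x).
Proof.
move=> /(amalgam_car oam)[[i|] [x [Mx <-]]]; last by left; exists x.
case: x Mx => t x [_ [/= /andP[t0 t1] Lx]].
move: t0; rewrite le_eqVlt => /predU1P[<-|t0].
  by right; exists i, x; split=> //; apply: obj_in_bd.
left; exists (pol i (t, x)); first exact: (pol_Omega0 hD).
by rewrite /obj_in /= glue_in_in.
Qed.

Lemma arr_cases g : car (arr G) g ->
  (exists p q, [/\ Omega0 p, Omega0 q & g = inr (p, q)]) \/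
  (exists i s x y, [/\ 0 < s, link_bd i x, link_bd i y & g = bd_arr i s x y]).
Proof.
move=> /(amalgam_car aam)[[i|] [a [Ma <-]]]; last first.
  by case: a Ma => p q [Op Oq]; left; exists p, q.
case: a Ma => [[t s] [x y]] /J_arrowsP[s0 [Lx Ly] t0 t1 ts1].
move: t0; rewrite le_eqVlt => /predU1P[<-|t0].
  by right; exists i, s, x, y; split=> //; apply: arr_in_bd.
left; exists (pol i (t, x)), (pol i (t * s^-1, y)); split.
- exact: (pol_Omega0 hD).
- by apply: (pol_Omega0 hD) => //; rewrite divr_gt0.
- by rewrite /arr_in /= glue_in_in //; apply/polar_arrowsP.
Qed.

(** Dilations fix 0, so both ends of an arrow are boundary points or neither is, and composability
    propagates the type from one arrow to the next. Equality of the middle objects also forces the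
    same conical point. *)
Lemma composable_cases g h : composable G (g, h) ->
  (exists p q r, [/\ Omega0 p, Omega0 q, Omega0 r, g = inr (p, q) & h = inr (q, r)]) \/
  (exists i s s' x y z, [/\ 0 < s /\ 0 < s',
     [/\ link_bd i x, link_bd i y & link_bd i z], g = bd_arr i s x y
   & h = bd_arr i s' y z]).
Proof.
move=> [/= /arr_cases[[p [q [Op Oq ->]]]|[i [s [x [y [s0 Lx Ly ->]]]]]]].
  move=> /arr_cases[[p' [q' [Op' Oq' ->]]]|[i' [s' [x' [y' [s0' Lx' Ly' ->]]]]]].
    by move=> [qp]; subst p'; left; exists p, q, q'.
  by rewrite -[X in _ = X]/(rng G (bd_arr i' s' x' y')) rng_bd.
move=> /arr_cases[[p' [q' [Op' Oq' ->]]]|[i' [s' [x' [y' [s0' Lx' Ly' ->]]]]]].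
  by rewrite -[X in X = _]/(src G (bd_arr i s x y)) src_bd.
rewrite -[X in X = _]/(src G (bd_arr i s x y)) src_bd.
rewrite -[X in _ = X]/(rng G (bd_arr i' s' x' y')) rng_bd => -[ii yx].
by subst i' x'; right; exists i, s, s', x, y, y'.
Qed.

Lemma layer_car_srng g : car (arr G) g ->
  car (obj G) (src G g) /\ car (obj G) (rng G g).
Proof.
move=> /arr_cases[[p [q [Op Oq ->]]]|[i [s [x [y [s0 Lx Ly ->]]]]]].
  by split; apply: car_obj_int.
by rewrite src_bd rng_bd; split; apply: car_obj_bd.
Qed.

Lemma layer_car_one x : car (obj G) x -> car (arr G) (Defs.one G x).
Proof.
move=> /obj_cases[[p Op ->]|[i [y [Ly ->]]]]; first exact: car_arr_int.
by rewrite one_bd; apply: car_arr_bd.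
Qed.

Lemma layer_car_inv g : car (arr G) g -> car (arr G) (Defs.inv G g).
Proof.
move=> /arr_cases[[p [q [Op Oq ->]]]|[i [s [x [y [s0 Lx Ly ->]]]]]].
  exact: car_arr_int.
by rewrite inv_bd; apply: car_arr_bd; rewrite ?invr_gt0.
Qed.

Lemma layer_car_mul g h : composable G (g, h) -> car (arr G) (Defs.mul G g h).
Proof.
move=> /composable_cases[[p [q [r [Op Oq Or -> ->]]]]|].
  exact: car_arr_int.
move=> [i [s [s' [x [y [z [[s0 s0'] [Lx Ly Lz] -> ->]]]]]]].
by rewrite mul_bd; apply: car_arr_bd; rewrite ?mulr_gt0.
Qed.

(** On normal forms there are two cases: the pair groupoid of [Omega0], and over the boundary the
    product of the dilation group with the pair groupoid of a link. *)
Lemma layer_groupoid_axioms : groupoid_axioms G.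
Proof.
split.
- move=> x /obj_cases[[p Op ->] //|[i [y [Ly ->]]]].
  by rewrite one_bd src_bd rng_bd.
- move=> g h /composable_cases[[p [q [r [Op Oq Or -> ->]]]] //|].
  move=> [i [s [s' [x [y [z [_ _ -> ->]]]]]]].
  by rewrite mul_bd !src_bd !rng_bd.
- move=> g h k /composable_cases[[p [q [r [_ _ _ -> ->]]]]|].
    by move=> /composable_cases[[p' [q' [r' [_ _ _ _ ->]]]]|] // [? [? [? [? [? [? []]]]]]].
  move=> [i [s [s' [x [y [z [_ _ -> ->]]]]]]].
  move=> /composable_cases[[? [? [? []]]] //|[i' [s1 [s2 [x' [y' [z' [_ _]]]]]]]].
  move=> [<- _ _ <-] ->; rewrite !mul_bd ?mulrA //.
- move=> g /arr_cases[[p [q [Op Oq ->]]] //|[i [s [x [y [s0 Lx Ly ->]]]]]].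
  by rewrite src_bd rng_bd !one_bd !mul_bd mulr1 mul1r.
- move=> g /arr_cases[[p [q [Op Oq ->]]] //|[i [s [x [y [s0 Lx Ly ->]]]]]].
  have sn0 : s != 0 by rewrite gt_eqF.
  by rewrite inv_bd !src_bd !rng_bd !one_bd !mul_bd mulfV // mulVf.
Qed.

End LayerGroupoid.

(** * Separation and density in the space of units *)

Section LayerTopology.
Context {R : realType} {n : nat} (Omega : set 'rV[R]_n) (D : conical_data R n).
Hypotheses (hn : (2 <= n)%N) (hD : conical_domain Omega D).
Implicit Type i : 'I_(cnum D).

Notation Omega0 := (smooth_part Omega D).
Notation Om := (submfd n.-1 Omega0).
Notation link i := (submfd n.-2 (link_bd i)).
Notation G := (layer_groupoid Omega D).

Let oam := obj_amalgam hn hD.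

(** The norm of the library is the sup norm, so this bounds the Euclidean balls and gives their
    compactness. *)
Lemma enorm_bound (x : 'rV[R]_n) : `|x| <= enorm x.
Proof.
rewrite [leLHS]/Num.Def.normr /= mx_normrE.
apply: bigmax_le; first exact: enorm_ge0.
move=> [i j] _ /=; rewrite ord1 -sqrtr_sqr ler_sqrt ?sqnorm_ge0 //.
by rewrite (bigD1 j) //= lerDl; apply: sumr_ge0 => k _; apply: sqr_ge0.
Qed.

Lemma compact_enorm_ball (e : R) : 0 <= e ->
  compact [set x : 'rV[R]_n | enorm x <= e].
Proof.
move=> e0; apply: bounded_closed_compact.
  exists e; split; first exact: num_real.
  by move=> M eM x /= xe; apply: le_trans (enorm_bound x) (le_trans xe (ltW eM)).
rewrite (_ : [set x | _] = [set x : 'rV[R]_n | \sum_i x 0 i ^+ 2 <= e ^+ 2]).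
  apply: (@closed_comp _ _ (fun x : 'rV[R]_n => \sum_i x 0 i ^+ 2) [set y | y <= e ^+ 2]).
    by move=> x _; apply: continuous_sqnorm.
  exact: closed_le.
apply/seteqP; split=> x /=; rewrite /enorm.
  move=> xe; rewrite -(sqr_sqrtr (sqnorm_ge0 x)).
  by rewrite ler_pXn2r // nnegrE // sqrtr_ge0.
by move=> xe; rewrite -(ger0_norm e0) -sqrtr_sqr ler_sqrt // sqr_ge0.
Qed.

(* Compactness of the closed balls around the conical point separates the
   boundary of the desingularization from its interior. *)
Lemma collar_separate i x p : link_bd i x -> Omega0 p ->
  exists A B, [/\ mopen (obj G) A, mopen (obj G) B, A (bd_pt i x), B (inr p)
                & A `&` B = set0].
Proof.
move=> Lx Op; have [_ hS hL c _] := hD.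
have [_ Vc [[oV oB] [sf sg] [fV gW] gf fg] _ _] := c i.
(* If [p] lies in the conical neighbourhood, half its radius keeps it out of the ball; otherwise any
   radius below 1 does, and 1/2 is taken. *)
have [e [e0 e1 ep]] : exists e : R, [/\ 0 < e, e < 1 &
    forall y, enorm y <= e -> cpsi i y <> p].
  have [Vp|Vp] := pselect (cnbhd i p).
    have [r0 r1 _] := polV_dom hD Op Vp.
    have [h0 h1] : 0 < (polV i p).1 / 2 /\ (polV i p).1 / 2 < (polV i p).1.
      by rewrite divr_gt0 // ltr_pdivrMr // ltr_pMr // ltr1n.
    exists ((polV i p).1 / 2); split=> //; first exact: lt_trans r1.
    move=> y ye E; have By : unit_ball n y.
      by apply/unit_ballP; apply: le_lt_trans ye (lt_trans h1 r1).
    have := le_lt_trans ye h1.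
    by rewrite -[polV i p]/(enorm (cphi i p), _) -E fg //= ltxx.
  have h1 : (1 / 2 : R) < 1 by rewrite ltr_pdivrMr // mul1r ltr1n.
  have h0 : 0 < (1 / 2 : R) by rewrite divr_gt0.
  exists (1 / 2); split=> //.
  move=> y ye E; apply: Vp; rewrite -E; apply: gW; exists y => //.
  by apply/unit_ballP; apply: le_lt_trans ye h1.
(* A compact image is closed in the whole space, so its complement is an open neighbourhood of [p]
   even when [p] lies outside [cnbhd i]. *)
pose K := cpsi i @` [set y : 'rV[R]_n | enorm y <= e].
have cK : closed K.
  apply: compact_closed; first exact: norm_hausdorff.
  apply: continuous_compact (compact_enorm_ball (ltW e0)).
  apply: continuous_in_subspaceT => y /set_mem ye.
  apply: (Coo_on_continuous sg); apply/unit_ballP.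
  exact: le_lt_trans ye e1.
have mH := @manifold_half_line R; have mL := manifold_link hD i.
pose A : set (R * 'rV[R]_n) := ([set t : R | 0 <= t] `&` [set t | t < e]) `*` link_bd i.
have oA : mopen (obj_piece Omega (Some i)) A.
  apply/mopen_restr; [exact: (manifold_cylinder hD i)|exact: (mopen_cylinder hD i)|split].
    apply: mopen_mprod => //; last exact: (mopen_car mL).
    exact: mopen_half_line (@open_lt R e).
  move=> [t y] [[/= t0 te] Ly]; split=> //=.
  by rewrite t0 (lt_trans te e1).
exists (@obj_in R n D (Some i) @` A), (@obj_in R n D None @` (Omega0 `&` ~` K)); split.
- exact: (mopen_amalgam_in oam oA).
- apply: (mopen_amalgam_in oam (a := None)).
  by apply: mopen_submfd => //; [exact: leq_pred|exact: closed_openC].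
- exists (0, x); last exact: obj_in_bd.
  by split=> //; split=> //=; exact: lexx.
- by exists p => //; split=> // -[y ye]; apply: ep.
- apply/seteqP; split=> // _ [[[t y] [[/= t0 te] Ly] <-] [q [Oq Kq]]].
  rewrite /obj_in /=; have [tt0|tt0] := ltP 0 t.
    rewrite glue_in_in // => -[E]; apply: Kq; exists (t *: y); last by rewrite E.
    by rewrite /= enormZ // (link_bd_sphere hD Ly) mulr1 ltW.
  by rewrite glue_in_out // /polar_dom /= ltNge tt0.
Qed.

Lemma obj_in_index i j x y : car (obj_piece Omega (Some i)) x ->
  car (obj_piece Omega (Some j)) y ->
  @obj_in R n D (Some i) x = @obj_in R n D (Some j) y -> i = j.
Proof.
move: x y => [t x] [s y] [_ [/= /andP[t0 t1] Lx]] [_ [/= /andP[s0 s1] Ly]].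
have x1 := link_bd_sphere hD Lx; have y1 := link_bd_sphere hD Ly.
rewrite /obj_in /=; have [tt0|tt0] := ltP 0 t; have [ss0|ss0] := ltP 0 s.
- rewrite !glue_in_in // => -[E]; apply: (@cnbhd_inj _ _ _ _ hD i j (pol i (t, x))).
    exact: (pol_cnbhd hD).
  by rewrite -[pol i _]/(polar (i, (t, x))) E; apply: (pol_cnbhd hD).
- by rewrite glue_in_in // glue_in_out // /polar_dom /= ltNge ss0.
- by rewrite glue_in_out ?glue_in_in // /polar_dom /= ltNge tt0.
- by rewrite !glue_in_out => [[]||] //; rewrite /polar_dom /= ltNge ?tt0 ?ss0.
Qed.

Lemma car_collar_bd i x : link_bd i x -> car (obj_piece Omega (Some i)) (0, x).
Proof. by move=> Lx; split; split=> //=; rewrite ?lexx ?ltr01. Qed.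

Lemma mhausdorff_collar i : mhausdorff (obj_piece Omega (Some i)).
Proof.
have mC := manifold_cylinder hD i; have mL := manifold_link hD i.
apply: (@mhausdorff_inj _ _ _ _ (mprod half_line (link i)) idfun) => //.
- exact: (manifold_collar hD i).
- apply: mhausdorff_mprod => //; [exact: manifold_half_line|exact: mhausdorff_half_line|].
  by apply: mhausdorff_submfd; [exact: le_pred2|have := is_submfd_link hD; apply].
- by apply: smooth_on_restr; apply: smooth_on_subset (manifold_id mC) => x [].
Qed.

(** Two interior points, or two boundary points over one conical point, lie in a common Hausdorff
    piece. A mixed pair is [collar_separate], and collars of different conical points are disjoint
    open sets. *)
Lemma layer_obj_mhausdorff : mhausdorff (obj G).
Proof.
have sep_sym (z w : 'I_(cnum D) * (R * 'rV[R]_n) + 'rV[R]_n) :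
    (exists A B, [/\ mopen (obj G) A, mopen (obj G) B, A z, B w & A `&` B = set0]) ->
    exists A B, [/\ mopen (obj G) A, mopen (obj G) B, A w, B z & A `&` B = set0].
  by move=> [A [B [oA oB Az Bw AB]]]; exists B, A; split; rewrite // setIC.
have [_ hS _ _ _] := hD.
move=> z w /(obj_cases hn hD)[[p Op ->]|[i [x [Lx ->]]]];
  move=> /(obj_cases hn hD)[[q Oq ->]|[j [y [Ly ->]]]] ne.
- apply: (@amalgam_separate _ _ _ _ _ _ _ oam None p q) => //; last by move=> E; rewrite E in ne.
  by apply: mhausdorff_submfd hS; apply: leq_pred.
- exact/sep_sym/collar_separate.
- exact: collar_separate.
- have [ij|ij] := eqVneq i j.
    subst j; rewrite -!obj_in_bd.
    apply: (amalgam_separate oam (mhausdorff_collar (i := i)) (car_collar_bd Lx) (car_collar_bd Ly)).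
    by move=> [E]; rewrite E in ne.
  exists (@obj_in R n D (Some i) @` car (obj_piece Omega (Some i))).
  exists (@obj_in R n D (Some j) @` car (obj_piece Omega (Some j))); split.
  + exact: (mopen_amalgam_in oam (mopen_car (amalgam_mfd oam (Some i)))).
  + exact: (mopen_amalgam_in oam (mopen_car (amalgam_mfd oam (Some j)))).
  + by exists (0, x); [exact: car_collar_bd|exact: obj_in_bd].
  + by exists (0, y); [exact: car_collar_bd|exact: obj_in_bd].
  + apply/seteqP; split=> // _ [[a Ma <-] [b Mb E]].
    by rewrite (obj_in_index Mb Ma E) eqxx in ij.
Qed.

(** The curve of points [(t, x)] with [x] fixed starts at the boundary point for [t = 0] and is
    interior for [t > 0], so it enters every neighbourhood at interior points. *)
Lemma layer_obj_dense : mdense (obj G) (@inr ('I_(cnum D) * (R * 'rV[R]_n)) _ @` Omega0).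
Proof.
move=> B oB [z Bz]; have [[p Op zp]|[i [x [Lx zx]]]] := obj_cases hn hD (oB.1 _ Bz).
  by exists z; split=> //; exists p.
subst z; have mC := manifold_cylinder hD i.
have mL := manifold_link hD i; have mH := @manifold_half_line R.
pose c t : 'I_(cnum D) * (R * 'rV[R]_n) + 'rV[R]_n := @obj_in R n D (Some i) (t, x).
pose I1 := [set t : R | 0 <= t < 1].
have sc : smooth_on half_line (obj G) I1 c.
  apply: (@smooth_on_comp _ _ _ _ half_line (obj_piece Omega (Some i)) (obj G) I1 _
    (fun t => (t, x)) _ _ _ _ (smooth_amalgam_in oam (Some i))).
  - exact: (manifold_collar hD i).
  - by move=> t t01; split; split=> //=; case/andP: t01.
  - apply: smooth_on_to_restr; first by move=> t t01; split.
    apply: smooth_on_pair.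
      by apply: smooth_on_subset (manifold_id mH) => t /andP[].
    by apply: smooth_cst => //; move=> t /andP[].
have oc := mopen_preimage (manifold_amalgam oam) (@mopen_collar R) sc oB.
have [|V [oV V0 VB]] := oc.2 _ erefl (0 : R) _ (lexx 0).
  by split; [rewrite /I1 /= lexx ltr01|rewrite /preimage /= /c /obj_in /= obj_in_bd].
have /nbhs_ballP[e /= e0 eV] := open_nbhs_nbhs (conj oV V0).
(* Small enough to stay in the ball of radius [e] and in the collar. *)
pose t := Num.min e 1 / 2.
have t0 : 0 < t by rewrite divr_gt0 // lt_min e0 ltr01.
have te : t < e.
  by rewrite ltr_pdivrMr // (le_lt_trans (y := e)) // ?ge_min ?lexx // ltr_pMr // ltr1n.
have t1 : t < 1.
  by rewrite ltr_pdivrMr // mul1r (le_lt_trans (y := 1)) // ?ge_min ?lexx ?orbT // ltr1n.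
have [_ Bct] : (I1 `&` c @^-1` B) t.
  apply: VB; first exact: ltW.
  apply: eV; split=> // a b; rewrite !mxE -ball_normE /= sub0r normrN.
  by rewrite gtr0_norm.
exists (c t); split=> //; exists (pol i (t, x)); first exact: (pol_Omega0 hD).
by rewrite /c /obj_in /= glue_in_in.
Qed.

End LayerTopology.

(** * Local models over the interior *)

Section LayerCover.
Context {R : realType} {n : nat} (Omega : set 'rV[R]_n) (D : conical_data R n).
Hypotheses (hn : (2 <= n)%N) (hD : conical_domain Omega D).
Notation Omega0 := (smooth_part Omega D).
Notation Om := (submfd n.-1 Omega0).
Notation G := (layer_groupoid Omega D).

Let oam := obj_amalgam hn hD.
Let aam := arr_amalgam hn hD.
Let mOm := manifold_Omega0 hD.
Let mOO := manifold_mprod mOm mOm.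

Definition good_open (U : set ('I_(cnum D) * (R * 'rV[R]_n) + 'rV[R]_n)) : Prop :=
  [/\ mopen (obj G) U, mopen (arr G) (arrows_over G U) & locally_action G U].

Lemma one_reduction U x : car (obj (reduction G U)) x ->
  car (arr (reduction G U)) (Defs.one G x).
Proof.
move=> [Ox Ux]; have [h _ _ _ _] := layer_groupoid_axioms hn hD.
have [s1 r1] := h x Ox; split; first exact: (layer_car_one hn hD).
split; first by change (U (src G (Defs.one G x))); rewrite s1.
by change (U (rng G (Defs.one G x))); rewrite r1.
Qed.

Lemma interior_arrows (W : set 'rV[R]_n) : W `<=` Omega0 ->
  arrows_over G (inr @` W) = inr @` (W `*` W).
Proof.
move=> WO; apply/seteqP; split=> [g [Ag [[q Wq Eq] [p Wp Ep]]]|_ [[p q] [Wp Wq] <-]].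
  have [[p' [q' [Op' Oq' E]]]|[i [s [x [y [s0 Lx Ly E]]]]]] := arr_cases hn hD Ag.
    move: Eq Ep; rewrite E => -[<-] [<-]; by exists (p, q).
  by move: Eq; rewrite E src_bd.
split; first by apply: (car_arr_int hn hD); apply: WO.
by split; [exists q|exists p].
Qed.

(** The space [eucl 0] acting on itself is a point with the trivial group. It gives the interior the
    same shape as a conical point, an action groupoid times a pair groupoid. *)
Lemma interior_iso (W : set 'rV[R]_n) : W `<=` Omega0 ->
  Lie_groupoid_iso (reduction G (inr @` W))
    (reduction (prod_groupoid (action_groupoid (eucl 0)
       (additive_group (eucl 0)) (fun x y : 'rV[R]_0 => x + y)) (pair_groupoid Om))
       (setT `*` W)).
Proof.
move=> WO; set Q := prod_groupoid _ _.
have mE := @manifold_eucl R 0; have mEE := manifold_mprod mE mE.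
have mQ : manifold (arr Q) := manifold_mprod mEE mOO.
pose h (g : 'I_(cnum D) * ((R * R) * ('rV[R]_n * 'rV[R]_n)) + 'rV[R]_n * 'rV[R]_n) :=
  if g is inr z then z else (0, 0).
pose hO (x : 'I_(cnum D) * (R * 'rV[R]_n) + 'rV[R]_n) := if x is inr p then p else 0.
have sh : smooth_on (arr G) (mprod Om Om) (inr @` (Omega0 `*` Omega0)) h.
  exact: (@smooth_amalgam_out _ _ _ _ _ _ _ aam None h (fun _ _ => erefl)).
have shO : smooth_on (obj G) Om (inr @` Omega0) hO.
  exact: (@smooth_amalgam_out _ _ _ _ _ _ _ oam None hO (fun _ _ => erefl)).
have iE : car (arr (reduction G (inr @` W))) = inr @` (W `*` W) := interior_arrows WO.
have iO : car (obj (reduction G (inr @` W))) = inr @` W.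
  apply/seteqP; split=> [_ [_ [p Wp <-]]|_ [p Wp <-]]; first by exists p.
  by split; [apply: (car_obj_int hn hD); apply: WO|exists p].
have rV0 (u v : 'rV[R]_0) : u = v by rewrite (thinmx0 u) (thinmx0 v).
have cQ a : car (arr (reduction Q (setT `*` W))) a <-> W a.2.1 /\ W a.2.2.
  split=> [[_ [[_ ?] [_ ?]]]//|[W1 W2]]; split; last by split.
  by split=> //; split; apply: WO.
exists (fun g => ((0, 0), h g)), (fun a => inr a.2).
exists (fun x => (0, hO x)), (fun y => inr y.2); split.
- split.
  + rewrite /smooth iE; apply: smooth_on_restr; apply: smooth_on_to_restr.
      by move=> _ [[p q] [Wp Wq] <-].
    have ZA : (inr @` (W `*` W)) `<=` car (arr G).
      by rewrite -iE => g [].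
    apply: smooth_on_pair.
      by apply: smooth_cst => //; exact: (manifold_amalgam aam).
    by apply: smooth_on_subset sh => _ [[p q] [Wp Wq] <-]; exists (p, q) => //; split; apply: WO.
  + apply: smooth_restr_restr.
      move=> [u [p q]] /= _ [[_ /= Wq] [_ /= Wp]].
      by split; [exists q|exists p].
    apply: (@smooth_on_comp _ _ _ _ (arr Q) (mprod Om Om) (arr G) _ _ snd _ mOO _ _
      (smooth_amalgam_in aam None)).
      by move=> a [[_ ?] _].
    by apply: smooth_on_subset (smooth_snd (mprod (eucl 0) (eucl 0)) mOO) => a [].
  + by rewrite iE => _ [[p q] _ <-].
  + move=> [[u v] [p q]] _ /=; congr (_, _, _); exact: rV0.
- split.
  + rewrite /smooth iO; apply: smooth_on_restr; apply: smooth_on_to_restr.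
      by move=> _ [p Wp <-].
    have ZA : (inr @` W) `<=` car (obj G).
      by rewrite -iO => g [].
    apply: smooth_on_pair.
      by apply: smooth_cst => //; exact: (manifold_amalgam oam).
    by apply: smooth_on_subset shO => _ [p Wp <-]; exists p => //; apply: WO.
  + apply: smooth_restr_restr; first by move=> [u p] _ [_ /= Wp]; exists p.
    apply: (@smooth_on_comp _ _ _ _ (obj Q) Om (obj G) _ _ snd _ mOm _ _
      (smooth_amalgam_in oam None)).
      by move=> a [[_ ?] _].
    by apply: smooth_on_subset (smooth_snd (eucl 0) mOm) => a [].
  + by rewrite iO => _ [p _ <-].
  + move=> [u p] _ /=; congr (_, _); exact: rV0.
- rewrite iE => _ [[p q] _ <-]; split=> //=; congr (_, _); exact: rV0.
- by rewrite iO => _ [p _ <-].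
- move=> g k [/= Gg Gk gk]; have : (inr @` (W `*` W)) g by rewrite -iE.
  have : (inr @` (W `*` W)) k by rewrite -iE.
  move=> [[p q] _ E] [[p' q'] _ E']; rewrite -E -E' /=.
  congr (_, _, _); exact: rV0.
Qed.

Lemma interior_piece p q r : Omega0 p -> Omega0 q -> Omega0 r ->
  exists2 U, good_open U & [/\ U (inr p), U (inr q) & U (inr r)].
Proof.
move=> Op Oq Or; have [_ hS _ _ _] := hD.
have pn : (n.-1 <= n)%N := leq_pred n.
have [|W [th [th' [[oW Ws] sth oth sth' thK]]]] := finite_points_sheets pn (s := [:: p; q; r]) hS.
  by move=> a; rewrite !inE => /or3P[] /eqP ->.
have WO : W `<=` Omega0 := oW.1.
exists (inr @` W); last first.
  by split; [exists p|exists q|exists r] => //; apply: Ws; rewrite !inE eqxx ?orbT.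
have mE := @manifold_eucl R 0.
split.
- exact: (mopen_amalgam_in oam (a := None) oW).
- rewrite interior_arrows //.
  exact: (mopen_amalgam_in aam (a := None) (mopen_mprod mOm mOm oW oW)).
- apply: (locally_action_of_sheets mE (Lie_group_eucl 0)
    (additive_action (smooth_eucl_add 0)) mOm (mopen_car mE) oW sth sth' thK
    (@mhausdorff_eucl R 0) oth (@one_reduction _)).
  exact: interior_iso.
Qed.

End LayerCover.

(** * Local models at the conical points *)

Section LayerBoundaryCharts.
Context {R : realType} {n : nat} (Omega : set 'rV[R]_n) (D : conical_data R n).
Hypotheses (hn : (2 <= n)%N) (hD : conical_domain Omega D).
Variable i : 'I_(cnum D).

Notation Omega0 := (smooth_part Omega D).
Notation Link := (submfd n.-2 (link_bd i)).
Notation G := (layer_groupoid Omega D).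
Notation P := (prod_groupoid (@dilation_groupoid R) (pair_groupoid Link)).
Notation Ji := (J_groupoid i).
Notation arr_i := (@arr_in R n D (Some i)).
Notation obj_i := (@obj_in R n D (Some i)).

Let oam := obj_amalgam hn hD.
Let aam := arr_amalgam hn hD.

(** A left inverse of the inclusion of the collar [i]; its values on the other collars are
    irrelevant. *)
Definition collar_obj (z : 'I_(cnum D) * (R * 'rV[R]_n) + 'rV[R]_n) :
    R * 'rV[R]_n :=
  match z with inl x => x.2 | inr p => polV i p end.

Definition collar_arr (g : 'I_(cnum D) * ((R * R) * ('rV[R]_n * 'rV[R]_n)) +
    'rV[R]_n * 'rV[R]_n) : (R * R) * ('rV[R]_n * 'rV[R]_n) :=
  match g with inl a => a.2 | inr z => polV_arrow i z end.

Lemma collarP t x : car (obj_piece Omega (Some i)) (t, x) <->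
  [/\ 0 <= t, t < 1 & link_bd i x].
Proof.
split=> [[_ [/= /andP[t0 t1] Lx]] //|[t0 t1 Lx]].
by split; split=> //=; rewrite t0.
Qed.

Lemma obj_i_pos t x : 0 < t -> obj_i (t, x) = inr (pol i (t, x)).
Proof. by move=> t0; rewrite /obj_in /= glue_in_in. Qed.

Lemma arr_i_pos t s x y : 0 < s -> 0 < t ->
  arr_i ((t, s), (x, y)) = inr (pol i (t, x), pol i (t * s^-1, y)).
Proof. by move=> s0 t0; rewrite /arr_in /= glue_in_in //; apply/polar_arrowsP. Qed.

Lemma collar_objK x : car (obj_piece Omega (Some i)) x ->
  collar_obj (obj_i x) = x.
Proof.
move: x => [t x] /collarP[t0 t1 Lx]; move: t0; rewrite le_eqVlt => /predU1P[<-|t0].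
  by rewrite /obj_in /= obj_in_bd.
by rewrite obj_i_pos //; apply: (polK hD) => //; exact: (link_bd_sphere hD Lx).
Qed.

Lemma collar_arrK a : car (arr Ji) a -> collar_arr (arr_i a) = a.
Proof.
move: a => [[t s] [x y]] /J_arrowsP[s0 [Lx Ly] t0 t1 ts1].
have x1 := link_bd_sphere hD Lx; have y1 := link_bd_sphere hD Ly.
move: t0; rewrite le_eqVlt => /predU1P[<-|t0].
  by rewrite /arr_in /= arr_in_bd.
have ts0 : 0 < t * s^-1 by rewrite divr_gt0.
rewrite arr_i_pos // /collar_arr /polV_arrow /fst /snd !(polK hD) //=.
by rewrite div_divK // gt_eqF.
Qed.

Lemma src_arr_i a : car (arr Ji) a -> src G (arr_i a) = obj_i (src Ji a).
Proof.
move: a => [[t s] [x y]] /J_arrowsP[s0 [Lx Ly] t0 t1 ts1].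
move: t0; rewrite le_eqVlt => /predU1P[<-|t0].
  by rewrite /arr_in /= arr_in_bd -[LHS]/(src G (bd_arr i s x y)) src_bd mul0r /obj_in /= obj_in_bd.
by rewrite arr_i_pos // -[src Ji _]/(t * s^-1, y) obj_i_pos // divr_gt0.
Qed.

Lemma rng_arr_i a : car (arr Ji) a -> rng G (arr_i a) = obj_i (rng Ji a).
Proof.
move: a => [[t s] [x y]] /J_arrowsP[s0 [Lx Ly] t0 t1 ts1].
move: t0; rewrite le_eqVlt => /predU1P[<-|t0].
  by rewrite /arr_in /= arr_in_bd -[LHS]/(rng G (bd_arr i s x y)) rng_bd /obj_in /= obj_in_bd.
by rewrite arr_i_pos // -[rng Ji _]/(t, x) obj_i_pos.
Qed.

Lemma one_obj_i x : car (obj_piece Omega (Some i)) x ->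
  Defs.one G (obj_i x) = arr_i (Defs.one Ji x).
Proof.
move: x => [t x] /collarP[t0 t1 Lx].
move: t0; rewrite le_eqVlt => /predU1P[<-|t0].
  by rewrite /obj_in /= obj_in_bd -[LHS]/(Defs.one G (bd_pt i x)) one_bd /arr_in /= arr_in_bd.
rewrite obj_i_pos // -[Defs.one Ji _]/((t, 1), (x, x)) arr_i_pos //.
by rewrite invr1 mulr1.
Qed.

Lemma mul_arr_i a b : car (arr Ji) a -> car (arr Ji) b -> src Ji a = rng Ji b ->
  Defs.mul G (arr_i a) (arr_i b) = arr_i (Defs.mul Ji a b).
Proof.
move: a b => [[t s] [x y]] [[t' s'] [x' y']] /J_arrowsP[s0 _ t0 _ _] /J_arrowsP[s0' _ _ _ _].
move=> [E1 E2]; rewrite /= in E1 E2; subst t' x'.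
rewrite -[Defs.mul Ji _ _]/((t, s' * s), (x, y')).
move: t0; rewrite le_eqVlt => /predU1P[<-|t0].
  by rewrite mul0r /arr_in /= !arr_in_bd; exact: mul_bd.
have ss0 : 0 < s' * s by rewrite mulr_gt0.
have ts0 : 0 < t * s^-1 by rewrite divr_gt0.
rewrite (arr_i_pos x y s0 t0) (arr_i_pos y y' s0' ts0) (arr_i_pos x y' ss0 t0).
by rewrite invfM mulrA mulrAC.
Qed.

Section Open.
Variable W : set 'rV[R]_n.
Hypothesis WL : W `<=` link_bd i.

Let C : set (R * 'rV[R]_n) := [set t : R | 0 <= t < 1] `*` W.
Let U := obj_i @` C.

Lemma C_collar x : C x -> car (obj_piece Omega (Some i)) x.
Proof. by move: x => [t x] [/= /andP[t0 t1] Wx]; apply/collarP; split=> //; apply: WL. Qed.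

Lemma P_arrows_over a : car (arr (reduction P C)) a <->
  car (arr Ji) a /\ (C (src Ji a) /\ C (rng Ji a)).
Proof.
split=> [[Pa [Cs Cr]]|[[Pa _] [Cs Cr]]].
  split; last exact: (conj Cs Cr).
  split; first exact: Pa.
  split; first by case: Cs => h1 /WL h2; exact: (conj h1 h2).
  by case: Cr => h1 /WL h2; exact: (conj h1 h2).
split; first exact: Pa.
exact: (conj Cs Cr).
Qed.

(** No arrow of the interior is missed: away from the vertex [J_groupoid i] is the full pair
    groupoid of the cone, so every pair of points of [U] with positive radii comes from it. *)
Lemma boundary_arrows : arrows_over G U = arr_i @` arrows_over Ji C.
Proof.
apply/seteqP; split=> [g|_ [a [Ja [Cs Cr]] <-]]; last first.
  split; first by apply/(amalgam_car aam); exists (Some i), a.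
  split; first by exists (src Ji a) => //; rewrite src_arr_i.
  by exists (rng Ji a) => //; rewrite rng_arr_i.
move=> [Ag [[[t y] Cy Ey] [[r x] Cx Ex]]].
have [/= /andP[t0 t1] Wy] := Cy; have [/= /andP[r0 r1] Wx] := Cx.
have Lx := WL Wx; have Ly := WL Wy.
have [[p [q [Op Oq E]]]|[j [s [x' [y' [s0 Lx' Ly' E]]]]]] := arr_cases hn hD Ag.
  rewrite E in Ey Ex.
  have tt0 : 0 < t.
    by move: t0 Ey; rewrite le_eqVlt => /predU1P[<-|//]; rewrite /obj_in /= obj_in_bd.
  have rr0 : 0 < r.
    by move: r0 Ex; rewrite le_eqVlt => /predU1P[<-|//]; rewrite /obj_in /= obj_in_bd.
  rewrite obj_i_pos // in Ey; rewrite obj_i_pos // in Ex.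
  case: Ey => Ey; case: Ex => Ex.
  (* The dilation factor [r * t^-1] is forced by the radii [r] of the range and [t] of the
     domain. *)
  have st : r * (r * t^-1)^-1 = t by rewrite div_divK // gt_eqF.
  exists ((r, r * t^-1), (x, y)); last first.
    rewrite -[LHS]/(arr_i ((r, r * t^-1), (x, y))) arr_i_pos ?divr_gt0 //.
    by rewrite st Ex Ey E.
  split; first by apply/J_arrowsP; rewrite st divr_gt0.
  by split; [rewrite /preimage /= st|].
rewrite E src_bd in Ey; rewrite E rng_bd in Ex.
have [tt0|tt0] := ltP 0 t; first by rewrite obj_i_pos in Ey.
have [rr0|rr0] := ltP 0 r; first by rewrite obj_i_pos in Ex.
have tE : t = 0 by apply/eqP; rewrite eq_le tt0 t0.
have rE : r = 0 by apply/eqP; rewrite eq_le rr0 r0.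
subst t r; rewrite /obj_in /= !obj_in_bd in Ey Ex.
case: Ey => ji yy; case: Ex => _ xx; subst j y' x'.
exists ((0, s), (x, y)); last by rewrite /arr_in /= arr_in_bd E.
split; first by apply/J_arrowsP; rewrite mul0r ltr01 lexx.
by split; [rewrite /preimage /= mul0r|].
Qed.

Lemma boundary_iso : Lie_groupoid_iso (reduction G U) (reduction P C).
Proof.
have mL := manifold_link hD i; have mC := manifold_cylinder hD i.
have mPA := manifold_P_arrows hD i.
have iE : car (arr (reduction G U)) = arr_i @` arrows_over Ji C := boundary_arrows.
have JC a : arrows_over Ji C a <-> car (arr (reduction P C)) a.
  by rewrite P_arrows_over; split=> [[? []]|[? []]].
have iO : car (obj (reduction G U)) = U.
  apply/seteqP; split=> [x []//|_ [x Cx <-]]; split; last by exists x.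
  by apply/(amalgam_car oam); exists (Some i), x; split=> //; apply: C_collar.
exists collar_arr, arr_i, collar_obj, obj_i; split.
- split.
  + rewrite /smooth iE; apply: smooth_on_restr; apply: smooth_on_to_restr.
      by move=> _ [a [Ja Ca] <-]; rewrite collar_arrK.
    apply: smooth_on_subset (_ : smooth_on _ _ (arr_i @` car (arr Ji)) _).
      by move=> _ [a [Ja _] <-]; exists a.
    have so : smooth_on (arr G) (arr Ji) (arr_i @` car (arr Ji)) collar_arr :=
      smooth_amalgam_out aam (a := Some i) collar_arrK.
    exact: (@smooth_on_into_restr _ _ _ (arr G) (arr P) _ _ _ so).
  + apply: smooth_restr_restr.
      move=> a Pa Ca; have /JC[Ja [Cs Cr]] : car (arr (reduction P C)) a by [].
      by split; [exists (src Ji a) => //; rewrite src_arr_i|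
                 exists (rng Ji a) => //; rewrite rng_arr_i].
    have sub : car (arr Ji) `<=`
        src P @^-1` ([set t : R | 0 <= t < 1] `*` link_bd i) `&`
        rng P @^-1` ([set t : R | 0 <= t < 1] `*` link_bd i) by move=> a [].
    have si : smooth (arr Ji) (arr G) arr_i := smooth_amalgam_in aam (Some i).
    apply: smooth_on_subset (@smooth_on_from_restr _ _ _ (arr P) (arr G) _ _ _ sub si).
    by move=> a Za; have /JC[] : car (arr (reduction P C)) a by [].
  + by rewrite iE => _ [a [Ja _] <-]; rewrite collar_arrK.
  + by move=> a /JC[Ja _]; rewrite collar_arrK.
- split.
  + rewrite /smooth iO; apply: smooth_on_restr; apply: smooth_on_to_restr.
      by move=> _ [x Cx <-]; rewrite collar_objK //; apply: C_collar.
    apply: smooth_on_subset (_ : smooth_on _ _ (obj_i @` car (obj_piece Omega (Some i))) _).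
      by move=> _ [x Cx <-]; exists x => //; apply: C_collar.
    have so : smooth_on (obj G) (obj_piece Omega (Some i))
        (obj_i @` car (obj_piece Omega (Some i))) collar_obj :=
      smooth_amalgam_out oam (a := Some i) collar_objK.
    exact: (@smooth_on_into_restr _ _ _ (obj G) (mprod half_line Link) _ _ _ so).
  + apply: smooth_restr_restr; first by move=> x _ Cx; exists x.
    have sub : car (obj_piece Omega (Some i)) `<=` [set t : R | 0 <= t < 1] `*` link_bd i.
      by move=> a [].
    have si : smooth (obj_piece Omega (Some i)) (obj G) obj_i :=
      smooth_amalgam_in oam (Some i).
    apply: smooth_on_subset
      (@smooth_on_from_restr _ _ _ (mprod half_line Link) (obj G) _ _ _ sub si).
    by move=> x [_ Cx]; apply: C_collar.
  + by rewrite iO => _ [x Cx <-]; rewrite collar_objK //; apply: C_collar.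
  + by move=> x [_ Cx]; rewrite collar_objK //; apply: C_collar.
- rewrite iE => _ [a [Ja [Cs Cr]] <-]; rewrite collar_arrK //.
  rewrite -[src (reduction G U) _]/(src G (arr_i a)) src_arr_i // collar_objK; last exact: C_collar.
  by rewrite -[rng (reduction G U) _]/(rng G (arr_i a)) rng_arr_i // collar_objK; last exact: C_collar.
- rewrite iO => _ [x Cx <-]; have Mx := C_collar Cx; rewrite collar_objK //.
  rewrite -[Defs.one (reduction G U) _]/(Defs.one G (obj_i x)) one_obj_i // collar_arrK //.
  move: x Cx {Mx} => [t x] [/= /andP[t0 t1] /WL Lx].
  by apply/J_arrowsP; rewrite invr1 mulr1; split.
- move=> g h [Gg Gh gh].
  have : (arr_i @` arrows_over Ji C) g by rewrite -iE.
  have : (arr_i @` arrows_over Ji C) h by rewrite -iE.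
  move=> [b [Jb [Csb Crb]] Eb] [a [Ja [Csa Cra]] Ea]; subst g h.
  have ab : src Ji a = rng Ji b.
    have : src G (arr_i a) = rng G (arr_i b) := gh.
    rewrite src_arr_i // rng_arr_i // => /(congr1 collar_obj).
    by rewrite !collar_objK //; exact: C_collar.
  rewrite -[Defs.mul (reduction G U) _ _]/(Defs.mul G (arr_i a) (arr_i b)) mul_arr_i //.
  rewrite !collar_arrK //.
  move: a b Ja Jb {Gg Gh gh Csa Cra Csb Crb} ab => [[t s] [x y]] [[t' s'] [x' y']].
  move=> /J_arrowsP[s0 [Lx Ly] t0 t1 ts1] /J_arrowsP[s0' [Lx' Ly'] t0' t1' ts1'].
  move=> [E1 _]; rewrite /= in E1; apply/J_arrowsP.
  by rewrite mulr_gt0 // invfM mulrA mulrAC E1.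
Qed.

End Open.

Lemma boundary_piece x y z : link_bd i x -> link_bd i y -> link_bd i z ->
  exists2 U, good_open Omega U & [/\ U (bd_pt i x), U (bd_pt i y) & U (bd_pt i z)].
Proof.
move=> Lx Ly Lz; have mL := manifold_link hD i; have hS := is_submfd_link hD.
have [|W [th [th' [[oW Ws] sth oth sth' thK]]]] :=
    finite_points_sheets (@le_pred2 n) (s := [:: x; y; z]) (hS i).
  by move=> a; rewrite !inE => /or3P[] /eqP ->.
have WL : W `<=` link_bd i := oW.1.
have mH := @manifold_half_line R.
have oC : mopen (mprod half_line Link) ([set t : R | 0 <= t < 1] `*` W).
  by apply: mopen_mprod => //; exact: mopen_collar.
exists (obj_i @` ([set t : R | 0 <= t < 1] `*` W)); last first.
  by split; [exists (0, x)|exists (0, y)|exists (0, z)];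
    rewrite /obj_in /= ?obj_in_bd //; split;
    rewrite /= ?lexx ?ltr01 //; apply: Ws; rewrite !inE eqxx ?orbT.
split.
- apply: (mopen_amalgam_in oam (a := Some i)).
  apply/mopen_restr; [exact: (manifold_cylinder hD i)|exact: (mopen_cylinder hD i)|].
  by split=> // t [? /WL].
- rewrite boundary_arrows //; apply: (mopen_amalgam_in aam (a := Some i)).
  exact: (J_arrows_mopen hD oC).
- apply: (locally_action_of_sheets mH (@Lie_group_positive R) (@dilation_action R)
    mL (@mopen_collar R) oW sth sth' thK (@mhausdorff_half_line R) oth
    (one_reduction hn hD (U := _))).
  exact: boundary_iso.
Qed.

End LayerBoundaryCharts.

(** * The open dense orbit *)

Section LayerInterior.
Context {R : realType} {n : nat} (Omega : set 'rV[R]_n) (D : conical_data R n).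
Hypotheses (hn : (2 <= n)%N) (hD : conical_domain Omega D).

Notation Omega0 := (smooth_part Omega D).
Notation G := (layer_groupoid Omega D).
Notation interior := (@inr ('I_(cnum D) * (R * 'rV[R]_n)) _ @` Omega0).

Let oam := obj_amalgam hn hD.
Let aam := arr_amalgam hn hD.
Let mOm := manifold_Omega0 hD.
Let mOO := manifold_mprod mOm mOm.

Lemma interior_invariant : invariant_set G interior.
Proof.
apply/seteqP; split=> [_ [g [Ag [q Oq Eq]] <-]|_ [p Op <-]].
  have [[p' [q' [Op' Oq' ->]]]|[i [s [x [y [s0 Lx Ly E]]]]]] := arr_cases hn hD Ag.
    by exists p'.
  by move: Eq; rewrite E src_bd.
exists (inr (p, p)) => //; split; first exact: (car_arr_int hn hD).
by exists p.
Qed.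

Lemma interior_pair_iso :
  Lie_groupoid_iso (reduction G interior) (pair_groupoid (restr (obj G) interior)).
Proof.
have mO := manifold_amalgam oam.
pose hA (g : 'I_(cnum D) * ((R * R) * ('rV[R]_n * 'rV[R]_n)) + 'rV[R]_n * 'rV[R]_n) :=
  if g is inr z then z else (0, 0).
pose hO (x : 'I_(cnum D) * (R * 'rV[R]_n) + 'rV[R]_n) := if x is inr p then p else 0.
have shA : smooth_on (arr G) (mprod (submfd n.-1 Omega0) (submfd n.-1 Omega0))
    (inr @` (Omega0 `*` Omega0)) hA.
  exact: (@smooth_amalgam_out _ _ _ _ _ _ _ aam None hA (fun _ _ => erefl)).
have shO : smooth_on (obj G) (submfd n.-1 Omega0) interior hO.
  exact: (@smooth_amalgam_out _ _ _ _ _ _ _ oam None hO (fun _ _ => erefl)).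
have sub : Omega0 `<=` Omega0 by [].
have iE : car (arr (reduction G interior)) = inr @` (Omega0 `*` Omega0) :=
  interior_arrows hn hD sub.
have iO : car (obj (reduction G interior)) = interior.
  apply/seteqP; split=> [_ [_ [p Op <-]]|_ [p Op <-]]; first by exists p.
  by split; [apply: (car_obj_int hn hD)|exists p].
have sin := smooth_amalgam_in oam None.
have oI : mopen (obj G) interior.
  exact: (mopen_amalgam_in oam (a := None) (mopen_car mOm)).
have mI := manifold_restr mO oI.
exists (fun g => (inr (hA g).1, inr (hA g).2)).
exists (fun z => inr (hO z.1, hO z.2)), idfun, idfun; split.
- split.
  + rewrite /smooth iE; apply: smooth_on_restr.
    apply: smooth_on_pair; apply: smooth_on_to_restr.
    * by move=> _ [[p q] [Op Oq] <-]; exists p.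
    * have s1 := smooth_on_comp mOO shA.1 shA (smooth_fst _ mOm).
      exact: (smooth_on_comp mOm s1.1 s1 sin).
    * by move=> _ [[p q] [Op Oq] <-]; exists q.
    * have s2 := smooth_on_comp mOO shA.1 shA (smooth_snd _ mOm).
      exact: (smooth_on_comp mOm s2.1 s2 sin).
  + apply: smooth_on_to_restr.
      by move=> _ [[_ [p Op <-]] [_ [q Oq <-]]]; split; [exists q|exists p].
    apply: (@smooth_on_comp _ _ _ _ _ _ (arr G) _ _ (fun z => (hO z.1, hO z.2)) _ mOO _ _
      (smooth_amalgam_in aam None)).
      by move=> z [[_ /= [p Op <-]] [_ /= [q Oq <-]]]; split.
    have s1 := smooth_fst (restr (obj G) interior) mI.
    have s2 := smooth_snd (restr (obj G) interior) mI.
    have sr : smooth_on (restr (obj G) interior) (submfd n.-1 Omega0)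
        (car (restr (obj G) interior)) hO.
      by apply: smooth_on_restr; apply: smooth_on_subset shO => x [].
    apply: smooth_on_pair.
      exact: (smooth_on_comp mI s1.1 s1 sr).
    exact: (smooth_on_comp mI s2.1 s2 sr).
  + by rewrite iE => _ [[p q] _ <-].
  + by move=> [_ _] [[_ /= [p Op <-]] [_ /= [q Oq <-]]].
- by split=> //; apply: manifold_id.
- by rewrite iE => _ [[p q] _ <-].
- by rewrite iO => _ [p _ <-].
- move=> g k [/= Gg Gk gk]; have : (inr @` (Omega0 `*` Omega0)) g by rewrite -iE.
  have : (inr @` (Omega0 `*` Omega0)) k by rewrite -iE.
  by move=> [[p q] _ <-] [[p' q'] _ <-].
Qed.

End LayerInterior.

Theorem theorem4p7 (R : realType) (n : nat) (Omega : set 'rV[R]_n)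
    (D : conical_data R n) :
  (2 <= n)%N ->
  conical_domain Omega D ->
  without_cracks Omega ->
  boundary_action_groupoid (layer_groupoid Omega D).
Proof.
move=> hn hD _; set G := layer_groupoid Omega D.
have aam := arr_amalgam hn hD; have oam := obj_amalgam hn hD.
have mA : manifold (arr G) := manifold_amalgam aam.
have mO : manifold (obj G) := manifold_amalgam oam.
(* The cover consists of all good open sets, indexed by themselves, which avoids choosing a piece
   for each composable pair. *)
pose U (V : {V : set ('I_(cnum D) * (R * 'rV[R]_n) + 'rV[R]_n) |
  good_open Omega V}) := sval V.
have gluing : weak_gluing G U.
  move=> g h gh; have [Ag Ah _] := gh.
  case: (composable_cases hn hD gh).
    move=> [p [q [r [Op Oq Or gE hE]]]].
    have [V gV [Vp Vq Vr]] := interior_piece hn hD Op Oq Or.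
    by exists (exist _ V gV); rewrite gE hE in Ag Ah *; split.
  move=> [i [s [s' [x [y [z [_ [Lx Ly Lz] gE hE]]]]]]].
  have [V gV [Vx Vy Vz]] := boundary_piece hn hD Lx Ly Lz.
  exists (exist _ V gV); split; split=> //; split; rewrite ?gE ?hE.
  - by change (V (src G (bd_arr i s x y))); rewrite src_bd.
  - by change (V (rng G (bd_arr i s x y))); rewrite rng_bd.
  - by change (V (src G (bd_arr i s' y z))); rewrite src_bd.
  - by change (V (rng G (bd_arr i s' y z))); rewrite rng_bd.
have [oU oAU aU] : [/\ forall V, mopen (obj G) (U V),
    forall V, mopen (arr G) (arrows_over G (U V))
  & forall V, locally_action G (U V)].
  by split; case=> V [].
split.
- exact: (Lie_groupoid_of_cover mA mO (layer_groupoid_axioms hn hD)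
    (layer_car_srng hn hD) (layer_car_one hn hD) (layer_car_inv hn hD)
    (layer_car_mul hn hD) (layer_obj_mhausdorff hn hD) oU oAU aU gluing).
- exists (@inr _ _ @` smooth_part Omega D); split.
  + exact: (mopen_amalgam_in oam (a := None) (mopen_car (manifold_Omega0 hD))).
  + exact: layer_obj_dense.
  + exact: interior_invariant.
  + exact: interior_pair_iso.
- exists _, U; split=> //; apply/seteqP; split=> [x Ox|x [V _ Vx]]; last exact: (oU V).1.
  have [[p Op ->]|[i [y [Ly ->]]]] := obj_cases hn hD Ox.
    (* A single object is caught by repeating it three times. *)
    have [V gV [Vp _ _]] := interior_piece hn hD Op Op Op.
    by exists (exist _ V gV).
  have [V gV [Vy _ _]] := boundary_piece hn hD Ly Ly Ly.
  by exists (exist _ V gV).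
Qed.
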